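(* Let $G=(V,E)$ be a connected outerplanar graph on $n$ vertices with maximum degree at most $\Delta$, accessible only through a distance oracle. There is a randomized algorithm for the metric reconstruction problem on $G$ with query complexity $O(\Delta\cdot n\log^3 n)$ (which is $\tilde{O}(n)$ when $\Delta$ is constant).
   Context: Query model: the vertex set $V$ of a connected unweighted graph $G$ is given, and its shortest-path metric $\delta$ is accessible only through an oracle returning $\delta(u,v)$ for a queried pair $(u,v)\in V^2$. The metric reconstruction problem is to determine $\delta$ on all pairs (equivalently, the edge set). Query complexity is the number of oracle queries. A graph is outerplanar if it can be embedded in the plane with all vertices on the exterior face. *)

(* Defs.v *)
(* MathComp and MathComp-Analysis. *)
From HB Require Import structures.
From mathcomp Require Import all_boot all_order all_algebra.
From mathcomp Require Import all_classical all_reals all_analysis.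

Set Implicit Arguments.
Unset Strict Implicit.
Unset Printing Implicit Defensive.

Import Order.TTheory GRing.Theory Num.Theory.
Import numFieldNormedType.Exports.

Local Open Scope classical_set_scope.
Local Open Scope ring_scope.

Section Graphs.
Variable V : finType.
Implicit Types e : rel V.

Definition simple_graph e := symmetric e /\ irreflexive e.

Definition connected_graph e := forall u v : V, connect e u v.

Definition max_degree_le e (Delta : nat) :=
  forall v : V, (#|[set w | e v w]%SET| <= Delta)%N.

Definition walk_of_length e (u v : V) (k : nat) : bool :=
  [exists p : k.-tuple V, path e u p && (last u p == v)].

(* A shortest walk repeats no vertex, hence has length < #|V|; the value is
   #|V| when u and v are not connected. *)
Definition gdist e (u v : V) : nat := find (walk_of_length e u v) (iota 0 #|V|).

End Graphs.

Section Outerplanarity.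
Variables (R : realType) (V : finType).
Implicit Types (e : rel V) (f : V -> R * R) (g : V -> V -> R -> R * R).

(* f places the vertices and g u v parametrizes on [0, 1] the arc that draws
   the edge uv, from f u to f v; the values of g on non-edges and outside
   [0, 1] are irrelevant. *)
Record plane_drawing e f g : Prop := PlaneDrawing {
  drawing_vertex_inj : injective f;
  drawing_arc_continuous : forall u v, e u v ->
    {within `[0, 1], continuous (g u v)};
  drawing_arc_inj : forall u v, e u v -> {in `[0, 1] &, injective (g u v)};
  drawing_arc_start : forall u v, e u v -> g u v 0 = f u;
  drawing_arc_end : forall u v, e u v -> g u v 1 = f v;
  drawing_arc_sym : forall u v, e u v -> g u v @` `[0, 1] = g v u @` `[0, 1];
  drawing_arc_vertex : forall u v w, e u v -> ~ (g u v @` `]0, 1[) (f w);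
  drawing_arc_disjoint : forall u v x y, e u v -> e x y ->
    [set u; v]%SET <> [set x; y]%SET ->
    g u v @` `]0, 1[ `&` g x y @` `]0, 1[ = set0
}.

Definition drawing_support e f g : set (R * R) :=
  range f `|` [set p | exists u v, e u v /\ (g u v @` `[0, 1]) p].

Definition face (D F : set (R * R)) : Prop :=
  exists2 p, (~` D) p & F = connected_component (~` D) p.

(* The exterior face is the unbounded one; it is unique because the support of
   a drawing is compact. A vertex lies on a face when it is on its boundary;
   as vertices belong to the support, being in the closure amounts to that. *)
Definition outerplanar e : Prop :=
  exists f g, plane_drawing e f g /\
  exists F, [/\ face (drawing_support e f g) F, ~ bounded_set F &
    forall v, closure F (f v)].

End Outerplanarity.

Section QueryAlgorithms.
Variable V : finType.

(* Randomized decision trees over a known vertex set V: a tree either outputs a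
   matrix of distances, queries the oracle on (u, v) and branches on the answer,
   or draws i uniformly in {0, ..., m} and branches on i. *)
Inductive query_alg : Type :=
| Output of (V -> V -> nat)
| Query of V & V & (nat -> query_alg)
| Random (m : nat) of ('I_m.+1 -> query_alg).

Fixpoint always_reconstructs (delta : V -> V -> nat) (a : query_alg) : Prop :=
  match a with
  | Output d => forall u v, d u v = delta u v
  | Query u v k => always_reconstructs delta (k (delta u v))
  | Random m k => forall i, always_reconstructs delta (k i)
  end.

Fixpoint expected_queries (R : realType) (delta : V -> V -> nat)
    (a : query_alg) : R :=
  match a with
  | Output _ => 0
  | Query u v k => 1 + expected_queries R delta (k (delta u v))
  | Random m k => (\sum_(i < m.+1) expected_queries R delta (k i)) / m.+1%:R
  end.

End QueryAlgorithms.

(* Main.v *)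
Require Import Defs.
From mathcomp Require Import all_boot.
From mathcomp Require Import zify.

(** Outerplanar graphs contain no asteroid: connected sets Pu, Pv, Pw joining a
    vertex r to u, v, w such that u, v are connected off Pw, u, w off Pv and
    v, w off Pu. Indeed, prolong the drawing of each of r, u, v, w through the
    exterior face up to a point at height H and count crossings modulo 2: the
    chain going down to u, along a walk to w and back up meets the chain through
    r and v only in the four pairs of prolongations. The parity of crossings of
    two chains whose ends are at the top depends only on the order of these
    ends, and the three parities obtained in this way are incompatible.

    The algorithm keeps a list of regions C, the distances between C and its
    boundary and between C and the neighbours of its boundary being known, so
    that for Z in C the components of C minus Z cost O(Delta |Z| |C|) queries.
    Given an induced path P in C, asteroid-freeness provides cuts of at most
    three vertices at each position of P, and a binary search yields a set Z of
    six vertices such that the components of C minus Z meeting P have at most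
    |C|/2 vertices. The boundary of C is the union of A, connected outside C,
    and of R. If R is not empty, P is part of a shortest
    path from A to R, so a component missing P has a larger connected part in
    its boundary. If R is empty, P is a shortest path from A to a random vertex,
    and by asteroid-freeness at least half of the vertices give a path such that
    the components missing it have at most 9/10 |C| vertices. The potential
    |C| (c ln |C| + |R| + 8) then bounds the expected number of queries. *)

Set Implicit Arguments.
Unset Strict Implicit.
Unset Printing Implicit Defensive.

(** * Walks and distances *)

Section WalksWithin.
Variables (V : finType) (e : rel V).
Implicit Types (A B : {set V}) (x y z : V).

(** Outerplanarity enters through [asteroid_free] alone, a statement on walks and vertex sets; the
    plane serves only to prove it. The oracle measures distances in the whole graph, whereas the
    components of C minus Z live in an induced subgraph. A geodesic leaves C only through the
    boundary, so comparing the distances from the boundary and from its neighbours detects geodesics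
    that stay inside; hence the rows carried by a region. Children inherit these rows, and a step
    pays only for the at most six new vertices, however large the boundary has become. The obstacle
    is a path missed by a component of almost full size, which the cuts do not control. If R is not
    empty, R then loses a vertex. If R is empty, nothing can be gained there, and randomness makes
    such a component unlikely. A vertex enters R only when the region is halved or in a random step,
    so ln |C| can pay for it. Of the three logarithms, two come from the search over positions of P,
    each position requiring a search for its own cut, and one comes from the potential. *)

Definition walk_within A x y :=
  (x \in A) && connect [rel a b | (a \in A) && (b \in A) && e a b] x y.

Definition comp_within A x := [set y | walk_within A x y].

Lemma walk_withinP A x y :
  reflect (exists p, [/\ path e x p, last x p = y & {subset x :: p <= A}])
    (walk_within A x y).
Proof.
apply: (iffP andP) => [[xA /connectP[p pp ->]]|[p [pp <- sub]]].
  exists p; split=> //; first by apply: sub_path pp => a b /= /andP[].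
  move=> z; rewrite inE => /predU1P[->//|].
  elim: p x xA pp => //= b p IH x xA /andP[/andP[/andP[_ bA] _] pp].
  by rewrite inE => /predU1P[->//|]; exact: IH pp.
split; first by apply: sub; exact: mem_head.
apply/connectP; exists p => //; elim: p x pp sub => //= b p IH x /andP[exb pp] sub.
rewrite exb !sub ?mem_head //= ?IH //; last by rewrite !inE eqxx orbT.
by move=> z hz; apply: sub; rewrite inE hz orbT.
Qed.

Lemma walk_within_refl A x : x \in A -> walk_within A x x.
Proof. by move=> xA; rewrite /walk_within xA connect0. Qed.

Lemma walk_within_l A x y : walk_within A x y -> x \in A.
Proof. by case/andP. Qed.

Lemma walk_within_r A x y : walk_within A x y -> y \in A.
Proof. by case/walk_withinP => p [_ <- sub]; apply: sub; exact: mem_last. Qed.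

Lemma walk_within_sub A B x y :
  A \subset B -> walk_within A x y -> walk_within B x y.
Proof.
move=> /subsetP AB /walk_withinP[p [pp lp sub]]; apply/walk_withinP.
by exists p; split=> // z /sub/AB.
Qed.

Lemma walk_within_trans A : transitive (walk_within A).
Proof.
move=> y x z /andP[xA h] /andP[_ h']; rewrite /walk_within xA.
exact: connect_trans h'.
Qed.

Lemma walk_within_edge A x y : x \in A -> y \in A -> e x y -> walk_within A x y.
Proof. by move=> xA yA exy; rewrite /walk_within xA connect1 //= xA yA. Qed.

Lemma walk_within_closed A (S : {set V}) x y : x \in S ->
  (forall a b, a \in S -> a \in A -> b \in A -> e a b -> b \in S) ->
  walk_within A x y -> y \in S.
Proof.
move=> xS cl /walk_withinP[p [pp <- sub]].
elim: p x xS pp sub => //= b p IH x xS /andP[exb pp] sub.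
apply: IH => //; last by move=> z hz; apply: sub; rewrite inE hz orbT.
by apply: cl exb => //; apply: sub; rewrite !inE eqxx ?orbT.
Qed.

Hypothesis esym : symmetric e.

Lemma walk_within_sym A x y : walk_within A x y = walk_within A y x.
Proof.
suff H a b : walk_within A a b -> walk_within A b a by apply/idP/idP; exact: H.
move=> h; have bA := walk_within_r h; case/andP: h => aA h; rewrite /walk_within bA.
rewrite sym_connect_sym // => u v /=.
by rewrite esym (andbC (u \in A)).
Qed.

End WalksWithin.

Section Distance.
Variables (V : finType) (e : rel V).
Hypotheses (esym : symmetric e) (eirr : irreflexive e) (econ : connected_graph e).
Implicit Types x y z : V.
Notation d := (gdist e).

Lemma walk_of_lengthP x y k :
  reflect (exists p, [/\ path e x p, last x p = y & size p = k])
    (walk_of_length e x y k).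
Proof.
apply: (iffP existsP) => [[p /andP[pp /eqP lp]]|[p [pp lp <-]]].
  by exists p; split=> //; exact: size_tuple.
by exists (in_tuple p); rewrite pp lp eqxx.
Qed.

Lemma gdist_lt_card x y : d x y < #|V|.
Proof.
have /connectP[p pp ->] := econ x y.
case/shortenP: pp => q pq uq _; set y' := last x q.
have sq : size q < #|V| by have := max_card (mem (x :: q)); rewrite (card_uniqP uq).
rewrite -[#|V|](size_iota 0) -has_find; apply/hasP; exists (size q).
  by rewrite mem_iota.
by apply/walk_of_lengthP; exists q.
Qed.

Lemma gdist_walk x y : exists p, [/\ path e x p, last x p = y & size p = d x y].
Proof.
apply/walk_of_lengthP; have := gdist_lt_card x y.
rewrite -[X in _ < X -> _](size_iota 0) -has_find => hs.
have := nth_find 0 hs; rewrite nth_iota //.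
by move: hs; rewrite has_find size_iota.
Qed.

Lemma gdist_le_walk x p : path e x p -> d x (last x p) <= size p.
Proof.
move=> pp; have [q pq uq sub] := shortenP pp.
have sq : size q < #|V| by have := max_card (mem (x :: q)); rewrite (card_uniqP uq).
have sqp : size q <= size p by apply: uniq_leq_size sub; case/andP: uq.
apply: leq_trans sqp.
rewrite leqNgt; apply/negP => /(before_find 0).
rewrite nth_iota // add0n => h.
suff : walk_of_length e x (last x q) (size q) by rewrite h.
by apply/walk_of_lengthP; exists q.
Qed.

Lemma gdistxx x : d x x = 0.
Proof. by apply/eqP; rewrite -leqn0; have := @gdist_le_walk x [::] isT. Qed.

Lemma gdist_eq0 x y : (d x y == 0) = (x == y).
Proof.
apply/eqP/eqP => [h|->]; last exact: gdistxx.
by have [p [_ lp sp]] := gdist_walk x y; rewrite h in sp; rewrite -lp (size0nil sp).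
Qed.

Lemma gdist_sym x y : d x y = d y x.
Proof.
suff H a b : d a b <= d b a by apply/eqP; rewrite eqn_leq !H.
have [p [pp <- <-]] := gdist_walk b a.
have := @gdist_le_walk (last b p) (rev (belast b p)).
rewrite size_rev size_belast rev_path (eq_path (e' := e)); last first.
  by move=> u v; rewrite esym.
move=> /(_ pp); suff -> : last (last b p) (rev (belast b p)) = b by [].
by case: p {pp} => //= c p; rewrite rev_cons last_rcons.
Qed.

Lemma gdist_triangle y x z : d x z <= d x y + d y z.
Proof.
have [p [pp lp <-]] := gdist_walk x y; have [q [pq lq <-]] := gdist_walk y z.
have := @gdist_le_walk x (p ++ q); rewrite cat_path pp last_cat lp lq size_cat.
exact.
Qed.

Lemma gdist_edge x y : (d x y == 1) = e x y.
Proof.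
apply/eqP/idP => [h|exy].
  have [[|a [|? ?]] //= [pp]] := gdist_walk x y; rewrite ?h //.
  by move: pp => /andP[+ _] <-.
apply/eqP; rewrite eqn_leq (@gdist_le_walk x [:: y]) /= ?exy //.
by rewrite lt0n gdist_eq0; apply: contraTneq exy => ->; rewrite eirr.
Qed.

Lemma gdist_edge_le x y z : e x y -> d x z <= (d y z).+1.
Proof. by rewrite -gdist_edge => /eqP h; have := gdist_triangle y x z; rewrite h. Qed.

Lemma gdist_next x y : x != y -> exists2 z, e x z & d x y = (d z y).+1.
Proof.
have [[|z p] /= [pp lp sp]] := gdist_walk x y; first by rewrite lp eqxx.
move=> _; case/andP: pp => exz pp; exists z => //.
apply/eqP; rewrite eqn_leq gdist_edge_le // -sp ltnS -lp.
exact: gdist_le_walk.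
Qed.

End Distance.

(** * Separators *)

Section Separation.
Variables (V : finType) (e : rel V).
Hypotheses (esym : symmetric e) (eirr : irreflexive e).
Implicit Types (A B C S Z : {set V}) (x y z : V) (P : seq V).
Notation ww := (walk_within e).

(** [Pu], [Pv], [Pw] may overlap at will, and so may the three connecting walks; each connection
    only avoids the opposite set. Walks found in a graph can thus be plugged in without being made
    disjoint. *)
Definition asteroid_free := forall r u v w (Pu Pv Pw : {set V}),
  ww Pu r u -> ww Pv r v -> ww Pw r w ->
  ww (~: Pw) u v -> ww (~: Pv) u w -> ww (~: Pu) v w -> False.

(** From any vertex of the walk, the rest of the walk leads to [y], so no vertex of [Z] occurs on
    it. *)
Lemma walk_within_avoid A Z x y :
  (forall z, z \in Z -> ~~ ww A z y) -> ww A x y -> ww (A :\: Z) x y.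
Proof.
move=> hZ h; apply/walk_withinP.
have /walk_withinP[p [pp lp sub]] := h; exists p; split=> // z zp.
rewrite inE sub // andbT; apply/negP => /hZ /negP; apply; apply/walk_withinP.
case/splitPl: zp pp lp sub => p1 p2 <-; rewrite cat_path last_cat => /andP[_ pp2] lp sub.
exists p2; split=> // z' hz'; apply: sub.
by move: hz'; rewrite inE => /predU1P[->|h']; rewrite -cat_cons mem_cat ?mem_last // h' orbT.
Qed.

Definition induced_path C P :=
  [/\ 0 < size P, uniq P, {subset P <= C},
     forall x0 i, i.+1 < size P -> e (nth x0 P i) (nth x0 P i.+1) &
     forall x0 i j, i < size P -> j < size P -> e (nth x0 P i) (nth x0 P j) ->
       i = j.+1 \/ j = i.+1].

Section OnePath.
Variables (C : {set V}) (P : seq V) (x0 : V).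
Hypothesis indP : induced_path C P.
Notation p i := (nth x0 P i).

Lemma path_inj i j : i < size P -> j < size P -> (p i == p j) = (i == j).
Proof. by case: indP => _ uP _ _ _ hi hj; rewrite nth_uniq. Qed.

Lemma path_in i : i < size P -> p i \in C.
Proof. by case: indP => _ _ sub _ _ hi; apply: sub; rewrite mem_nth. Qed.

Lemma path_walk A a b : a <= b -> b < size P ->
  (forall j, a <= j <= b -> p j \in A) -> ww A (p a) (p b).
Proof.
move=> ab bP; have -> : b = a + (b - a) by rewrite subnKC.
have : a + (b - a) < size P by rewrite subnKC.
elim: (b - a) => [|n IH] h hA.
  by rewrite addn0; apply: walk_within_refl; apply: hA; rewrite leqnn leq_addr.
apply: (walk_within_trans (IH _ _)).
- by apply: leq_ltn_trans h; rewrite addnS.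
- by move=> j /andP[h1 h2]; apply: hA; rewrite h1 addnS leqW.
- case: indP => _ _ _ adj _; rewrite addnS; apply: walk_within_edge.
  + by apply: hA; rewrite leq_addr addnS leqnSn.
  + by apply: hA; rewrite addnS ltnW ?leqnn // ltnS leq_addr.
  + by apply: adj; rewrite -addnS.
Qed.

Lemma path_walk_back A a b : a <= b -> b < size P ->
  (forall j, a <= j <= b -> p j \in A) -> ww A (p b) (p a).
Proof. by move=> h1 h2 h3; rewrite walk_within_sym //; exact: path_walk. Qed.

(* That is, {p k, p i} cuts p (i - 1) off the part of P after p i. *)
Definition isolated i k :=
  (k.+1 == i) || ~~ ww (C :\: [set p k; p i]) (p i.-1) (p i.+1).

(** Along [P], the vertices strictly between [p k] and [p i] stay joined to [p i.-1] off the pair,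
    and those after [p i] to [p i.+1]; the test on these two neighbours of [p i] therefore decides
    for all pairs. *)
Lemma isolated_sep i k a b : k < i -> i.+1 < size P -> isolated i k ->
  k < a < i -> i < b < size P ->
  ~~ ww (C :\: [set p k; p i]) (p a) (p b).
Proof.
move=> ki iP iso /andP[ka ai] /andP[ib bP]; apply/negP => h.
move: iso; rewrite /isolated => /orP[/eqP ki'|/negP]; first by move: ka ai; lia.
apply; have inA j : j < size P -> j != k -> j != i -> p j \in C :\: [set p k; p i].
  move=> jP jk ji; rewrite !inE path_in // !path_inj ?(negbTE jk) ?(negbTE ji) //;
  by lia.
apply: (@walk_within_trans _ _ _ (p a)).
  by apply: path_walk_back; [lia|lia|move=> j hj; apply: inA; lia].
apply: (walk_within_trans h).
by apply: path_walk_back; [lia|lia|move=> j hj; apply: inA; lia].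
Qed.

Lemma isolated0_sep i a b : 0 < i -> i.+1 < size P -> isolated i 0 ->
  a < i -> i < b < size P -> ~~ ww (C :\: [set p 0; p i]) (p a) (p b).
Proof.
move=> i0 iP iso; case: a => [|a] ai hb.
  by apply/negP => /walk_within_l; rewrite !inE eqxx.
by apply: isolated_sep.
Qed.

(** Some walk from [p i.-1] to [p i.+1] avoids [p k.-1] and [p i], and it must visit [p k]; the
    vertex that follows its last visit is the connector. *)
Lemma connector_exists i k : 0 < k -> k < i -> i.+1 < size P ->
  isolated i k -> ~~ isolated i k.-1 ->
  exists2 q, q \in C & e (p k) q && ww (C :\: [set p k.-1; p k; p i]) q (p i.+1).
Proof.
move=> k0 ki iP iso; rewrite /isolated negb_or negbK prednK // => /andP[_ h].
pose A0 := C :\: [set p k.-1; p i]; pose A1 := C :\: [set p k.-1; p k; p i].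
have A01 z : (z \in A1) = (z != p k) && (z \in A0).
  by rewrite !inE; case: (z == p k.-1); case: (z == p k); case: (z == p i).
have [/exists_inP[q qC hq]|/exists_inPn no] :=
  boolP [exists q in C, e (p k) q && ww A1 q (p i.+1)].
  by exists q.
(* Inside [A0], the set [S] can be left only from [p k], straight to a connector; without one it is
   closed and would contain [p i.+1]. *)
exfalso; pose S := [set z in A0 | ~~ ww A1 z (p i.+1)].
have : p i.+1 \in S.
  apply: (walk_within_closed (x := p i.-1) _ _ h).
    rewrite inE (walk_within_l h) /=; apply/negP => h1.
    move: iso => /orP[/eqP ki'|/negP].
      by move: (walk_within_l h1); rewrite A01 -ki' /= eqxx.
    apply; apply: walk_within_sub h1; apply/subsetP => z; rewrite A01 !inE.
    by case: (z == p k); case: (z == p i); case: (z == p k.-1); rewrite ?andbF ?orbT.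
  move=> a b; rewrite inE => /andP[_ nh] aA0 bA0 eab; rewrite inE bA0 /=.
  apply/negP => hb; have [ak|ak] := eqVneq a (p k).
    have bC : b \in C by move: bA0; rewrite !inE => /andP[].
    by have := no b bC; rewrite -ak eab hb.
  move/negP: nh; apply; apply: (walk_within_trans _ hb); apply: walk_within_edge => //.
    by rewrite A01 ak.
  exact: walk_within_l hb.
rewrite inE => /andP[h1 /negP]; apply; apply: walk_within_refl.
by rewrite A01 h1 andbT path_inj; lia.
Qed.

Hypothesis af : asteroid_free.

(** A walk around the cut has to start before [p k]. Then [p k] is the centre of an asteroid with
    tips [p k.-1], [q] and [p i], whose sets are two edges and the stretch of [P] from [p k] to
    [p i]. The three connections follow [P], the walk around the cut and the walk from [q] to
    [p i.+1]. *)
Lemma connector_sep i k q a b : 0 < k -> k < i -> i.+1 < size P ->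
  isolated i k -> q \in C -> e (p k) q ->
  ww (C :\: [set p k.-1; p k; p i]) q (p i.+1) ->
  a < i -> i < b < size P -> ~~ ww (C :\: [set p i; p k; q]) (p a) (p b).
Proof.
move=> k0 ki iP iso qC ekq hq ai /andP[ib bP]; apply/negP => R2.
have inC := path_in; have inj := path_inj.
have isep m n : k < m < i -> i < n < size P -> ~~ ww (C :\: [set p k; p i]) (p m) (p n).
  exact: isolated_sep.
have sub2 : C :\: [set p k.-1; p k; p i] \subset C :\: [set p k; p i].
  by apply/subsetP => z; rewrite !inE !negb_or => /andP[/andP[/andP[_ ->] ->] ->].
have sub1 : C :\: [set p i; p k; q] \subset C :\: [set p k; p i].
  by apply/subsetP => z; rewrite !inE !negb_or => /andP[/andP[/andP[-> ->] _] ->].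
(* As [P] is induced, a neighbour of [p k] on it is [p k.-1], which the walk from [q] avoids, or
   [p k.+1], which is [p i], avoided as well, or is cut off from [p i.+1]. *)
have qP m : m < size P -> q != p m.
  move=> mP; apply/eqP => qm; move: (walk_within_l hq).
  rewrite qm !inE !inj ?negb_or; try (by clear -k0 ki iP mP; lia).
  move=> hm; case: indP => _ _ _ _ /(_ x0 k m); case; try (by clear -k0 ki iP mP hm; lia).
    by rewrite -qm.
  move=> mk.
  have /negP := isep m i.+1 ltac:(clear -ki mk hm; lia) ltac:(clear -iP; lia); apply.
  by rewrite -qm; apply: walk_within_sub hq.
have ak : a != k.
  by apply/eqP => ak; move: (walk_within_l R2); rewrite ak !inE eqxx !orbT.
have {}ak : a < k.
  rewrite ltnNge; apply/negP => ka.
    have /negP := isep a b ltac:(clear -ka ak ai; lia) ltac:(clear -ib bP; lia).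
  by apply; apply: walk_within_sub R2.
pose seg := [set x | [exists j : 'I_(size P), (k <= j <= i) && (x == p j)]].
pose inner := [set x | [exists j : 'I_(size P), (k < j < i) && (x == p j)]].
have seg_p j : j < size P -> (p j \in seg) = (k <= j <= i).
  move=> jP; rewrite inE; apply/existsP/idP => [[j' /andP[h]]|h].
    by rewrite inj // => /eqP->.
  by exists (Ordinal jP); rewrite /= h eqxx.
have segE A : A \subset C :\: [set p k; p i] -> A :\: inner \subset ~: seg.
  move=> /subsetP sA; apply/subsetP => z /setDP[/sA]; rewrite !inE negb_or.
  move=> /andP[/andP[zk zi] _] /existsPn nz; apply/existsPn => j.
  rewrite negb_and; have [zj|//] := eqVneq z (p j); rewrite ?orbT // orbF.
  apply/negP => hj; have := nz j; rewrite zj eqxx andbT => /negP; apply.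
  move: zk zi; rewrite zj !inj; clear -ki iP hj; lia.
(* Isolation keeps a walk off [p k] and [p i] that leads beyond [p i] clear of the inner stretch,
   hence of all of [seg]. *)
have innersep A n : A \subset C :\: [set p k; p i] -> i < n < size P ->
    forall z, z \in inner -> ~~ ww A z (p n).
  move=> sA hn z; rewrite inE => /existsP[j /andP[hj /eqP->]].
  by apply: contra (isep j n hj hn); exact: walk_within_sub.
apply: (@af (p k) (p k.-1) q (p i) [set p k; p k.-1] [set p k; q] seg).
- apply: walk_within_edge; rewrite ?inE ?eqxx ?orbT // esym.
  by case: indP => _ _ _ /(_ x0 k.-1) + _; rewrite prednK //; apply; lia.
- by apply: walk_within_edge; rewrite ?inE ?eqxx ?orbT.
- by apply: path_walk; [clear -k0 ki iP ai ib bP ak; lia..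
    |move=> j hj; rewrite seg_p;
     clear -k0 ki iP ai ib bP ak hj; lia].
- apply: (@walk_within_trans _ _ _ (p a)).
    by apply: path_walk_back; [clear -k0 ki iP ai ib bP ak; lia..
      |move=> j hj; rewrite inE seg_p;
       clear -k0 ki iP ai ib bP ak hj; lia].
  apply: (@walk_within_trans _ _ _ (p b)).
    apply: walk_within_sub (segE _ sub1) _; apply: walk_within_avoid R2.
    by apply: innersep => //; lia.
  apply: (@walk_within_trans _ _ _ (p i.+1)).
    by apply: path_walk_back; [clear -k0 ki iP ai ib bP ak; lia..
      |move=> j hj; rewrite inE seg_p;
       clear -k0 ki iP ai ib bP ak hj; lia].
  rewrite walk_within_sym //.
  apply: walk_within_sub (segE _ sub2) _; apply: walk_within_avoid hq.
  by apply: innersep => //; lia.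
- have inQ j : j < size P -> j != k -> p j \in ~: [set p k; q].
    move=> jP jk; rewrite !inE negb_or inj //; last by lia.
    by rewrite jk eq_sym qP.
  apply: (@walk_within_trans _ _ _ (p a)).
    by apply: path_walk_back; [clear -k0 ki iP ai ib bP ak; lia..
      |move=> j hj; apply: inQ;
       clear -k0 ki iP ai ib bP ak hj; lia].
  apply: (@walk_within_trans _ _ _ (p b)).
    apply: walk_within_sub R2; apply/subsetP => z; rewrite !inE !negb_or.
    by move=> /andP[/andP[/andP[_ ->] ->] _].
  by apply: path_walk_back; [clear -k0 ki iP ai ib bP ak; lia..
    |move=> j hj; apply: inQ;
     clear -k0 ki iP ai ib bP ak hj; lia].
- apply: (@walk_within_trans _ _ _ (p i.+1)).
    apply: walk_within_sub hq; apply/subsetP => z; rewrite !inE !negb_or.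
    by move=> /andP[/andP[/andP[-> ->] _] _].
  apply: path_walk_back; [clear -k0 ki iP ai ib bP ak; lia..
    |move=> j hj; rewrite !inE !negb_or !inj;
     clear -k0 ki iP ai ib bP ak hj; lia].
Qed.

End OnePath.
End Separation.

(** Double counting of the pairs [(u, v)] such that [K u] misses [v]: an average that is small over
    [u] is small for some [v]. *)
Lemma exists_rarely_missed (T : finType) (B : {set T}) (K : T -> {set T}) N :
  B != set0 -> {in B, forall u, 10 * #|B :\: K u| < N} ->
  exists2 v, v \in B & 10 * #|[set u in B | v \notin K u]| < N.
Proof.
move=> B0 hK; apply/exists_inP; apply: contraT => /exists_inPn no.
have : \sum_(v in B) 10 * #|[set u in B | v \notin K u]| =
       \sum_(u in B) 10 * #|B :\: K u|.
  rewrite -!big_distrr /=; congr (_ * _).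
  have card_sum (p : pred T) : #|[set u in B | p u]| = \sum_(u in B) p u.
    by rewrite -sum1dep_card big_mkcondr; apply: eq_bigr => u _; case: (p u).
  under eq_bigr do rewrite card_sum.
  rewrite exchange_big; apply: eq_bigr => u _; rewrite -card_sum.
  by apply: eq_card => v; rewrite !inE andbC.
move=> E; have h1 : \sum_(v in B) N <= \sum_(v in B) 10 * #|[set u in B | v \notin K u]|.
  by apply: leq_sum => v vB; rewrite leqNgt; exact: no.
have h2 : \sum_(u in B) (10 * #|B :\: K u|).+1 <= \sum_(u in B) N.
  by apply: leq_sum => u uB; exact: hK.
have h3 : \sum_(u in B) (10 * #|B :\: K u|).+1 = #|B| + \sum_(u in B) 10 * #|B :\: K u|.
  rewrite -[#|B|]sum1_card -big_split /=; apply: eq_bigr => u _; exact: add1n.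
by have := leq_trans h2 h1; rewrite h3 E; move: B0; rewrite -card_gt0; lia.
Qed.

(** * Paths to a random vertex *)

Section Balance.
Variables (V : finType) (e : rel V).
Hypothesis esym : symmetric e.
Hypothesis af : asteroid_free e.
Implicit Types (C A B : {set V}) (u v w x : V).

(* Three bad vertices, each pair of them lying in the large component left by
   the path to the third, would form an asteroid. *)
Lemma few_unbalanced_paths C r (Ps : V -> {set V}) :
  {in C, forall u, walk_within e (~: C :|: Ps u) r u} ->
  2 * #|[set u in C | [exists x in C :\: Ps u,
           9 * #|C| < 10 * #|comp_within e (C :\: Ps u) x|]]| <= #|C|.
Proof.
move=> hP; set bad := [set u in C | _]; rewrite leqNgt; apply/negP => hbad.
(* For a bad [u] the pick finds a large component; the default makes [K] total. *)
pose K u := comp_within e (C :\: Ps u)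
  (odflt u [pick x in C :\: Ps u | 9 * #|C| < 10 * #|comp_within e (C :\: Ps u) x|]).
have Kbad u : u \in bad -> 10 * #|C :\: K u| < #|C|.
  rewrite inE => /andP[_ /exists_inP[x hx1 hx2]]; rewrite /K.
  case: pickP => [y /andP[hy1 hy2]|/(_ x)]; last by rewrite hx1 hx2.
  have /setIidPr E : comp_within e (C :\: Ps u) y \subset C.
    by apply/subsetP => z; rewrite inE => /walk_within_r/setDP[].
  have := cardsID (comp_within e (C :\: Ps u) y) C; rewrite E /=.
  by move: hy2; lia.
have Ksep u v w : v \in K u -> w \in K u ->
    walk_within e (~: (~: C :|: Ps u)) v w.
  rewrite !inE => hv hw.
  have sub : C :\: Ps u \subset ~: (~: C :|: Ps u).
    by apply/subsetP => z; rewrite !inE negb_or negbK andbC.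
  apply: (walk_within_sub sub); apply: walk_within_trans hw.
  by rewrite walk_within_sym.
clearbody K.
have avg B : B \subset bad -> B != set0 ->
    exists2 v, v \in B & 10 * #|[set u in B | v \notin K u]| < #|C|.
  move=> /subsetP sB B0; apply: exists_rarely_missed => // u /sB ub.
  apply: leq_ltn_trans (Kbad u ub); rewrite leq_mul2l /=.
  apply: subset_leq_card; apply: setSD; apply/subsetP => z /sB.
  by rewrite inE => /andP[].
pose good v w := (w \in K v) && (v \in K w).
(* Fewer than a tenth of [#|C|] lies outside [K v], and by [avg] fewer than a tenth has a [K w] that
   misses [v]: less than a fifth of [#|C|] is lost for [v]. *)
have select B : B \subset bad -> B != set0 -> exists2 v, v \in B &
    10 * #|B| < 2 * #|C| + 10 * #|[set w in B | good v w]|.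
  move=> sB B0; have [v vB hv] := avg B sB B0; exists v => //.
  have vb := subsetP sB _ vB; have h := Kbad v vb.
  have : #|B| <= #|B :\: K v| + #|[set u in B | v \notin K u]|
                 + #|[set w in B | good v w]|.
    apply: leq_trans (_ : #|(B :\: K v) :|: [set u in B | v \notin K u]
                 :|: [set w in B | good v w]| <= _); last first.
      by apply: leq_trans (leq_card_setU _ _) _; rewrite leq_add2r leq_card_setU.
    apply: subset_leq_card; apply/subsetP => w wB; rewrite !inE wB /good.
    by case: (w \in K v); case: (v \in K w).
  have : #|B :\: K v| <= #|C :\: K v|.
    apply: subset_leq_card; apply: setSD; apply/subsetP => z /(subsetP sB).
    by rewrite inE => /andP[].
  by move: h hv; lia.
(* The successive sets exceed 1/2, 3/10 and 1/10 of [#|C|]. The threshold 9/10 for a large component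
   leaves room for two selections and a third vertex. *)
have bad0 : bad != set0 by rewrite -card_gt0; lia.
have [v1 v1b h1] := select bad (subxx _) bad0.
set B2 := [set w in bad | good v1 w] in h1.
have sB2 : B2 \subset bad by apply/subsetP => z; rewrite inE => /andP[].
have B20 : B2 != set0 by rewrite -card_gt0; lia.
have [v2 v2b h2] := select B2 sB2 B20.
set B3 := [set w in B2 | good v2 w] in h2.
have : B3 != set0 by rewrite -card_gt0; lia.
case/set0Pn => w; rewrite inE => /andP[wB2 /andP[g1 g2]].
move: (v2b) (wB2); rewrite !inE => /andP[v2bad /andP[g3 g4]] /andP[wbad /andP[g5 g6]].
have inC u : u \in bad -> u \in C by rewrite inE => /andP[].
apply: (@af r v1 v2 w (~: C :|: Ps v1) (~: C :|: Ps v2) (~: C :|: Ps w)).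
- exact/hP/inC.
- by apply: hP; move: v2bad => /andP[].
- by apply: hP; move: wbad => /andP[].
- exact: Ksep.
- exact: Ksep.
- exact: Ksep.
Qed.
End Balance.

(** * Querying programs *)

Section Programs.
Variable V : finType.

(** Deterministic stretches of the algorithm. Random draws occur only between them, so each has one
    value and one cost, and [run] grafts it into a [query_alg]. *)
Inductive prog (T : Type) : Type :=
| Ret of T
| Ask of V & V & (nat -> prog T).

Fixpoint bind T U (p : prog T) (f : T -> prog U) : prog U :=
  match p with
  | Ret t => f t
  | Ask u v k => Ask u v (fun n => bind (k n) f)
  end.

Fixpoint value T (delta : V -> V -> nat) (p : prog T) : T :=
  match p with
  | Ret t => t
  | Ask u v k => value delta (k (delta u v))
  end.

Fixpoint cost T (delta : V -> V -> nat) (p : prog T) : nat :=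
  match p with
  | Ret _ => 0
  | Ask u v k => (cost delta (k (delta u v))).+1
  end.

Fixpoint run T (p : prog T) (f : T -> query_alg V) : query_alg V :=
  match p with
  | Ret t => f t
  | Ask u v k => Query u v (fun n => run (k n) f)
  end.

Lemma value_bind T U delta (p : prog T) (f : T -> prog U) :
  value delta (bind p f) = value delta (f (value delta p)).
Proof. by elim: p => //= u v k IH. Qed.

Lemma cost_bind T U delta (p : prog T) (f : T -> prog U) :
  cost delta (bind p f) = cost delta p + cost delta (f (value delta p)).
Proof. by elim: p => //= u v k IH; rewrite IH. Qed.

Lemma always_reconstructs_run T delta (p : prog T) (f : T -> query_alg V) :
  always_reconstructs delta (run p f) <->
  always_reconstructs delta (f (value delta p)).
Proof. by elim: p => //= u v k IH. Qed.

(* A table of answers, with 0 for the pairs not yet queried. *)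
Definition table := V -> V -> nat.

Implicit Types (D : table) (A B C S T : {set V}).

Definition record_answer D u v n : table :=
  fun x y => if ((x, y) == (u, v)) || ((x, y) == (v, u)) then n else D x y.

Fixpoint ask_all (L : seq (V * V)) D : prog table :=
  if L is (u, v) :: L' then Ask u v (fun n => ask_all L' (record_answer D u v n))
  else Ret D.

Definition ask_rows A B D := ask_all [seq (x, y) | x <- enum A, y <- enum B] D.

Definition known_nbrs C S D := [set w in C | [exists s in S, D s w == 1]].

(** Two rounds of rows, since the neighbours of [S] are recognized from the answers of the first. *)
Definition probe C S D : prog table :=
  bind (ask_rows S C D) (fun D' => ask_rows (known_nbrs C S D') C D').

(* In C :\: S a vertex y and a neighbour w of T :|: S are connected as soon
   as w is at least as close to y as the whole of T :|: S; conversely every edge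
   of C :\: S has such a w in common for its two ends. *)
Definition linked C T S D : rel V := fun x y =>
  [&& x \in C :\: S, y \in C :\: S & [exists w in known_nbrs (C :\: S) (T :|: S) D,
     [forall z in T :|: S, (D w x <= D z x) && (D w y <= D z y)]]].

Definition same_comp C T S D x y :=
  (x \in C :\: S) && connect (linked C T S D) x y.

Section Correct.
Variable e : rel V.
Hypotheses (esym : symmetric e) (eirr : irreflexive e) (econ : connected_graph e).
Notation d := (gdist e).
Variable Delta : nat.
Hypothesis edeg : max_degree_le e Delta.

(** The value 0 of an unasked pair cannot be mistaken for an edge: a recorded 1 always is one. *)
Definition sound D :=
  (forall x y, D x y = D y x) /\ (forall x y, D x y = d x y \/ D x y = 0).

Definition extends D D' := forall x y, D x y = d x y -> D' x y = d x y.

Definition knows D A B := {in A & B, forall x y, D x y = d x y}.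

Lemma extends_trans D D' D'' : extends D D' -> extends D' D'' -> extends D D''.
Proof. by move=> h1 h2 x y /h1/h2. Qed.

Lemma knows_extends D D' A B : extends D D' -> knows D A B -> knows D' A B.
Proof. by move=> h1 h2 x y xA yB; apply: h1; exact: h2. Qed.

Lemma knows_sub D A B A' B' : A' \subset A -> B' \subset B -> knows D A B -> knows D A' B'.
Proof. by move=> /subsetP h1 /subsetP h2 k x y /h1 hx /h2; exact: k. Qed.

Lemma record_answer_spec D u v : sound D ->
  [/\ sound (record_answer D u v (d u v)), extends D (record_answer D u v (d u v)) &
      record_answer D u v (d u v) u v = d u v].
Proof.
move=> [sD hD]; rewrite /record_answer; split.
- split=> x y; last first.
    case: ifP => [/orP[] /eqP[-> ->]|_]; [by left| by left; rewrite gdist_sym|exact: hD].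
  by rewrite sD orbC !xpair_eqE (andbC (y == _)) (andbC (y == v)).
- by move=> x y; case: ifP => [/orP[] /eqP[-> ->]|//] _ //; rewrite gdist_sym.
- by rewrite eqxx.
Qed.

Lemma ask_all_spec L D : sound D ->
  let D' := value d (ask_all L D) in
  [/\ sound D', extends D D' & {in L, forall xy, D' xy.1 xy.2 = d xy.1 xy.2}].
Proof.
elim: L D => [|[u v] L IH] D sD /=; first by split.
have [s1 e1 k1] := record_answer_spec u v sD.
have [s2 e2 k2] := IH _ s1; split=> //; first exact: extends_trans e2.
by move=> xy; rewrite inE => /predU1P[->/=|/k2//]; exact: e2.
Qed.

Lemma cost_ask_all L D : cost d (ask_all L D) = size L.
Proof. by elim: L D => [|[u v] L IH] D //=; rewrite IH. Qed.

Lemma ask_rows_spec A B D : sound D ->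
  let D' := value d (ask_rows A B D) in
  [/\ sound D', extends D D' & knows D' A B].
Proof.
move=> /(ask_all_spec [seq (x, y) | x <- enum A, y <- enum B])[h1 h2 h3].
split=> // x y xA yB; apply: (h3 (x, y)).
by apply/allpairsP; exists (x, y); rewrite !mem_enum.
Qed.

Lemma cost_ask_rows A B D : cost d (ask_rows A B D) = #|A| * #|B|.
Proof. by rewrite cost_ask_all size_allpairs -!cardE. Qed.

Definition nbrs C S := [set w in C | [exists s in S, e s w]].

Lemma known_nbrsE C S D : knows D S C -> known_nbrs C S D = nbrs C S.
Proof.
move=> k; apply/setP => w; rewrite !inE; case wC: (w \in C) => //=.
apply/exists_inP/exists_inP => -[s sS h]; exists s => //;
  by move: h; rewrite k // gdist_edge.
Qed.

Lemma card_nbrs C S : #|nbrs C S| <= Delta * #|S|.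
Proof.
apply: leq_trans (_ : #|\bigcup_(s in S) [set w | e s w]| <= _).
  apply: subset_leq_card; apply/subsetP => w; rewrite inE => /andP[_ /exists_inP[s sS esw]].
  by apply/bigcupP; exists s => //; rewrite inE.
apply: leq_trans (_ : \sum_(s in S) #|[set w | e s w]| <= _).
  elim/big_rec2: _ => [|s n A _ h]; first by rewrite cards0.
  by apply: leq_trans (leq_card_setU _ _) _; rewrite leq_add2l.
by rewrite mulnC -sum_nat_const; apply: leq_sum.
Qed.

Definition probed C S D := knows D S C /\ knows D (nbrs C S) C.

Lemma probe_spec C S D : sound D ->
  let D' := value d (probe C S D) in
  [/\ sound D', extends D D' & probed C S D'].
Proof.
move=> sD; rewrite /probe value_bind.
have [s1 e1 k1] := ask_rows_spec S C sD.
have [s2 e2 k2] := ask_rows_spec (known_nbrs C S (value d (ask_rows S C D))) C s1.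
split=> //; first exact: extends_trans e2.
split; first exact: knows_extends k1.
by rewrite -(known_nbrsE k1).
Qed.

Lemma cost_probe C S D : sound D ->
  cost d (probe C S D) <= #|S| * Delta.+1 * #|C|.
Proof.
move=> sD; rewrite /probe cost_bind !cost_ask_rows.
have [s1 e1 k1] := ask_rows_spec S C sD.
rewrite known_nbrsE // -mulnDl leq_mul2r; apply/orP; right.
by rewrite mulnS leq_add2l mulnC card_nbrs.
Qed.

Lemma probed_extends C S D D' : extends D D' -> probed C S D -> probed C S D'.
Proof. by move=> h [k1 k2]; split; exact: knows_extends h _. Qed.

(* T is the part of the removed vertices that can touch the region C. *)
Definition region C T D :=
  [/\ forall x y, x \in C -> e x y -> y \in C :|: T,
      [disjoint T & C], T != set0 & probed C T D].

Lemma region_extends C T D D' : extends D D' -> region C T D -> region C T D'.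
Proof. by move=> h [h1 h2 h3 h4]; split=> //; exact: probed_extends h4. Qed.

Section SameComp.
Variables (C T S : {set V}) (D : table).
Hypotheses (regD : region C T D) (prD : probed C S D).

Lemma region_step x y : x \in C :\: S -> e x y -> y \notin T :|: S -> y \in C :\: S.
Proof.
case: regD => cl _ _ _ /setDP[xC _] exy; rewrite !inE negb_or => /andP[yT yS].
by have := cl x y xC exy; rewrite inE (negbTE yT) orbF yS.
Qed.

(** The geodesic from [x] to [w] keeps the hypothesis, since a step lowers the distance to [w] by
    one and the distance to [z] by at most one. If its next vertex were in [T :|: S], at distance
    one from [x], then [d w x] would be 1 and that vertex would be [w]. *)
Lemma near_walk w x : x \in C :\: S -> w \notin T :|: S ->
  {in T :|: S, forall z, d w x <= d z x} -> walk_within e (C :\: S) w x.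
Proof.
move=> + wZ; elim: {x}(d w x) {-2}x (erefl (d w x)) => [|n IH] x hx xCS near.
  by move/eqP: hx; rewrite gdist_eq0 // => /eqP->; exact: walk_within_refl.
have xw : x != w by rewrite -(gdist_eq0 econ) gdist_sym // hx.
have [y exy] := gdist_next eirr econ xw.
rewrite (gdist_sym esym econ x w) (gdist_sym esym econ y w) hx => -[hy].
have yZ : y \notin T :|: S.
  apply/negP => yZ; have := near y yZ.
  have /eqP-> : d y x == 1 by rewrite gdist_edge // esym.
  rewrite hx ltnS leqn0 => /eqP n0.
  move/eqP: hy; rewrite n0 eq_sym gdist_eq0 // => /eqP wy.
  by move: wZ; rewrite wy yZ.
have yCS := region_step xCS exy yZ.
apply: (walk_within_trans (IH y (Logic.eq_sym hy) yCS _)).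
  move=> z zZ; have := near z zZ; rewrite hx.
  have := gdist_edge_le eirr econ z exy.
  by rewrite (gdist_sym esym econ x z) (gdist_sym esym econ y z); lia.
by apply: walk_within_edge; rewrite // esym.
Qed.

Lemma same_comp_walk x y :
  same_comp C T S D x y = walk_within e (C :\: S) x y.
Proof.
case: (regD) => cl dis T0 [kT kNT]; case: prD => kS kNS.
have kZ : knows D (T :|: S) C.
  by move=> z c; rewrite inE => /orP[] hz hc; [exact: kT|exact: kS].
have nbE : known_nbrs (C :\: S) (T :|: S) D = nbrs (C :\: S) (T :|: S).
  by apply: known_nbrsE; apply: knows_sub kZ; rewrite ?subxx ?subsetDl.
have kW : knows D (nbrs (C :\: S) (T :|: S)) C.
  move=> w c; rewrite inE => /andP[/setDP[wC _] /exists_inP[z]].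
  rewrite inE => /orP[] hz ezw hc; [apply: kNT|apply: kNS] => //;
    by rewrite inE wC; apply/exists_inP; exists z.
have linkedP a b : linked C T S D a b -> walk_within e (C :\: S) a b.
  move=> /and3P[aCS bCS /exists_inP[w]]; rewrite nbE => hw /forall_inP near.
  have /setDP[wC wS] : w \in C :\: S by move: hw; rewrite inE => /andP[].
  have wZ : w \notin T :|: S.
    rewrite inE negb_or wS andbT; apply/negP => wT.
    by move/pred0P: dis => /(_ w); rewrite /= wT wC.
  have inC c : c \in C :\: S -> c \in C by case/setDP.
  apply: (@walk_within_trans _ _ _ w); last first.
    apply: near_walk => // z zZ; have /andP[_] := near z zZ.
    by rewrite (kW _ _ hw) ?inC // kZ ?inC.
  rewrite walk_within_sym //; apply: near_walk => // z zZ.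
  by have /andP[+ _] := near z zZ; rewrite (kW _ _ hw) ?inC // kZ ?inC.
apply/idP/idP.
  move=> /andP[xCS /connectP[p pp ey]]; rewrite {y}ey.
  elim: p x xCS pp => [|b p IH] x xCS /=; first by move=> _; exact: walk_within_refl.
  move=> /andP[/linkedP h pp]; apply: (walk_within_trans h).
  exact: IH (walk_within_r h) pp.
move=> h; rewrite /same_comp (walk_within_l h) /=.
have /walk_withinP[p [pp ly sub]] := h.
apply/connectP; exists p => //; elim: p x pp {ly h} sub => //= b p IH x /andP[exb pp] sub.
rewrite IH // ?andbT; last by move=> z hz; apply: sub; rewrite inE hz orbT.
have xCS : x \in C :\: S by apply: sub; rewrite mem_head.
have bCS : b \in C :\: S by apply: sub; rewrite !inE eqxx orbT.
rewrite /linked xCS bCS /= nbE.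
(* Here [z] is a vertex of [T :|: S] closest to the edge and [a] is the end nearer to it. The second
   vertex [w] of a geodesic from [z] to [a] beats all of [T :|: S] at [a]; at [c] it is no worse,
   because [d w c <= d w a + 1 = d z a]. *)
have claim a c z : a \in C :\: S -> c \in C :\: S -> e a c -> z \in T :|: S ->
    {in T :|: S, forall z', d z a <= d z' a /\ d z a <= d z' c} ->
    exists2 w, w \in nbrs (C :\: S) (T :|: S) &
      {in T :|: S, forall z', d w a <= d z' a /\ d w c <= d z' c}.
  move=> aCS cCS eac zZ hz.
  have notZ u : u \in C :\: S -> u \notin T :|: S.
    move=> /setDP[uC uS]; rewrite inE negb_or uS andbT; apply/negP => uT.
    by move/pred0P: dis => /(_ u); rewrite /= uT uC.
  have za : z != a by apply: contraTneq zZ => ->; exact: notZ.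
  have [w ezw hw] := gdist_next eirr econ za.
  have near : {in T :|: S, forall z', d w a <= d z' a}.
    by move=> z' /hz[h1 _]; apply: leq_trans h1; rewrite hw.
  have wZ : w \notin T :|: S by apply/negP => /hz[]; rewrite hw ltnn.
  have wCS := walk_within_l (near_walk aCS wZ near).
  exists w; first by rewrite inE wCS; apply/exists_inP; exists z.
  move=> z' z'Z; split; first exact: near.
  have [_ h2] := hz z' z'Z; apply: leq_trans h2; rewrite hw.
  rewrite (gdist_sym esym econ w c) (gdist_sym esym econ w a).
  by apply: gdist_edge_le => //; rewrite esym.
have [w hw1 hw2] : exists2 w, w \in nbrs (C :\: S) (T :|: S) &
      {in T :|: S, forall z', d w x <= d z' x /\ d w b <= d z' b}.
  have [z0 z0Z] : exists z0, z0 \in T :|: S.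
    by case/set0Pn: T0 => z0 hz0; exists z0; rewrite inE hz0.
  case: (arg_minnP (fun z => minn (d z x) (d z b)) z0Z) => z zZ hz.
  have hz' : {in T :|: S, forall z', minn (d z x) (d z b) <= d z' x /\
      minn (d z x) (d z b) <= d z' b}.
    by move=> z' /hz; rewrite leq_min => /andP[].
  have [le|lt] := leqP (d z x) (d z b).
    by move: hz'; rewrite (minn_idPl le) => hz'; apply: (claim x b z).
  move: hz'; rewrite (minn_idPr (ltnW lt)) => hz'.
  have ebx : e b x by rewrite esym.
  have [|w hw1 hw2] := claim b x z bCS xCS ebx zZ.
    by move=> z' /hz'[].
  by exists w => // z' /hw2[].
apply/exists_inP; exists w => //; apply/forall_inP => z' hz'.
have inC c : c \in C :\: S -> c \in C by case/setDP.
by rewrite !(kW _ _ hw1) ?kZ ?inC //; apply/andP; exact: hw2.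
Qed.

End SameComp.
End Correct.
End Programs.

(** * Binary search and cuts along a path *)

Section Bisection.
Variables (V : finType) (X : Type) (dec : X -> bool).
Variable q : nat -> table V -> prog V (X * table V).

(** Only the disagreement of the two ends is maintained: the search stops at some change of [dec]
    between consecutive positions, however often [dec] changes in the range. [X] keeps the data
    computed at each end. *)
Fixpoint bisect fuel lo (xlo : X) hi (xhi : X) (D : table V) :
    prog V (nat * X * X * table V) :=
  if fuel is f.+1 then
    if hi <= lo.+1 then Ret V (lo, xlo, xhi, D) else
    let m := (lo + hi)./2 in
    bind (q m D) (fun r =>
      if dec r.1 then bisect f lo xlo m r.1 r.2 else bisect f m r.1 hi xhi r.2)
  else Ret V (lo, xlo, xhi, D).

Variables (d : V -> V -> nat) (ok : table V -> Prop) (Q : nat -> X -> Prop) (c : nat).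

Lemma bisect_spec fuel lo xlo hi xhi D :
  (forall m D', lo < m < hi -> ok D' -> let r := value d (q m D') in
     [/\ ok r.2, Q m r.1 & cost d (q m D') <= c]) ->
  lo < hi -> hi - lo <= 2 ^ fuel -> ok D ->
  Q lo xlo -> ~~ dec xlo -> Q hi xhi -> dec xhi ->
  let p := bisect fuel lo xlo hi xhi D in
  let: (l, x, y, D') := value d p in
  [/\ lo <= l < hi, Q l x /\ ~~ dec x, Q l.+1 y /\ dec y, ok D' &
      cost d p <= fuel * c].
Proof.
elim: fuel lo xlo hi xhi D => [|f IH] lo xlo hi xhi D hq lohi hsz okD Ql dl Qh dh /=.
  have E : hi = lo.+1 by move: hsz; rewrite expn0; lia.
  by rewrite leqnn lohi; split=> //; rewrite -E.
case: leqP => hl /=.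
  have E : hi = lo.+1 by lia.
  by rewrite leqnn lohi; split=> //; rewrite -E.
set m := (lo + hi)./2.
have lomhi : lo < m < hi by rewrite /m; lia.
have hm1 : m - lo <= 2 ^ f by move: hsz; rewrite expnS /m; lia.
have hm2 : hi - m <= 2 ^ f by move: hsz; rewrite expnS /m; lia.
have [ok1 Q1 c1] := hq m D lomhi okD.
rewrite value_bind cost_bind.
have hq' a b : lo <= a -> b <= hi -> forall m' D', a < m' < b -> ok D' ->
    let r := value d (q m' D') in [/\ ok r.2, Q m' r.1 & cost d (q m' D') <= c].
  by move=> h1 h2 m' D' h3 h4; apply: hq => //; lia.
have [lom mhi] : lo < m /\ m < hi by apply/andP.
case: (boolP (dec (value d (q m D)).1)) => dm.
  have /= := IH lo xlo m _ _ (hq' lo m (leqnn _) (ltnW mhi)) lom hm1 ok1 Ql dl Q1 dm.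
  case: (value d (bisect _ _ _ _ _ _)) => [[[l x] y] D'] /= [h1 h2 h3 h4 h5].
  by split=> //; lia.
have /= := IH m _ hi xhi _ (hq' m hi (ltnW lom) (leqnn _)) mhi hm2 ok1 Q1 dm Qh dh.
case: (value d (bisect _ _ _ _ _ _)) => [[[l x] y] D'] /= [h1 h2 h3 h4 h5].
by split=> //; lia.
Qed.

End Bisection.

Section Sweep.
Variables (V : finType) (C T : {set V}) (P : seq V) (x0 : V) (fuel : nat).
Notation p i := (nth x0 P i).
Implicit Types (D : table V).

Definition query_isolated i k D : prog V (bool * table V) :=
  bind (probe C [set p k; p i] D) (fun D' => Ret V
    ((k.+1 == i) || ~~ same_comp C T [set p k; p i] D' (p i.-1) (p i.+1), D')).

(* If isolated i k holds but isolated i k.-1 does not, some neighbour of p k is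
   still joined to p i.+1; with it {p k, p i} cuts P at p i, see connector_sep. *)
Definition connector i k D : V :=
  odflt (p i) [pick q in C | (D (p k) q == 1) &&
    same_comp C T [set p k.-1; p k; p i] D q (p i.+1)].

(** At an end of [P] one side is empty and one vertex is enough. Isolation at [k = 0] gives a cut of
    two vertices, and at [k = i.-1] it holds because [p i.-1] is itself removed. If it fails at 0,
    bisection finds a failure at [l] followed by a success at [l.+1], which is what a connector
    requires. *)
Definition find_cut i D : prog V ({set V} * table V) :=
  if i == 0 then Ret V ([set p 0], D)
  else if size P <= i.+1 then Ret V ([set p i], D)
  else bind (query_isolated i 0 D) (fun r =>
    if r.1 then Ret V ([set p 0; p i], r.2)
    else bind (bisect id (query_isolated i) fuel 0 false i.-1 true r.2) (fun s =>
      let: (l, _, _, D1) := s in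
      bind (probe C [set p l; p l.+1; p i] D1) (fun D2 =>
        Ret V ([set p i; p l.+1; connector i l.+1 D2], D2)))).

Definition weigh_cut i D : prog V ({set V} * bool * table V) :=
  bind (find_cut i D) (fun r => bind (probe C r.1 r.2) (fun D' => Ret V
    ((r.1, #|C| < 2 * #|[set x in C | [exists j : 'I_i,
                          same_comp C T r.1 D' (p j) x]]|), D'))).

(* The part of C before the cut at i is light for i = 0; if it becomes heavy,
   the two cuts around the change leave only light components along P. *)
Definition sweep D : prog V ({set V} * table V) :=
  bind (weigh_cut (size P).-1 D) (fun r =>
    if r.1.2 then
      (* Nothing of [P] precedes position 0, so the cut there is known to be light without a
         query. *)
      bind (bisect snd weigh_cut fuel 0 ([set p 0], false) (size P).-1 r.1 r.2)
        (fun s => let: (_, x, y, D') := s in Ret V (x.1 :|: y.1, D'))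
    else Ret V (r.1.1, r.2)).

Variable e : rel V.
Hypotheses (esym : symmetric e) (eirr : irreflexive e) (econ : connected_graph e).
Hypothesis af : asteroid_free e.
Variable Delta : nat.
Hypothesis edeg : max_degree_le e Delta.
Hypothesis indP : induced_path e C P.
Hypothesis fuelP : size P <= 2 ^ fuel.
Notation d := (gdist e).
Notation ww := (walk_within e).
Notation unit_cost := (3 * Delta.+1 * #|C|).

Variable D0 : table V.
Definition ready D := (sound e D /\ extends e D0 D) /\ region e C T D.

Lemma ready_probe (S : {set V}) D : ready D -> #|S| <= 3 ->
  let D' := value d (probe C S D) in
  [/\ ready D', probed e C S D' & cost d (probe C S D) <= unit_cost].
Proof.
move=> [[sD xD] rD] cS; have [s1 e1 p1] := probe_spec esym eirr econ C S sD.
split=> //.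
  split; last exact: region_extends e1 rD.
  by split=> //; exact: extends_trans e1.
apply: leq_trans (cost_probe esym eirr econ edeg C S sD) _.
by rewrite -!mulnA leq_mul2r cS orbT.
Qed.

(** The last clause serves the merging step: it attaches the cut to [P] outside any component that
    misses [P]. *)
Definition is_cut i (S : {set V}) :=
  [/\ S \subset C /\ p i \in S, #|S| <= 3,
      forall a b, a < i -> i < b < size P -> ~~ ww (C :\: S) (p a) (p b) &
      {in S, forall s, s \in P \/ exists2 x, x \in P & e x s}].

Lemma query_isolated_spec i k D : ready D ->
  let r := value d (query_isolated i k D) in
  [/\ ready r.2, r.1 = isolated e C P x0 i k & cost d (query_isolated i k D) <= unit_cost].
Proof.
move=> rD; have [|r1 p1 c1] := @ready_probe [set p k; p i] D rD.
  by rewrite cards2; case: (_ != _).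
rewrite /query_isolated value_bind cost_bind /= addn0; split=> //.
by rewrite (same_comp_walk esym eirr econ r1.2 p1).
Qed.

Lemma sizeP : 0 < size P.
Proof. by case: indP. Qed.

Lemma find_cut_spec i D : i < size P -> ready D ->
  let r := value d (find_cut i D) in
  [/\ ready r.2, is_cut i r.1 & cost d (find_cut i D) <= fuel.+2 * unit_cost].
Proof.
move=> iP rD; rewrite /find_cut.
have inC j : j < size P -> p j \in C by move=> ?; apply: path_in indP _ _.
have inP j : j < size P -> p j \in P by move=> ?; apply: mem_nth.
have [i0|i0] := eqVneq i 0.
  split=> //=; split=> //.
  - by rewrite i0 !sub1set !inE eqxx inC ?sizeP.
  - by rewrite cards1.
  - by rewrite i0.
  - by move=> s; rewrite inE => /eqP->; left; apply: inP; exact: sizeP.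
case: leqP => iP'.
  split=> //=; split=> //.
  - by rewrite sub1set !inE eqxx inC.
  - by rewrite cards1.
  - by move=> a b _; lia.
  - by move=> s; rewrite inE => /eqP->; left; apply: inP.
rewrite value_bind cost_bind.
have := @query_isolated_spec i 0 D rD.
case: (value d (query_isolated i 0 D)) => b D1 /= [r1 eb c1].
case: b eb => /= eb.
  split=> //; last by rewrite addn0 (leq_trans c1) // leq_pmull.
  split=> //.
  - by rewrite subUset !sub1set !inE eqxx orbT !inC ?sizeP.
  - by rewrite cards2; case: (_ != _).
  - by move=> a b' ai hb; apply: (isolated0_sep esym indP) => //; rewrite lt0n.
  - by move=> s; rewrite !inE => /orP[]/eqP->; left; apply: inP; rewrite ?sizeP.
have i1 : 1 < i.
  rewrite ltn_neqAle eq_sym lt0n i0 andbT; apply/eqP => E.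
  by move: eb; rewrite /isolated E eqxx.
rewrite value_bind cost_bind.
have hq m D' : 0 < m < i.-1 -> ready D' -> let r := value d (query_isolated i m D') in
     [/\ ready r.2, r.1 = isolated e C P x0 i m & cost d (query_isolated i m D') <= unit_cost].
  by move=> _; exact: query_isolated_spec.
have sz : i.-1 - 0 <= 2 ^ fuel by apply: leq_trans fuelP; lia.
have iso1 : true = isolated e C P x0 i i.-1 by rewrite /isolated prednK ?eqxx //; lia.
have lt1 : 0 < i.-1 by lia.
have /= := @bisect_spec V bool id (query_isolated i) d ready
  (fun k b => b = isolated e C P x0 i k) unit_cost fuel 0 false i.-1 true D1
  hq lt1 sz r1 eb isT iso1 isT.
case: (value d (bisect _ _ _ _ _ _ _ _)) => [[[l x] y] D2] /=.
move=> [li [ex dx] [ey dy] r2 c2].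
rewrite value_bind cost_bind /=.
have [|r3 p3 c3] := @ready_probe [set p l; p l.+1; p i] D2 r2.
  apply: leq_trans (leq_card_setU _ _) _; rewrite cards1 cards2.
  by case: (_ != _).
split=> //; last first.
  rewrite addn0; move: c1 c2 c3; set U := 3 * Delta.+1 * #|C|.
  by rewrite 2!mulSn; lia.
set D3 := value d _ in r3 p3 *.
have kli : l.+1 < i by lia.
have isol : isolated e C P x0 i l.+1 by rewrite -ey.
have nisol : ~~ isolated e C P x0 i l by rewrite -ex.
have [qC [eq hq']] : connector i l.+1 D3 \in C /\ (e (p l.+1) (connector i l.+1 D3) /\
    ww (C :\: [set p l; p l.+1; p i]) (connector i l.+1 D3) (p i.+1)).
  have kp q : q \in C -> (D3 (p l.+1) q == 1) = e (p l.+1) q.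
    move=> qC; case: p3 => k3 _; rewrite k3 ?gdist_edge //.
    by rewrite !inE eqxx orbT.
  have cw := same_comp_walk esym eirr econ r3.2 p3.
  rewrite /connector; case: pickP => [q /and3P[qC h1 h2]|no] /=.
    by split=> //; rewrite -kp // h1 -cw h2.
  have [q qC /andP[h1 h2]] := connector_exists indP (ltn0Sn l) kli iP' isol nisol.
  by have := no q; rewrite /= qC kp // h1 cw h2.
split=> //.
- by rewrite !subUset !sub1set qC !inC ?inE ?eqxx //; clear -kli iP; lia.
- apply: leq_trans (leq_card_setU _ _) _; rewrite cards1 cards2.
  by case: (_ != _).
- move=> a b ai hb; apply: (connector_sep esym indP af _ kli) => //.
- move=> s; rewrite !inE => /orP[/orP[]|] /eqP->.
  + by left; apply: inP.
  + by left; apply: inP; clear -kli iP; lia.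
  + by right; exists (p l.+1) => //; apply: inP; clear -kli iP; lia.
Qed.

Lemma weigh_cut_spec i D : i < size P -> ready D ->
  let r := value d (weigh_cut i D) in
  [/\ ready r.2, is_cut i r.1.1 /\
        r.1.2 = (#|C| < 2 * #|[set x in C | [exists j : 'I_i,
                                 ww (C :\: r.1.1) (p j) x]]|) &
      cost d (weigh_cut i D) <= fuel.+3 * unit_cost].
Proof.
move=> iP rD; rewrite /weigh_cut value_bind cost_bind.
have := find_cut_spec iP rD.
case: (value d (find_cut i D)) => S D1 /= [r1 cutS c1].
rewrite value_bind cost_bind /=.
have [|r2 p2 c2] := @ready_probe S D1 r1; first by case: cutS.
split=> //; last first.
  by rewrite addn0; move: c1 c2; set U := 3 * Delta.+1 * #|C|; rewrite [_.+3 * U]mulSn; lia.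
split=> //; congr (_ < 2 * _); apply: eq_card => x; rewrite !inE; congr (_ && _).
by apply: eq_existsb => j; rewrite (same_comp_walk esym eirr econ r2.2 p2).
Qed.

(** If the change occurs between [i] and [i.+1], these two vertices of [P] are removed. The
    component of an earlier one is contained in the light part before the cut at [i]; that of a
    later one is disjoint from the heavy part before the cut at [i.+1]. At most [fuel.+1] cuts are
    weighed, and the bound 6 is twice the size of a cut. *)
Lemma sweep_spec D : ready D ->
  let: (Z, D') := value d (sweep D) in
  [/\ ready D', [/\ Z \subset C, Z != set0 & #|Z| <= 6],
      {in Z, forall s, s \in P \/ exists2 x, x \in P & e x s},
      {in P, forall x, 2 * #|comp_within e (C :\: Z) x| <= #|C|} &
      cost d (sweep D) <= fuel.+1 * (fuel.+3 * unit_cost)].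
Proof.
move=> rD; rewrite /sweep value_bind cost_bind.
have hP := sizeP; set h := (size P).-1.
have hsz : h < size P by rewrite /h; lia.
pose up i (S : {set V}) := [set x in C | [exists j : 'I_i, ww (C :\: S) (p j) x]].
have compS (S S' : {set V}) x : x \in S -> comp_within e (C :\: (S :|: S')) x = set0.
  move=> xS; apply/setP => y; rewrite !inE; apply/negP => /walk_within_l.
  by rewrite !inE xS.
have comp_sub (S S' : {set V}) x :
    #|comp_within e (C :\: (S :|: S')) x| <= #|comp_within e (C :\: S) x|.
  apply: subset_leq_card; apply/subsetP => y; rewrite !inE; apply: walk_within_sub.
  by rewrite setDS // subsetUl.
have comp_up (S : {set V}) i j : j < i -> #|comp_within e (C :\: S) (p j)| <= #|up i S|.
  move=> ji; apply: subset_leq_card; apply/subsetP => y; rewrite !inE => hy.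
  have /setDP[-> _] := walk_within_r hy.
  by apply/existsP; exists (Ordinal ji).
have := weigh_cut_spec hsz rD.
case: (value d (weigh_cut h D)) => [[S b] D1] /= [r1 [cutS eb] c1].
case: b eb => eb; last first.
  have [[sS phS] cS sepS nearS] := cutS.
  split=> //=; last by rewrite addn0 (leq_trans c1) // leq_pmull.
  - split=> //; last by lia.
    by apply/set0Pn; exists (p h).
  - move=> x /(nthP x0)[j hj <-].
    have [->|jh] := eqVneq j h.
      have -> : comp_within e (C :\: S) (p h) = set0 by rewrite -(setUid S) compS.
      by rewrite cards0.
    have jh' : j < h by rewrite ltn_neqAle jh /h -ltnS prednK.
    have eb' : 2 * #|up h S| <= #|C| by rewrite leqNgt -eb.
    by apply: leq_trans eb'; rewrite leq_mul2l comp_up.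
rewrite value_bind cost_bind.
have h0 : 0 < h.
  have : #|C| < 2 * #|up h S| by rewrite -eb.
  rewrite lt0n; apply: contraTneq => h0.
  suff -> : up h S = set0 by rewrite cards0 muln0.
  by apply/setP => x; rewrite h0 !inE; apply/andP => -[_ /existsP[[]]].
have hsz2 : h - 0 <= 2 ^ fuel by apply: leq_trans fuelP; lia.
pose Q i (x : {set V} * bool) := is_cut i x.1 /\ x.2 = (#|C| < 2 * #|up i x.1|).
have Q0 : Q 0 ([set p 0], false).
  split=> /=; last first.
    suff -> : up 0 [set p 0] = set0 by rewrite cards0 muln0.
    by apply/setP => x; rewrite !inE; apply/andP => -[_ /existsP[[]]].
  have := find_cut_spec hP rD; rewrite /find_cut eqxx /=.
  by case.
have hq m D' : 0 < m < h -> ready D' -> let r := value d (weigh_cut m D') in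
     [/\ ready r.2, Q m r.1 & cost d (weigh_cut m D') <= fuel.+3 * unit_cost].
  by move=> hm; apply: weigh_cut_spec; lia.
have /= := @bisect_spec V _ snd weigh_cut d ready Q _ fuel 0 ([set p 0], false) h (S, true) D1
  hq h0 hsz2 r1 Q0 isT (conj cutS eb) isT.
case: (value d (bisect _ _ _ _ _ _ _ _)) => [[[i [S1 b1]] [S2 b2]] D2] /=.
move=> [ih [[cut1 eb1] db1] [[cut2 eb2] db2] r2 c2].
rewrite /= in cut1 eb1 db1 cut2 eb2 db2.
have [[sS1 pS1] cS1 sep1 near1] := cut1; have [[sS2 pS2] cS2 sep2 near2] := cut2.
split=> //=; last by rewrite addn0 mulSn leq_add.
- split; first by rewrite subUset sS1.
    by apply/set0Pn; exists (p i); rewrite inE pS1.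
  by apply: leq_trans (leq_card_setU _ _) _; lia.
- by move=> s; rewrite inE => /orP[/near1|/near2].
move=> x /(nthP x0)[j hj <-].
case: (ltngtP j i) => hji; last by rewrite hji compS // cards0.
  apply: leq_trans (_ : 2 * #|comp_within e (C :\: S1) (p j)| <= _).
    by rewrite leq_mul2l comp_sub.
  have eb1' : 2 * #|up i S1| <= #|C| by rewrite leqNgt -eb1.
  by apply: leq_trans eb1'; rewrite leq_mul2l comp_up.
have [->|ji] := eqVneq j i.+1; first by rewrite setUC compS // cards0.
apply: leq_trans (_ : 2 * #|comp_within e (C :\: S2) (p j)| <= _).
  by rewrite leq_mul2l setUC comp_sub.
have hj2 : i.+1 < j < size P by rewrite hj andbT ltn_neqAle eq_sym ji.
have : #|comp_within e (C :\: S2) (p j)| + #|up i.+1 S2| <= #|C|.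
  rewrite -cardsUI (_ : _ :&: _ = set0) ?cards0 ?addn0; last first.
    apply/setP => y; rewrite !inE; apply/negP => /and3P[h1 _ /existsP[j' h2]].
    have /negP := sep2 j' j (ltn_ord j') hj2; apply.
    by apply: (walk_within_trans h2); rewrite walk_within_sym.
  apply: subset_leq_card; apply/subsetP => y; rewrite !inE => /orP[|/andP[//]].
  by move/walk_within_r/setDP => [].
have eb2' : #|C| < 2 * #|up i.+1 S2| by rewrite -eb2.
by lia.
Qed.

End Sweep.

(** * Induced paths from levels of the distance *)

Section Descent.
Variables (V : finType) (C : {set V}).
Implicit Types (D : table V) (x y z : V).

(** The row of [z] is known, so the next vertex is sought in a single level of the distance to [z].
    Each level is asked at most once, so the descent costs at most one query per vertex of [C]. *)
Fixpoint descend fuel z x D : prog V (seq V * table V) :=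
  if fuel is f.+1 then
    bind (ask_rows [set x] [set y in C | (D z y).+1 == D z x] D) (fun D' =>
      if [pick y in C | ((D z y).+1 == D z x) && (D' x y == 1)] is Some y
      then bind (descend f z y D') (fun r => Ret V (x :: r.1, r.2))
      else Ret V ([:: x], D'))
  else Ret V ([:: x], D).

Variable e : rel V.
Hypotheses (esym : symmetric e) (eirr : irreflexive e) (econ : connected_graph e).
Notation d := (gdist e).

Definition downhill z a b := e a b && (d z a == (d z b).+1).

Lemma downhill_dist z x s i : path (downhill z) x s -> i < (size s).+1 ->
  d z (nth x (x :: s) i) + i = d z x.
Proof.
elim: s x i => [|y s IH] x [|i] //=; try by rewrite addn0.
move=> /andP[/andP[_ /eqP h] ps] hi; rewrite h -(IH y i ps hi) addnS.
by rewrite (set_nth_default y).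
Qed.

(** The distance to [z] numbers the positions of the path, and an edge changes it by at most one. *)
Lemma downhill_induced z x s : path (downhill z) x s -> {subset x :: s <= C} ->
  induced_path e C (x :: s).
Proof.
move=> ps sub; have dist := downhill_dist ps.
have nthx x0 i : i < (size s).+1 -> nth x0 (x :: s) i = nth x (x :: s) i.
  by move=> hi; apply: set_nth_default.
have inj i j : i < (size s).+1 -> j < (size s).+1 ->
    nth x (x :: s) i = nth x (x :: s) j -> i = j.
  by move=> hi hj h; have := dist i hi; have := dist j hj; rewrite h; lia.
split=> //.
- apply/(uniqP x) => i j; rewrite !inE; exact: inj.
- move=> x0 i hi; have hi' : i < (size s).+1 by apply: ltnW.
  rewrite !nthx //; have := pathP x ps i hi; rewrite /downhill => /andP[+ _].
  by [].
- move=> x0 i j hi hj; rewrite !nthx // => eij.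
  have h1 := gdist_edge_le eirr econ z eij.
  have h2 := gdist_edge_le eirr econ z (etrans (esym _ _) eij).
  move: h1 h2; rewrite ![d _ z]gdist_sym //.
  have := dist i hi; have := dist j hj.
  have nij : i != j by apply: contraTneq eij => ->; rewrite eirr.
  lia.
Qed.

Lemma descend_spec fuel z x D : sound e D -> knows e D [set z] C -> x \in C ->
  d z x < fuel ->
  let p := descend fuel z x D in
  let: (P, D') := value d p in
  exists s, [/\ P = x :: s, sound e D' /\ extends e D D',
     path (downhill z) x s /\ {subset x :: s <= C},
     {in C, forall y, e (last x s) y -> d z (last x s) != (d z y).+1} &
     cost d p <= #|[set y in C | d z y < d z x]|].
Proof.
elim: fuel x D => // f IH x D sD kD xC hf /=.
rewrite value_bind cost_bind cost_ask_rows cards1 mul1n.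
have kz y : y \in C -> D z y = d z y by move=> yC; apply: kD; rewrite ?inE.
set L := [set y in C | (D z y).+1 == D z x].
have LE y : (y \in L) = (y \in C) && (d z x == (d z y).+1).
  by rewrite inE; case yC: (y \in C); rewrite //= !kz // eq_sym.
have [s1 e1 k1] := ask_rows_spec esym econ [set x] L sD.
set D1 := value d (ask_rows [set x] L D) in s1 e1 k1 *.
have k1x y : y \in L -> (D1 x y == 1) = e x y.
  by move=> yL; rewrite (k1 x y (set11 x) yL) gdist_edge.
case: pickP => [y /andP[yC /andP[h1 h2]]|no] /=; last first.
  exists [::]; split=> //=.
  - by split=> // y; rewrite inE => /eqP->.
  - move=> y yC exy; apply/negP => h.
    have yL : y \in L by rewrite LE yC.
    have := no y; rewrite /= yC k1x // exy andbT.
    by move: yL; rewrite inE yC /= => ->.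
  - rewrite addn0; apply: subset_leq_card; apply/subsetP => y.
    by rewrite LE inE => /andP[-> /eqP->] /=.
have yL : y \in L by rewrite inE yC.
have exy : e x y by rewrite -k1x.
have dxy : d z x = (d z y).+1 by move: yL; rewrite LE => /andP[_ /eqP].
rewrite value_bind cost_bind /= addn0.
have := IH y D1 s1 (knows_extends e1 kD) yC; rewrite -ltnS -dxy => /(_ hf) /=.
case: (value d (descend f z y D1)) => P D2 [s [-> [s2 e2] [ps sub] last_s c2]].
exists (y :: s); split=> //=.
- by split=> //; exact: extends_trans e2.
- by split; [rewrite /downhill exy dxy eqxx | move=> a; rewrite inE => /predU1P[->|/sub]].
- apply: leq_trans (_ : #|L| + #|[set y' in C | d z y' < d z y]| <= _).
    by rewrite leq_add2l.
  rewrite -cardsUI (_ : _ :&: _ = set0) ?cards0 ?addn0; last first.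
    apply/setP => a; rewrite !(inE, LE); apply/negP => /andP[/andP[_ h]].
    by move/andP => [_]; move: h; rewrite dxy; lia.
  apply: subset_leq_card; apply/subsetP => a; rewrite !(inE, LE).
  by move=> /orP[/andP[-> /eqP->]|/andP[-> h]] //=; rewrite dxy; lia.
Qed.

End Descent.

(** * Exploration of regions *)

Section Exploration.
Variable V : finType.
Implicit Types (D : table V) (x y z a b : V) (A B C P R S T : {set V}).

(* An item (C, A, R) is a region C still to be explored: A :|: R contains its
   outer neighbours, and A is known to be connected outside C. *)
Definition item := ({set V} * {set V} * {set V})%type.

(* A shortest path from A to R, of minimal length, either enters C right after
   its start or stays outside C, in which case its end can be added to A. *)
Fixpoint merge_boundary n C D A R : {set V} * {set V} * option (V * V * V) :=
  if n is n'.+1 then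
    if [pick ab : V * V | (ab.1 \in A) && (ab.2 \in R)] is Some ab0 then
      let ab := [arg min_(ab < ab0 | (ab.1 \in A) && (ab.2 \in R)) D ab.1 ab.2] in
      if [pick x in C | (D ab.1 x == 1) && (D ab.1 ab.2 == (D ab.2 x).+1)] is Some x
      then (A, R, Some (ab, x))
      else merge_boundary n' C D (ab.2 |: A) (R :\ ab.2)
    else (A, R, None)
  else (A, R, None).

Definition comps C T S D : seq {set V} :=
  enum [set [set y | same_comp C T S D x y] | x in C :\: S].

Definition split_region C T fuel z x D : prog V (seq V * {set V} * table V) :=
  bind (descend C #|V| z x D) (fun r =>
    bind (sweep C T r.1 x fuel r.2) (fun s =>
      bind (probe C s.1 s.2) (fun D' => Ret V (r.1, s.1, D')))).

(** The path enters [C] next to the vertex of [A] nearest to [u]. A child may meet it, so [Z] is not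
    added to [A]; it becomes the new [R], which is small because the step is taken with the old one
    empty. *)
Definition step_random C A fuel u D : prog V (seq item * table V) :=
  bind (ask_rows [set u] C D) (fun D1 =>
    if [pick ax : V * V | [&& ax.1 \in A, ax.2 \in C, [forall t in A, D1 ax.1 u <= D1 t u],
          D1 ax.1 ax.2 == 1 & D1 ax.1 u == (D1 u ax.2).+1]] is Some ax
    then bind (split_region C A fuel u ax.2 D1) (fun r =>
      let: (_, Z, D') := r in
      Ret V ([seq (C', A, Z) | C' <- comps C A Z D'], D'))
    else Ret V ([::], D1)).

(** The descent aims at [b], which lies outside [C], and follows a geodesic from [A] to [b]. Outside
    a child that misses this path, the path joins [A] to [b] and to [Z]. *)
Definition step_merge C A R fuel b x D : prog V (seq item * table V) :=
  bind (split_region C (A :|: R) fuel b x D) (fun r =>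
    let: (P, Z, D') := r in
    Ret V ([seq if [disjoint C' & P] then (C', b |: (A :|: Z), R :\ b)
              else (C', A, R :|: Z) | C' <- comps C (A :|: R) Z D'], D')).

Definition edges D : rel V := fun x y => D x y == 1.

(** [n] bounds the total size of the regions, which drops at each step; the output for [n = 0] with
    a region left is a dummy. [Random m] has [m.+1] outcomes, whence the predecessor of [#|C|]. *)
Fixpoint explore n fuel x0 (wl : seq item) D : query_alg V :=
  match wl with
  | [::] => Output (gdist (edges D))
  | (C, A, R) :: wl' =>
    if n is m.+1 then
      match merge_boundary #|R| C D A R with
      | (A', R', Some (_, b, x)) =>
          run (step_merge C A' R' fuel b x D)
            (fun r => explore m fuel x0 (r.1 ++ wl') r.2)
      | (A', _, None) =>
          Random (fun i : 'I_(#|C|.-1).+1 =>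
            run (step_random C A' fuel (nth x0 (enum C) i) D)
              (fun r => explore m fuel x0 (r.1 ++ wl') r.2))
      end
    else Output (fun _ _ => 0)
  end.

Definition reconstruct : query_alg V :=
  if #|V| <= 1 then Output (fun _ _ => 0) else
  if [pick r : V] is Some r then
    run (probe [set: V] [set r] (fun _ _ => 0)) (fun D =>
      explore #|V| (up_log 2 #|V|) r [:: ([set~ r], [set r], set0)] D)
  else Output (fun _ _ => 0).

Variable e : rel V.
Hypotheses (esym : symmetric e) (eirr : irreflexive e) (econ : connected_graph e).
Hypothesis af : asteroid_free e.
Variable Delta : nat.
Hypothesis edeg : max_degree_le e Delta.
Notation d := (gdist e).
Notation ww := (walk_within e).

(** The distances inside the boundary are there for [merge_boundary], which compares pairs from [A]
    and [R]. *)
Definition item_ok D (it : item) := let: (C, A, R) := it in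
  [/\ region e C (A :|: R) D, A != set0, C != set0,
      {in A &, forall a a', ww (~: C) a a'} & knows e D (A :|: R) (A :|: R)].

Lemma item_ok_extends D D' it : extends e D D' -> item_ok D it -> item_ok D' it.
Proof.
case: it => [[C A] R] h [h1 h2 h3 h4 h5]; split=> //.
  exact: region_extends h1.
exact: knows_extends h5.
Qed.

(** Minimality keeps the inner vertices of a geodesic from [a] to [b] out of [T]. Since [C] is
    entered only from [T], the geodesic could enter it only at its first step, which the condition
    on the neighbours of [a] excludes. *)
Lemma outside_geodesic C T D a b y :
  region e C T D -> a \in T -> b \in T ->
  {in T, forall t, t != a -> t != b -> d a b <= d a t \/ d a b <= d t b} ->
  {in C, forall x, d a x = 1 -> d a b <> (d b x).+1} ->
  y \notin C -> y = a \/ y = b \/ y \notin T -> d a y + d y b = d a b -> ww (~: C) y b.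
Proof.
move=> [cl dis _ _] aT bT minab noC.
elim: {y}(d y b) {-2}y (erefl (d y b)) => [|n IH] y hy yC hyT hab.
  move/eqP: hy; rewrite gdist_eq0 // => /eqP->.
  by apply: walk_within_refl; rewrite inE; apply: contraTN bT => bC;
     apply/negP => bT; move/pred0P: dis => /(_ b); rewrite /= bT bC.
have yb : y != b by rewrite -(gdist_eq0 econ) hy.
have [z eyz hz] := gdist_next eirr econ yb.
have dzb : d z b = n by move: hz; rewrite hy => -[].
have daz : d a z = (d a y).+1.
  have h1 := gdist_triangle econ z a b; have h2 := gdist_triangle econ y a z.
  have /eqP h3 : d y z == 1 by rewrite gdist_edge.
  by lia.
have zC : z \notin C.
  apply/negP => zC; have ezy : e z y by rewrite esym.
  have := cl z y zC ezy; rewrite inE (negbTE yC) /= => yT.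
  case: hyT => [ya|[yb'|]]; last by rewrite yT.
    apply: (noC z zC); first by rewrite daz ya gdistxx.
    by rewrite -hab ya gdistxx add0n -ya hz [d b z]gdist_sym.
  by rewrite yb' eqxx in yb.
apply: (@walk_within_trans _ _ _ z).
  by apply: walk_within_edge; rewrite ?inE.
apply: IH => //; last by lia.
have [zT|] := boolP (z \in T); last by right; right.
have [->|za] := eqVneq z a; first by left.
have [->|zb] := eqVneq z b; first by right; left.
have zb0 : d z b != 0 by rewrite gdist_eq0.
move: (minab z zT za zb) zb0; rewrite -hab hy daz dzb; move: (d a y) => k.
by clear; lia.
Qed.

Lemma merge_boundary_spec n C D A R : #|R| <= n -> sound e D -> item_ok D (C, A, R) ->
  let: (A', R', o) := merge_boundary n C D A R in
  [/\ A' :|: R' = A :|: R, R' \subset R, item_ok D (C, A', R') &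
    if o is Some (a, b, x) then
      [/\ a \in A', b \in R', x \in C, e a x /\ d a b = (d b x).+1 &
          {in A' & R', forall a' b', d a b <= d a' b'}]
    else R' = set0].
Proof.
elim: n A R => [|n IH] A R hn sD it.
  by move: hn it; rewrite leqn0 cards_eq0 => /eqP-> it /=; split.
have [rD A0 C0 conA kT] := it.
have kAR a b : a \in A -> b \in R -> D a b = d a b.
  by move=> aA bR; apply: kT; rewrite inE ?aA ?bR ?orbT.
rewrite /=; case: pickP => [ab0 hab0|no]; last first.
  split=> //; apply/setP => b; rewrite inE; apply/negP => bR.
  by case/set0Pn: A0 => a aA; have := no (a, b); rewrite /= aA bR.
case: arg_minnP => // -[a b] /andP[/= aA bR] minab.
have min' : {in A & R, forall a' b', d a b <= d a' b'}.
  move=> a' b' a'A b'R; have := minab (a', b'); rewrite /= a'A b'R => /(_ isT).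
  by rewrite !kAR.
have [cl dis T0 [kTC kN]] := rD.
have kC t x : t \in A :|: R -> x \in C -> D t x = d t x by exact: kTC.
have aT : a \in A :|: R by rewrite inE aA.
have bT : b \in A :|: R by rewrite inE bR orbT.
case: pickP => [x /and3P[xC h1 h2]|no].
  split=> //; split=> //; split.
    by rewrite -gdist_edge // -(kC a).
  by move: h2; rewrite kAR // (kC b) // => /eqP.
have notC t : t \in A :|: R -> t \notin C.
  by move=> tT; apply/negP => tC; move/pred0P: dis => /(_ t); rewrite /= tT tC.
have wab : ww (~: C) a b.
  apply: (@outside_geodesic C (A :|: R) D a) => //.
  - move=> t; rewrite inE => /orP[tA|tR] _ _; first by right; apply: min'.
    by left; apply: min'.
  - move=> x xC h1 h2; have := no x; rewrite /= xC (kC a) // h1 eqxx /=.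
    by rewrite kAR // (kC b) // h2 eqxx.
  - exact: notC.
  - by left.
  - by rewrite gdistxx.
have AR' : (b |: A) :|: (R :\ b) = A :|: R.
  apply/setP => t; rewrite !inE; case: (eqVneq t b) => [->|_] /=; last by [].
  by rewrite bR orbT.
have it' : item_ok D (C, b |: A, R :\ b).
  split; rewrite ?AR' //; first by apply/set0Pn; exists b; rewrite !inE eqxx.
  have toa t : t \in b |: A -> ww (~: C) t a.
    rewrite !inE => /predU1P[->|tA]; last exact: conA.
    by rewrite walk_within_sym.
  move=> t t' /toa h /toa h'; apply: (walk_within_trans h).
  by rewrite walk_within_sym.
have hn' : #|R :\ b| <= n by move: hn; rewrite (cardsD1 b R) bR add1n ltnS.
have := IH _ _ hn' sD it'; case: (merge_boundary _ _ _ _ _) => [[A' R'] o].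
rewrite AR' => -[h1 h2 h3 h4]; split=> //.
by apply: subset_trans h2 _; rewrite subsetDl.
Qed.

Lemma mem_comps C T S D C' : region e C T D -> probed e C S D ->
  C' \in comps C T S D -> exists2 x, x \in C :\: S & C' = comp_within e (C :\: S) x.
Proof.
move=> rD pD; rewrite mem_enum => /imsetP[x xCS ->]; exists x => //.
by apply/setP => y; rewrite !inE (same_comp_walk esym eirr econ rD pD).
Qed.

Lemma comp_in_comps C T S D x : region e C T D -> probed e C S D ->
  x \in C :\: S -> comp_within e (C :\: S) x \in comps C T S D.
Proof.
move=> rD pD xCS; rewrite mem_enum; apply/imsetP; exists x => //.
by apply/setP => y; rewrite !inE (same_comp_walk esym eirr econ rD pD).
Qed.

Lemma comp_within_eq A x y : ww A x y -> comp_within e A x = comp_within e A y.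
Proof.
move=> h; apply/setP => z; rewrite !inE; apply/idP/idP => h'.
  by apply: walk_within_trans h'; rewrite walk_within_sym.
exact: walk_within_trans h'.
Qed.

Lemma sum_comps C T S D : region e C T D -> probed e C S D ->
  \sum_(C' <- comps C T S D) #|C'| <= #|C :\: S|.
Proof.
move=> rD pD; rewrite big_enum /=; set F := [set _ | _ in _].
have mem X : X \in F -> exists2 x, x \in C :\: S & X = comp_within e (C :\: S) x.
  by move=> XF; apply: (mem_comps rD pD); rewrite /comps mem_enum.
have /eqP-> : trivIset F.
  apply/trivIsetP => X Y /mem[x xCS ->] /mem[y yCS ->]; apply: contraR.
  case/pred0Pn => z /andP[/=]; rewrite !inE => h1 h2; apply/eqP.
  by rewrite (comp_within_eq h1) (comp_within_eq h2).
apply: subset_leq_card; apply/bigcupsP => X /mem[x _ ->].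
by apply/subsetP => z; rewrite inE => /walk_within_r.
Qed.

End Exploration.

(** * Correctness and cost of one step *)

Section Steps.
Variable V : finType.
Implicit Types (D : table V) (x y z a b : V) (A B C P R S T Z : {set V}).
Variable e : rel V.
Hypotheses (esym : symmetric e) (eirr : irreflexive e) (econ : connected_graph e).
Hypothesis af : asteroid_free e.
Variable Delta : nat.
Hypothesis edeg : max_degree_le e Delta.
Variable fuel : nat.
Hypothesis fuelV : #|V| <= 2 ^ fuel.
Notation d := (gdist e).
Notation ww := (walk_within e).

Definition step_cost C := fuel.+3 ^ 2 * (3 * Delta.+1 * #|C|).

(** The spare [#|C|] in the cost bound pays for the row of the random vertex in [step_random]. *)
Lemma split_region_spec C T z x D : sound e D -> region e C T D -> knows e D [set z] C ->
  x \in C ->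
  let p := split_region C T fuel z x D in
  let: (P, Z, D') := value d p in
  exists s, [/\ P = x :: s, [/\ sound e D', extends e D D', region e C T D' & probed e C Z D'],
     [/\ Z \subset C, Z != set0, #|Z| <= 6 &
       {in Z, forall s, s \in P \/ exists2 x, x \in P & e x s}],
     [/\ path (downhill e z) x s, {subset P <= C},
       {in C, forall y, e (last x s) y -> d z (last x s) != (d z y).+1} &
       {in P, forall x, 2 * #|comp_within e (C :\: Z) x| <= #|C|}] &
     cost d p + #|C| <= step_cost C].
Proof.
move=> sD rD kD xC p; rewrite {}/p /split_region value_bind cost_bind.
have := descend_spec esym eirr econ sD kD xC (gdist_lt_card econ z x).
lazy zeta; case: (value d (descend _ _ _ _ _)) => [P D1] [s [-> [s1 e1] [ps sub] last_s c1]].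
have indP := downhill_induced esym eirr econ ps sub.
have fuelP : size (x :: s) <= 2 ^ fuel.
  apply: leq_trans fuelV; case: indP => _ us _ _ _.
  by rewrite -(card_uniqP us) max_card.
have r1 : ready C T e D1 D1 by split; [split|exact: region_extends e1 rD].
have := sweep_spec x esym eirr econ af edeg indP fuelP r1.
rewrite value_bind cost_bind; case: (value d (sweep _ _ _ _ _ _)) => [Z D2].
move=> [[[s2 e2] r2] [hS1 hS2 hS3] hS4 hS5 c2].
have [s3 e3 p3] := probe_spec esym eirr econ C Z s2.
rewrite value_bind cost_bind; exists s; split=> //.
  split=> //; last exact: region_extends r2.
  exact: extends_trans (extends_trans e1 e2) e3.
have c3 := cost_probe esym eirr econ edeg C Z s2.
have {c1} : cost d (descend C #|V| z x D) <= #|C|.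
  apply: leq_trans c1 _; apply: subset_leq_card; apply/subsetP => y.
  by rewrite inE => /andP[].
have {c3} : cost d (probe C Z D2) <= 2 * (3 * Delta.+1 * #|C|).
  by apply: leq_trans c3 _; rewrite !mulnA !leq_mul.
have : #|C| <= 3 * Delta.+1 * #|C| by rewrite -[X in X <= _]mul1n leq_mul.
move: c2; rewrite /step_cost addn0; move: (3 * _ * _) (cost _ _) (cost _ _) (cost _ _).
move=> u c4 c5 c6; clear; move=> h1 h2 h3 h4.
(* Descent, sweep, final probe and spare row, in units of [3 * Delta.+1 * #|C|]; a probe of six
   vertices takes two units. *)
apply: leq_trans (_ : u + fuel.+1 * (fuel.+3 * u) + 2 * u + u <= _); first by lia.
rewrite (_ : _ ^ 2 = fuel.+1 * fuel.+3 + 2 * fuel.+3); last by lia.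
by rewrite mulnDl -mulnA; lia.
Qed.

(** A child costs no query: as [S] lies in [C], the rows of [T] and [S] over [C] contain all
    distances between [T] and [S] and inside [S]. *)
Lemma child_ok C T S D C' A' R' : sound e D -> region e C T D -> probed e C S D ->
  S \subset C -> knows e D T T -> C' \in comps C T S D ->
  A' :|: R' = T :|: S -> A' != set0 -> {in A' &, forall a a', ww (~: C') a a'} ->
  item_ok e D (C', A', R').
Proof.
move=> [symD sD] rD pD SC kTT C'in E A0 conA.
have [x xCS C'E] := mem_comps esym eirr econ rD pD C'in.
have C'sub : C' \subset C :\: S.
  by rewrite C'E; apply/subsetP => y; rewrite inE => /walk_within_r.
have C'C : C' \subset C by apply: subset_trans C'sub (subsetDl _ _).
have [cl dis T0 [kTC kNC]] := rD; have [kSC kNSC] := pD.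
split=> //; rewrite ?E.
- split=> //.
  + move=> y z yC' eyz; have /setDP[yC yS] := subsetP C'sub _ yC'.
    have := cl y z yC eyz; rewrite !inE => /orP[zC|->]; last by rewrite !orbT.
    have [zS|zS] := boolP (z \in S); first by rewrite !orbT.
    rewrite C'E inE; move: (yC'); rewrite C'E inE => h; rewrite (walk_within_trans h) //.
    by apply: walk_within_edge; rewrite ?inE ?zS ?yS.
  + apply/pred0Pn => -[y /andP[/= + yC']].
    have /setDP[yC yS] := subsetP C'sub _ yC'; rewrite !inE (negbTE yS) orbF => yT.
    by move/pred0P: dis => /(_ y); rewrite /= yT yC.
  + by apply/set0Pn; case/set0Pn: T0 => t tT; exists t; rewrite inE tT.
  + split=> y z; rewrite !inE.
      move=> /orP[yT|yS] /(subsetP C'C) zC; [exact: kTC|exact: kSC].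
    move=> /andP[yC' /exists_inP[t]]; rewrite inE => tTS ety /(subsetP C'C) zC.
    have yC := subsetP C'C _ yC'.
    case/orP: tTS => tTS; [apply: kNC|apply: kNSC] => //;
      by rewrite inE yC; apply/exists_inP; exists t.
- by apply/set0Pn; exists x; rewrite C'E inE; exact: walk_within_refl.
- have inC := subsetP SC.
  move=> t t'; rewrite !inE => /orP[tT|tS] /orP[tT'|tS'].
  + exact: kTT.
  + by apply: kTC => //; exact: inC.
  + by rewrite symD gdist_sym //; apply: kTC => //; exact: inC.
  + by apply: kSC => //; exact: inC.
Qed.

Definition covers C D' (cs : seq (item V)) := {in C &, forall x y, e x y ->
  D' x y = 1 \/ exists2 it, it \in cs & (x \in it.1.1) && (y \in it.1.1)}.

Lemma covers_comps C T S D cs : sound e D -> region e C T D -> probed e C S D ->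
  [seq it.1.1 | it <- cs] = comps C T S D -> covers C D cs.
Proof.
move=> [symD sD] rD pD E x y xC yC exy; have [kSC _] := pD.
have dxy : d x y = 1 by apply/eqP; rewrite gdist_edge.
have [xS|xS] := boolP (x \in S); first by left; rewrite kSC.
have [yS|yS] := boolP (y \in S).
  by left; rewrite symD kSC // gdist_sym.
right; have xCS : x \in C :\: S by rewrite inE xS.
have := comp_in_comps esym eirr econ rD pD xCS; rewrite -E => /mapP[it itin h].
have hyx : y \in comp_within e (C :\: S) x.
  by rewrite inE walk_within_edge // !inE ?xS ?yS.
exists it => //; rewrite -h hyx andbT inE; exact: walk_within_refl.
Qed.

(* The vertex a of T is the one that the geodesic from u enters first. *)
Lemma nearest_inside C T D a u y : region e C T D -> u \in C ->
  {in T, forall t, d u a <= d u t} -> d u y < d u a -> y \in C.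
Proof.
move=> [cl _ _ _] uC mina.
elim: {y}(d u y) {-2}y (erefl (d u y)) => [|n IH] y hy hya.
  by move/eqP: hy; rewrite gdist_eq0 // => /eqP <-.
have yu : y != u by rewrite -(gdist_eq0 econ) gdist_sym // hy.
have [z eyz hz] := gdist_next eirr econ yu.
have duz : d u z = n by move: hz; rewrite ![d _ u]gdist_sym // hy => -[].
have zC : z \in C by apply: IH => //; move: hya; rewrite hy duz; exact: ltnW.
have := cl z y zC; rewrite esym => /(_ eyz); rewrite inE => /orP[//|yT].
by have := mina y yT; rewrite leqNgt hya.
Qed.

Definition step_ok C D cs D' c :=
  [/\ sound e D' /\ extends e D D', {in cs, forall it, item_ok e D' it}, covers C D' cs,
      \sum_(it <- cs) #|it.1.1| < #|C| & c <= step_cost C].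

Lemma sum_children C T Z D cs :
  region e C T D -> probed e C Z D -> Z \subset C -> Z != set0 ->
  [seq it.1.1 | it <- cs] = comps C T Z D ->
  \sum_(it <- cs : seq (item V)) #|it.1.1| < #|C|.
Proof.
move=> rD pD ZC Z0 E; have := sum_comps esym eirr econ rD pD.
rewrite -E big_map => h; apply: leq_ltn_trans h _.
rewrite -(cardsID Z C) (setIidPr ZC) -[X in X < _]add0n ltn_add2r.
by rewrite card_gt0.
Qed.

Lemma downhill_last_le z x s : path (downhill e z) x s -> d z (last x s) <= d z x.
Proof.
elim: s x => //= y s IH x /andP[/andP[_ /eqP h] ps].
by apply: leq_trans (IH _ ps) _; rewrite h.
Qed.

(** The last clause prepares [few_unbalanced_paths]: [A] being connected outside [C], all paths can
    be started from one [r], and a child is either halved by the sweep or confined to a component of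
    [C :\: P]. *)
Lemma step_random_spec C A D r u : sound e D -> item_ok e D (C, A, set0) -> r \in A ->
  u \in C -> let p := step_random C A fuel u D in
  let: (cs, D') := value d p in
  [/\ step_ok C D cs D' (cost d p), {in cs, forall it : item V, #|it.2| <= 6} &
    exists P, ww (~: C :|: P) r u /\ {in cs, forall it : item V, 2 * #|it.1.1| <= #|C| \/
      exists2 x, x \in C :\: P & it.1.1 \subset comp_within e (C :\: P) x}].
Proof.
move=> sD it rA uC p; move: it; rewrite {}/p /item_ok setU0 => -[rD A0 C0 conA kAA].
rewrite /step_random value_bind cost_bind cost_ask_rows cards1 mul1n.
have [s1 e1 k1] := ask_rows_spec esym econ [set u] C sD.
set D1 := value d _ in s1 e1 k1 *.
have [sym1 _] := s1.
have r1 := region_extends e1 rD.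
have [cl dis _ [kAC kNC]] := r1.
have [a0 a0A] : exists a, a \in A by apply/set0Pn.
case: (arg_minnP (fun a => d u a) a0A) => a aA mina.
have ua : a != u by apply: contraTneq aA => ->; apply/negP => uA;
  move/pred0P: dis => /(_ u); rewrite /= uC andbT => /negP; exact.
have [c eac dac] := gdist_next eirr econ ua.
have ducE : d u a = (d u c).+1 by rewrite ![d u _]gdist_sym.
have cC : c \in C by apply: (nearest_inside r1 uC mina); rewrite ducE.
(* The vertex of [A] nearest to [u] and its successor towards [u] pass the test, so the branch
   without children does not occur. *)
case: pickP => [[a' x] /= | /(_ (a, c)) /negP[]]; last first.
  apply/and5P; split=> //=.
  - apply/forall_inP => t tA; rewrite !kAC // ![d _ u]gdist_sym //; exact: mina.
  - by rewrite kAC // gdist_edge.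
  - by rewrite kAC // k1 ?inE // gdist_sym // ducE.
case/and5P => a'A xC /forall_inP min' h1 h2.
have {}mina : {in A, forall t, d u a' <= d u t}.
  by move=> t tA; have := min' t tA; rewrite !kAC // ![d _ u]gdist_sym.
have {h1} ea'x : e a' x by move: h1; rewrite kAC // gdist_edge.
have {h2} dua' : d u a' = (d u x).+1.
  by move: h2; rewrite kAC // k1 ?inE // gdist_sym // => /eqP.
rewrite value_bind cost_bind.
have := split_region_spec s1 r1 k1 xC; lazy zeta.
case: (value d (split_region _ _ _ _ _ _)) => [[P Z] D2].
move=> [s [PE [s2 e2 r2 p2] [ZC Z0 Z6 adj] [ps sub last_s half] c2]] /=.
have kAA2 : knows e D2 A A by apply: knows_extends kAA; exact: extends_trans e2.
split.
- split.
  + by split=> //; exact: extends_trans e2.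
  + move=> _ /mapP[C' C'in ->]; apply: (child_ok s2 r2 p2 ZC kAA2 C'in erefl A0).
    have [y yCZ ->] := mem_comps esym eirr econ r2 p2 C'in.
    move=> a1 a2 h1 h2; apply: walk_within_sub (conA _ _ h1 h2); rewrite setCS.
    by apply/subsetP => z; rewrite inE => /walk_within_r /setDP[].
  + apply: (covers_comps s2 r2 p2); rewrite -map_comp; exact: map_id.
  + by apply: (sum_children r2 p2 ZC Z0); rewrite -map_comp; exact: map_id.
  + by rewrite addn0 addnC.
- by move=> _ /mapP[C' _ ->].
exists [set z in P]; split.
  (* The path stays closer to [u] than all of [A], so a next vertex towards [u] is in [C] and the
     descent cannot stop before [u]. *)
  have -> : u = last x s.
    have [//|neq] := eqVneq u (last x s); rewrite eq_sym in neq.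
    have [y h1 h2] := gdist_next eirr econ neq.
    have h3 : d u (last x s) = (d u y).+1 by rewrite ![d u _]gdist_sym.
    have yC : y \in C.
      apply: (nearest_inside r1 uC mina); rewrite dua'.
      by have := downhill_last_le ps; rewrite h3 => h; rewrite ltnS ltnW.
    by have := last_s y yC h1; rewrite h3 eqxx.
  have notC t : t \in A -> t \notin C.
    by move=> tA; apply/negP => tC; move/pred0P: dis => /(_ t); rewrite /= tA tC.
  apply: (@walk_within_trans _ _ _ a').
    by apply: walk_within_sub (conA _ _ rA a'A); exact: subsetUl.
  apply: (@walk_within_trans _ _ _ x).
    have xP : x \in P by rewrite PE mem_head.
    by apply: walk_within_edge => //; rewrite !inE ?xP ?orbT ?notC.
  apply/walk_withinP; exists s; split=> //.
    by apply: sub_path ps => y z /andP[].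
  by move=> z hz; rewrite !inE PE hz orbT.
move=> _ /mapP[C' C'in ->] /=.
have [y yCZ ->] := mem_comps esym eirr econ r2 p2 C'in.
have [disj|] := boolP [disjoint comp_within e (C :\: Z) y & P]; last first.
  case/pred0Pn => z /andP[/= + zP]; rewrite inE => h; left.
  by rewrite (comp_within_eq esym h) half.
right.
have sub' w : ww (C :\: Z) y w -> w \notin P.
  by move=> h; apply/negP => wP; move/pred0P: disj => /(_ w); rewrite /= inE h wP.
have yC : y \in C by case/setDP: yCZ.
exists y; first by rewrite !inE yC andbT sub' // walk_within_refl.
apply/subsetP => w; rewrite !inE => /walk_withinP[q [pq lq sq]].
apply/walk_withinP; exists q; split=> // z zq; rewrite !inE.
have /setDP[-> _] := sq z zq; rewrite andbT; apply: sub'.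
case/splitPl: zq pq sq lq => q1 q2 lq1; rewrite cat_path => /andP[pq1 _] sq _.
apply/walk_withinP; exists q1; split=> // t tq; apply: sq.
by rewrite -cat_cons mem_cat tq.
Qed.

End Steps.

Section BalancedSteps.
Variable V : finType.
Implicit Types (D : table V) (x y z a b : V) (A B C P R S T : {set V}).
Variable e : rel V.
Hypotheses (esym : symmetric e) (eirr : irreflexive e) (econ : connected_graph e).
Hypothesis af : asteroid_free e.
Variable Delta : nat.
Hypothesis edeg : max_degree_le e Delta.
Variable fuel : nat.
Hypothesis fuelV : #|V| <= 2 ^ fuel.
Notation d := (gdist e).
Notation ww := (walk_within e).

Lemma random_mostly_balanced C A D : sound e D -> item_ok e D (C, A, set0) ->
  2 * #|[set u in C | ~~ all (fun it : item V => 10 * #|it.1.1| <= 9 * #|C|)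
                             (value d (step_random C A fuel u D)).1]| <= #|C|.
Proof.
move=> sD it; have [_ /set0Pn[r rA] _ _ _] := it.
have /fin_all_exists[Ps hPs] u : exists P, u \in C -> ww (~: C :|: P) r u /\
    {in (value d (step_random C A fuel u D)).1, forall it : item V, 2 * #|it.1.1| <= #|C| \/
      exists2 x, x \in C :\: P & it.1.1 \subset comp_within e (C :\: P) x}.
  have [uC|] := boolP (u \in C); last by exists set0.
  have := step_random_spec esym eirr econ af edeg fuelV sD it rA uC.
  lazy zeta; case: (value d _) => cs D' [_ _ [P hP]]; by exists P.
have hww : {in C, forall u, ww (~: C :|: Ps u) r u} by move=> u /hPs[].
apply: leq_trans (few_unbalanced_paths esym af hww); rewrite leq_mul2l /=.
apply: subset_leq_card; apply/subsetP => u; rewrite !inE => /andP[uC].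
rewrite uC /=; apply: contraR => /exists_inPn no; apply/allP => it' /(proj2 (hPs u uC)).
case=> [h|[x xCP /subset_leq_card h]]; first by lia.
have := no x xCP; rewrite -leqNgt => h'; apply: leq_trans h'.
by rewrite leq_mul2l.
Qed.

Lemma step_merge_spec C A R a b x D : sound e D -> item_ok e D (C, A, R) ->
  a \in A -> b \in R -> x \in C -> e a x -> d a b = (d b x).+1 ->
  {in A & R, forall a' b', d a b <= d a' b'} ->
  let p := step_merge C A R fuel b x D in
  let: (cs, D') := value d p in
  step_ok e Delta fuel C D cs D' (cost d p) /\
  {in cs, forall it : item V, 2 * #|it.1.1| <= #|C| /\ #|it.2| <= #|R| + 6 \/
     #|it.2| < #|R|}.
Proof.
move=> sD it aA bR xC eax dab mini p.
have [rD A0 C0 conA kTT] := it; have [cl dis T0 [kTC _]] := rD.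
have notC t : t \in A :|: R -> t \notin C.
  by move=> tT; apply/negP => tC; move/pred0P: dis => /(_ t); rewrite /= tT tC.
have bT : b \in A :|: R by rewrite inE bR orbT.
have bC : b \notin C by exact: notC.
have kD : knows e D [set b] C by apply: knows_sub kTC; rewrite ?sub1set.
rewrite {}/p /step_merge value_bind cost_bind.
have := split_region_spec esym eirr econ af edeg fuelV sD rD kD xC.
lazy zeta; case: (value d (split_region _ _ _ _ _ _)) => [[P Z] D2].
move=> [s [PE [s2 e2 r2 p2] [ZC Z0 Z6 adj] [ps sub last_s half] c2]].
have kTT2 := knows_extends e2 kTT.
rewrite /= addn0; split.
  set mk := fun C' => _.
  have mkE : [seq it.1.1 | it <- [seq mk C' | C' <- comps C (A :|: R) Z D2]]
      = comps C (A :|: R) Z D2.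
    by rewrite -map_comp -[RHS]map_id; apply: eq_map => C'; rewrite /= /mk; case: ifP.
  split=> //; last by apply: leq_trans c2; exact: leq_addr.
  - move=> _ /mapP[C' C'in ->]; have := mem_comps esym eirr econ r2 p2 C'in.
    move=> [y yCZ C'E]; have C'CZ : C' \subset C :\: Z.
      by rewrite C'E; apply/subsetP => z; rewrite inE => /walk_within_r.
    have sub' : ~: C \subset ~: C'.
      by rewrite setCS; apply: subset_trans C'CZ (subsetDl _ _).
    have conA' t t' : t \in A -> t' \in A -> ww (~: C') t t'.
      by move=> tA t'A; apply: (walk_within_sub sub'); exact: conA.
    rewrite /mk; case: ifP => disj; last first.
      by apply: (child_ok esym eirr econ s2 r2 p2 ZC kTT2 C'in); rewrite // setUA.
    apply: (child_ok esym eirr econ s2 r2 p2 ZC kTT2 C'in).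
    + apply/setP => t; rewrite !inE; case: (eqVneq t b) => [->|_]; rewrite /= ?bR ?orbT //.
      by case: (t \in A); case: (t \in R); case: (t \in Z).
    + by apply/set0Pn; exists b; rewrite !inE eqxx.
    have PC' t : t \in P -> t \in ~: C'.
      move=> tP; rewrite inE; apply/negP => tC'.
      by move/pred0P: disj => /(_ t); rewrite /= tC' tP.
    have wax : ww (~: C') a x.
      apply: walk_within_edge => //; last by apply: PC'; rewrite PE mem_head.
      by apply: (subsetP sub'); rewrite inE notC // inE aA.
    have wxP t : t \in P -> ww (~: C') x t.
      move=> tP; have ts : t \in x :: s by rewrite -PE.
      case/splitPl: ts (ps) (PE) => [q1 q2 lq1] ps' PE'.
      apply/walk_withinP; exists q1; split=> //.
        move: ps'; rewrite cat_path => /andP[pq _].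
        by apply: sub_path pq => u v /andP[].
      by move=> z hz; apply: PC'; rewrite PE' -cat_cons mem_cat hz.
    (* Outside the child, [a] reaches [x], then the whole path, then [Z], one edge away at most, and
       [b] after the last vertex. *)
    have toa t : t \in b |: (A :|: Z) -> ww (~: C') a t.
      rewrite !inE => /predU1P[->|/orP[tA|tZ]]; last 2 first.
      - exact: conA'.
      - apply: (walk_within_trans wax); have [/wxP//|[z zP ezt]] := adj t tZ.
        apply: (walk_within_trans (wxP z zP)); apply: walk_within_edge => //.
          exact: PC'.
        by rewrite inE; apply/negP => /(subsetP C'CZ) /setDP[_ /negP].
      (* A further step towards [b] leaves [C] at a boundary vertex [z]. In [A], it would be closer
         to [b] than [a] is; in [R] and distinct from [b], it would be closer to [a] than [b] is. *)
      have lP : last x s \in P by rewrite PE mem_last.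
      apply: (walk_within_trans wax); apply: (walk_within_trans (wxP _ lP)).
      apply: walk_within_edge; [exact: PC'|by apply: (subsetP sub'); rewrite inE|].
      have bl : last x s != b by apply: contraNneq bC => <-; exact: sub.
      have [z elz dlz] := gdist_next eirr econ bl.
      have dbl : d b (last x s) = (d b z).+1 by rewrite ![d b _]gdist_sym.
      have zC : z \notin C.
        by apply/negP => zC; have := last_s z zC elz; rewrite dbl eqxx.
      have := cl _ _ (sub _ lP) elz; rewrite inE (negbTE zC) /= inE => /orP[zA|zR].
        have := mini z b zA bR; have := downhill_last_le ps.
        by rewrite dbl dab [d z b]gdist_sym //; clear; lia.
      have [<-//|zb] := eqVneq z b.
      have := mini a z aA zR.
      have epx : path e x s by apply: sub_path ps => u v /andP[].
      have := @gdist_le_walk _ e a (x :: rcons s z).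
      rewrite /= rcons_path eax epx elz last_rcons size_rcons => /(_ isT).
      have := downhill_dist ps (ltnSn (size s)); rewrite -last_nth dbl dab.
      have : d b z != 0 by rewrite gdist_eq0 // eq_sym.
      by clear; lia.
    move=> t t' /toa h /toa h'; apply: walk_within_trans h'.
    by rewrite walk_within_sym.
  - exact: (covers_comps esym eirr econ s2 r2 p2).
  - exact: (sum_children esym eirr econ r2 p2 ZC Z0).
move=> _ /mapP[C' C'in ->]; case: ifP => disj /=.
  by right; rewrite [X in _ < X](cardsD1 b R) bR.
left; have [y yCZ C'E] := mem_comps esym eirr econ r2 p2 C'in.
have [z] := pred0Pn (negbT disj); rewrite /= => /andP[zC' zP].
have := half z zP; rewrite C'E in zC' *; rewrite inE in zC'.
rewrite (comp_within_eq esym zC'); split=> //.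
by apply: leq_trans (leq_card_setU _ _) _; rewrite leq_add2l.
Qed.
End BalancedSteps.

(** * Invariant of the exploration *)

Section Explore.
Variable V : finType.
Implicit Types (D : table V) (x y z a b : V) (A B C P R S T : {set V}).
Implicit Types (it : item V) (wl cs : seq (item V)).
Variable e : rel V.
Hypotheses (esym : symmetric e) (eirr : irreflexive e) (econ : connected_graph e).
Hypothesis af : asteroid_free e.
Variable Delta : nat.
Hypothesis edeg : max_degree_le e Delta.
Notation d := (gdist e).
Notation ww := (walk_within e).

Lemma eq_gdist (e1 e2 : rel V) : e1 =2 e2 -> gdist e1 =2 gdist e2.
Proof.
move=> E x y; rewrite /gdist; apply: eq_find => k; apply: eq_existsb => p.
by rewrite (eq_path E).
Qed.

(** An edge is recorded or lies inside a pending region; when no region is left, the table contains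
    the whole graph and the distances follow without queries. *)
Definition invariant n wl D :=
  [/\ sound e D, {in wl, forall it, item_ok e D it}, \sum_(it <- wl) #|it.1.1| <= n &
    forall x y, e x y ->
      D x y = 1 \/ exists2 it, it \in wl & (x \in it.1.1) && (y \in it.1.1)].

Lemma invariant_edges n D : invariant n [::] D -> edges D =2 e.
Proof.
move=> [[_ sD] _ _ cov] x y; rewrite /edges; apply/eqP/idP => [h|exy].
  by rewrite -(gdist_edge eirr econ); move: (sD x y); rewrite h => -[<-|].
by case: (cov x y exy) => // -[].
Qed.

Variable fuel : nat.
Hypothesis fuelV : #|V| <= 2 ^ fuel.

Lemma invariant_step n C A R wl D cs D' c : invariant n ((C, A, R) :: wl) D ->
  step_ok e Delta fuel C D cs D' c -> invariant n.-1 (cs ++ wl) D'.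
Proof.
move=> [sD ok sumn cov] [[sD' eD] ok' cov' lt _]; split=> //.
- move=> it; rewrite mem_cat => /orP[/ok'//|itin].
  by apply: item_ok_extends eD _; apply: ok; rewrite inE itin orbT.
- rewrite big_cat /=; have {}sumn : #|C| + \sum_(it <- wl) #|it.1.1| <= n.
    by move: sumn; rewrite big_cons.
  move: lt; rewrite -(ltn_add2r (\sum_(it <- wl) #|it.1.1|)) => /leq_trans/(_ sumn).
  by case: (n).
- move=> x y exy; have dxy : d x y = 1 by apply/eqP; rewrite gdist_edge.
  case: (cov x y exy) => [h|[it]]; first by left; rewrite eD // dxy.
  rewrite inE => /predU1P[->/=/andP[xC yC]|itin h]; last first.
    by right; exists it; rewrite // mem_cat itin orbT.
  case: (cov' x y xC yC exy) => [|[it' h1 h2]]; first by left.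
  by right; exists it'; rewrite // mem_cat h1.
Qed.

Lemma explore_step n C A R wl D : invariant n ((C, A, R) :: wl) D -> 0 < n /\
  match merge_boundary #|R| C D A R with
  | (A', R', Some (_, b, x)) =>
      let: (cs, D') := value d (step_merge C A' R' fuel b x D) in
      [/\ invariant n.-1 (cs ++ wl) D', \sum_(it <- cs) #|it.1.1| <= #|C|,
        {in cs, forall it, 0 < #|it.1.1| /\
          (2 * #|it.1.1| <= #|C| /\ #|it.2| <= #|R| + 6 \/ #|it.2| < #|R|)} &
        cost d (step_merge C A' R' fuel b x D) <= step_cost Delta fuel C]
  | (A', _, None) => [/\ 0 < #|C|,
      {in C, forall u, let: (cs, D') := value d (step_random C A' fuel u D) in
      [/\ invariant n.-1 (cs ++ wl) D', \sum_(it <- cs) #|it.1.1| <= #|C|,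
        {in cs, forall it, 0 < #|it.1.1| /\ #|it.2| <= 6} &
        cost d (step_random C A' fuel u D) <= step_cost Delta fuel C]} &
      2 * #|[set u in C | ~~ all (fun it => 10 * #|it.1.1| <= 9 * #|C|)
                             (value d (step_random C A' fuel u D)).1]| <= #|C|]
  end.
Proof.
move=> inv; have [sD ok sumn cov] := inv.
have it : item_ok e D (C, A, R) by apply: ok; exact: mem_head.
have [_ _ C0 _ _] := it; rewrite -card_gt0 in C0.
have pos cs D' c : step_ok e Delta fuel C D cs D' c ->
    {in cs, forall it, 0 < #|it.1.1|} /\ \sum_(it <- cs) #|it.1.1| <= #|C|.
  case=> _ ok' _ /ltnW ? _; split=> // -[[C' A1] R1] /ok'[_ _ h _ _].
  by rewrite card_gt0.
split; first by move: sumn; rewrite big_cons /=; apply: leq_trans; exact: ltn_addr.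
have := merge_boundary_spec esym eirr econ (leqnn #|R|) sD it.
case: (merge_boundary _ _ _ _ _) => [[A' R'] [[[a b] x]|]] [_ R'R it' h].
  case: h => aA bR xC [eax dab] mini.
  have := step_merge_spec esym eirr econ af edeg fuelV sD it' aA bR xC eax dab mini.
  lazy zeta; case: (value d _) => cs D' [sok ch]; have [p1 p2] := pos _ _ _ sok.
  split=> //; first exact: invariant_step inv sok.
    move=> it1 it1in; split; first exact: p1.
    have := subset_leq_card R'R; case: (ch it1 it1in) => [[h1 h2] h3|h1 h3].
      by left; split=> //; apply: leq_trans h2 _; rewrite leq_add2r.
    by right; exact: leq_trans h1 h3.
  by case: sok.
rewrite h in it'; have [_ /set0Pn[r rA] _ _ _] := it'.
split=> //; last exact: (random_mostly_balanced esym eirr econ af edeg fuelV sD it').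
move=> u uC; have := step_random_spec esym eirr econ af edeg fuelV sD it' rA uC.
lazy zeta; case: (value d _) => cs D' [sok ch _]; have [p1 p2] := pos _ _ _ sok.
split=> //; first exact: invariant_step inv sok.
  by move=> it1 it1in; split; [exact: p1|exact: ch].
by case: sok.
Qed.

Lemma nth_enum_mem C x0 (i : 'I_(#|C|.-1).+1) : 0 < #|C| -> nth x0 (enum C) i \in C.
Proof.
by move=> C0; rewrite -mem_enum mem_nth // -cardE -[X in _ < X](prednK C0).
Qed.

Lemma explore_correct n x0 wl D : invariant n wl D ->
  always_reconstructs d (explore n fuel x0 wl D).
Proof.
elim: n wl D => [|n IH] [|[[C A] R] wl] D inv /=.
- by move=> u v; apply: eq_gdist; exact: invariant_edges inv.
- by have [] := explore_step inv.
- by move=> u v; apply: eq_gdist; exact: invariant_edges inv.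
have [_] := explore_step inv.
case: (merge_boundary _ _ _ _ _) => [[A' R'] [[[a b] x]|]].
  rewrite always_reconstructs_run.
  by case: (value d _) => cs D' [/IH inv' _ _ _].
case=> C0 h _ /= i; rewrite always_reconstructs_run.
have := h _ (nth_enum_mem x0 i C0).
by case: (value d _) => cs D' [/IH inv' _ _ _].
Qed.

Lemma initial_invariant r : 1 < #|V| ->
  invariant #|V| [:: ([set~ r], [set r], set0)]
    (value d (probe [set: V] [set r] (fun _ _ => 0))).
Proof.
move=> V1; have s0 : sound e (fun _ _ => 0) by split=> // x y; right.
have [s1 _ [k1 k2]] := probe_spec esym eirr econ [set: V] [set r] s0.
set D := value d _ in s1 k1 k2 *.
have k1' y : D r y = d r y by apply: k1; rewrite !inE.
split=> //.
- move=> it; rewrite inE => /eqP->; rewrite /item_ok setU0; split.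
  + split; last split.
    * by move=> x y _ _; rewrite !inE orNb.
    * by apply/pred0P => x /=; rewrite !inE andbN.
    * by apply/set0Pn; exists r; rewrite inE.
    * by apply: knows_sub k1; rewrite ?subsetT.
    * apply: knows_sub k2; rewrite ?subsetT //; apply/subsetP => x.
      by rewrite !inE => /andP[_].
  + by apply/set0Pn; exists r; rewrite inE.
  + by rewrite -card_gt0 cardsC1; case: #|V| V1 => // -[].
  + by move=> a a'; rewrite !inE => /eqP-> /eqP->; apply: walk_within_refl; rewrite !inE eqxx.
  + by move=> a a'; rewrite !inE => /eqP-> _.
- by rewrite big_seq1 /= max_card.
move=> x y exy; have [sym _] := s1.
have dxy : d x y = 1 by apply/eqP; rewrite gdist_edge.
have [xr|xr] := eqVneq x r; first by left; rewrite xr k1' -xr.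
have [yr|yr] := eqVneq y r; first by left; rewrite sym yr k1' -yr gdist_sym.
by right; exists ([set~ r], [set r], set0); rewrite !inE ?eqxx ?xr ?yr.
Qed.

End Explore.

Lemma reconstruct_correct (V : finType) (e : rel V) Delta : symmetric e -> irreflexive e ->
  connected_graph e -> asteroid_free e -> max_degree_le e Delta ->
  always_reconstructs (gdist e) (reconstruct V).
Proof.
move=> esym eirr econ af edeg; rewrite /reconstruct; case: leqP => [V1|V1].
  move=> u v; have -> : u = v by apply: (fintype_le1P V1).
  by rewrite gdistxx.
case: pickP => [r _|no]; last by move: V1; rewrite eq_card0.
rewrite always_reconstructs_run; apply: (explore_correct esym eirr econ af edeg).
  exact: up_logP.
exact: initial_invariant.
Qed.

From mathcomp Require Import all_order all_algebra.
From mathcomp Require Import ring lra.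
Import Order.TTheory GRing.Theory Num.Theory.
Local Open Scope ring_scope.

(** * Crossing parity of polygonal chains *)

Section CrossingParity.
Variable R : realFieldType.
Implicit Types (p q a b c : R * R).

(** The order of abscissae after an infinitesimal shear, which disposes of vertical segments and of
    points on a common vertical. *)
Definition lexlt p q := (p.1 < q.1) || ((p.1 == q.1) && (p.2 < q.2)).

(** Twice the signed area of the triangle [a b p], positive when [p] is to the left of the line from
    [a] to [b]. *)
Definition orient a b p := (b.1 - a.1) * (p.2 - a.2) - (b.2 - a.2) * (p.1 - a.1).

(** A half-open interval, with the smaller end included: consecutive segments of a chain then share
    no abscissa twice when it runs in one direction. *)
Definition btw p a b := lexlt p a (+) lexlt p b.

Definition below p a b :=
  btw p a b && (if lexlt a b then orient a b p < 0 else orient b a p < 0).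

Definition on_seg p q c :=
  exists2 t : R, 0 <= t <= 1 &
    c = ((1 - t) * p.1 + t * q.1, (1 - t) * p.2 + t * q.2).

(* Each of the four ends contributes whether it is below the other segment; the
   last line corrects for the order of the ends. Being a sum over ends, the
   parity telescopes along chains and needs no general position. *)
Definition seg_cross p q a b :=
  below p a b (+) below q a b (+) (below a p q (+) below b p q)
  (+) (btw p a b (+) btw q a b).

Lemma lexltP p q : reflect (p.1 < q.1 \/ p.1 = q.1 /\ p.2 < q.2) (lexlt p q).
Proof.
rewrite /lexlt; apply: (iffP orP) => -[]; [by left | | by left |].
  by move=> /andP[/eqP ? ?]; right.
by move=> [-> ->]; right; rewrite eqxx.
Qed.

Lemma lexltxx p : lexlt p p = false.
Proof. by rewrite /lexlt !ltxx andbF. Qed.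

Lemma lexlt_total p q : p <> q -> lexlt q p = ~~ lexlt p q.
Proof.
case: p q => p1 p2 [q1 q2] neq; rewrite /lexlt /=.
case: (ltgtP p1 q1) => //= e1; case: (ltgtP p2 q2) => //= e2.
by case: neq; rewrite e1 e2.
Qed.

Lemma lexlt_trans : transitive lexlt.
Proof.
move=> b a c /lexltP H1 /lexltP H2; apply/lexltP.
case: H1 => [h|[h h']]; case: H2 => [k|[k k']].
- by left; lra.
- by left; lra.
- by left; lra.
- by right; split; lra.
Qed.

Lemma lexlt_asym p q : lexlt p q -> lexlt q p = false.
Proof.
move=> h; apply/negbTE/negP => h'.
by have := lexlt_trans h h'; rewrite lexltxx.
Qed.

Lemma on_seg_l p q : on_seg p q p.
Proof. by exists 0; [lra | case: p => x y /=; congr (_, _); ring]. Qed.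

Lemma on_seg_r p q : on_seg p q q.
Proof. by exists 1; [lra | case: q => x y /=; congr (_, _); ring]. Qed.

Lemma on_segC p q c : on_seg p q c -> on_seg q p c.
Proof. by case=> t ht ->; exists (1 - t); [lra | congr (_, _); ring]. Qed.

Lemma collinear_on_seg p q c :
  lexlt p c -> lexlt c q -> orient p q c = 0 -> on_seg p q c.
Proof.
case: p q c => [p1 p2] [q1 q2] [c1 c2] /lexltP /= H1 /lexltP /= H2.
rewrite /orient /= => ho.
have [h|h] := ltP p1 q1.
  have hn : q1 - p1 != 0 by lra.
  exists ((c1 - p1) / (q1 - p1)).
    rewrite divr_ge0 /= ?ler_pdivrMr; lra.
  congr (_, _) => /=; first by field.
  apply: (mulfI hn).
  have -> : (q1 - p1) * ((1 - (c1 - p1) / (q1 - p1)) * p2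
      + (c1 - p1) / (q1 - p1) * q2) = (q1 - c1) * p2 + (c1 - p1) * q2 by field.
  by lra.
have [e1 e2] : p1 = q1 /\ c1 = q1 by lra.
have hn : q2 - p2 != 0 by lra.
exists ((c2 - p2) / (q2 - p2)).
  rewrite divr_ge0 /= ?ler_pdivrMr; lra.
congr (_, _) => /=; last by field.
by rewrite e1 e2; ring.
Qed.

Lemma lexlt_conv_r p a b c :
  lexlt p a -> lexlt p b -> on_seg a b c -> lexlt p c.
Proof.
move=> /lexltP H1 /lexltP H2 [t /andP[t0 t1] ->]; apply/lexltP => /=.
have [->|tn0] := eqVneq t 0; first by case: H1 => [h|[h h']]; [left|right]; lra.
have [->|tn1] := eqVneq t 1; first by case: H2 => [h|[h h']]; [left|right]; lra.
have tp : 0 < t by rewrite lt_neqAle eq_sym tn0.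
have tp1 : 0 < 1 - t by rewrite subr_gt0 lt_neqAle tn1.
case: H1 => [h|[h h']]; case: H2 => [k|[k k']].
- by left; nra.
- by left; nra.
- by left; nra.
- by right; split; [rewrite -h -k; ring | nra].
Qed.

Lemma lexlt_conv_l p a b c :
  lexlt a p -> lexlt b p -> on_seg a b c -> lexlt c p.
Proof.
move=> /lexltP H1 /lexltP H2 [t /andP[t0 t1] ->]; apply/lexltP => /=.
have [->|tn0] := eqVneq t 0; first by case: H1 => [h|[h h']]; [left|right]; lra.
have [->|tn1] := eqVneq t 1; first by case: H2 => [h|[h h']]; [left|right]; lra.
have tp : 0 < t by rewrite lt_neqAle eq_sym tn0.
have tp1 : 0 < 1 - t by rewrite subr_gt0 lt_neqAle tn1.
case: H1 => [h|[h h']]; case: H2 => [k|[k k']].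
- by left; nra.
- by left; nra.
- by left; nra.
- by right; split; [rewrite h k; ring | nra].
Qed.

(* Lexicographically positive vectors form a half-plane, on which turning
   counterclockwise is transitive. *)
Lemma cross_trans (x1 x2 y1 y2 z1 z2 : R) :
  0 < x1 \/ 0 = x1 /\ 0 < x2 -> 0 < y1 \/ 0 = y1 /\ 0 < y2 ->
  0 < z1 \/ 0 = z1 /\ 0 < z2 ->
  0 < x1 * y2 - x2 * y1 -> 0 < y1 * z2 - y2 * z1 -> 0 < x1 * z2 - x2 * z1.
Proof.
move=> hx hy hz hxy hyz.
case: hy => [hy|[hy hy']]; last first.
  move: hxy hyz; rewrite -hy mulr0 subr0 mul0r sub0r oppr_gt0 => hxy hyz.
  have hz1 : z1 < 0 by rewrite -(pmulr_rlt0 _ hy').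
  by case: hz => [hz|[hz hz']]; lra.
rewrite -(pmulr_lgt0 _ hy).
have -> : (x1 * z2 - x2 * z1) * y1 =
  (x1 * y2 - x2 * y1) * z1 + (y1 * z2 - y2 * z1) * x1 by ring.
case: hx => [hx|[hx hx']]; last first.
  have : 0 < x2 * y1 by rewrite mulr_gt0.
  by move: hxy; rewrite -hx mul0r; lra.
have := mulr_gt0 hyz hx.
case: hz => [hz|[hz hz']]; first by have := mulr_gt0 hxy hz; lra.
by rewrite -hz mulr0; lra.
Qed.

Lemma seg_meet_of_signs p q a b :
  orient p q a < 0 -> 0 < orient p q b -> 0 < orient a b p -> orient a b q < 0 ->
  exists2 c, on_seg p q c & on_seg a b c.
Proof.
case: p q a b => [p1 p2] [q1 q2] [a1 a2] [b1 b2] /=.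
pose k := (q1 - p1) * (b2 - a2) - (q2 - p2) * (b1 - a1); rewrite /orient /=.
set fa := (X in X < 0 -> _); set fb := (X in _ -> 0 < X -> _).
set gp := (X in _ -> _ -> 0 < X -> _); set gq := (X in _ -> _ -> _ -> X < 0 -> _).
move=> hfa hfb hgp hgq.
have ek : k = fb - fa by rewrite /k /fb /fa; ring.
have ek' : k = gp - gq by rewrite /k /gp /gq; ring.
have kp : 0 < k by lra.
have kn : k != 0 by lra.
(* Cramer's rule, [k] being the determinant of the two directions. *)
pose t := - fa / k; pose s := gp / k.
have ht : t * k = - fa by rewrite /t; field.
have hs : s * k = gp by rewrite /s; field.
exists ((1 - s) * p1 + s * q1, (1 - s) * p2 + s * q2).
  by exists s => //; rewrite /s divr_ge0 ?ler_pdivrMr //=; lra.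
exists t => /=; first by rewrite /t divr_ge0 ?ler_pdivrMr //=; lra.
congr (_, _); apply: (mulIf kn).
  transitivity (p1 * k + (s * k) * (q1 - p1)); first by ring.
  transitivity (a1 * k + (t * k) * (b1 - a1)); last by ring.
  by rewrite ht hs /gp /fa /k; ring.
transitivity (p2 * k + (s * k) * (q2 - p2)); first by ring.
transitivity (a2 * k + (t * k) * (b2 - a2)); last by ring.
by rewrite ht hs /gp /fa /k; ring.
Qed.

Lemma orientC a b p : orient b a p = - orient a b p.
Proof. by rewrite /orient; ring. Qed.

Lemma btwC p a b : btw p a b = btw p b a.
Proof. by rewrite /btw addbC. Qed.

Lemma belowC p a b : below p a b = below p b a.
Proof.
rewrite /below btwC; case: (btw p b a) => //=.
have [->//|/eqP neq] := eqVneq a b.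
by rewrite (lexlt_total neq); case: (lexlt a b).
Qed.

Lemma btw_swap p q a b : p <> a -> p <> b -> q <> a -> q <> b ->
  btw p a b (+) btw q a b = btw a p q (+) btw b p q.
Proof.
move=> h1 h2 h3 h4; rewrite /btw.
rewrite (lexlt_total h1) (lexlt_total h2) (lexlt_total h3) (lexlt_total h4).
by case: (lexlt p a); case: (lexlt p b); case: (lexlt q a); case: (lexlt q b).
Qed.

Lemma seg_crossCl p q a b : seg_cross p q a b = seg_cross q p a b.
Proof.
rewrite /seg_cross (belowC a p q) (belowC b p q).
by rewrite (addbC (below p a b)) (addbC (btw p a b)).
Qed.

Lemma seg_crossCr p q a b : seg_cross p q a b = seg_cross p q b a.
Proof.
rewrite /seg_cross (belowC p b a) (belowC q b a) (btwC p b a) (btwC q b a).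
by rewrite (addbC (below a p q)).
Qed.

Lemma seg_crossC p q a b : p <> a -> p <> b -> q <> a -> q <> b ->
  seg_cross p q a b = seg_cross a b p q.
Proof.
move=> h1 h2 h3 h4; rewrite /seg_cross (btw_swap h1 h2 h3 h4).
by rewrite (addbC (_ (+) _) (below a p q (+) _)).
Qed.

(** If [a] and [b] were on different sides of the line [p q], the segment [a b] would meet this line
    at a point which lies lexicographically between [p] and [q], hence on the segment [p q]. *)
Lemma seg_meet_nested p q a b : lexlt p a -> lexlt a b -> lexlt b q ->
  (forall c, on_seg p q c -> on_seg a b c -> False) ->
  (orient p q a < 0) = (orient p q b < 0).
Proof.
move=> hpa hab hbq dis.
have haq := lexlt_trans hab hbq; have hpb := lexlt_trans hpa hab.
have na : orient p q a != 0.
  by apply/eqP => /(collinear_on_seg hpa haq) h; apply: dis h (on_seg_l _ _).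
have nb : orient p q b != 0.
  by apply/eqP => /(collinear_on_seg hpb hbq) h; apply: dis h (on_seg_r _ _).
have key : 0 < orient p q a * orient p q b.
  rewrite ltNge; apply/negP => hle.
  have hlt : orient p q a * orient p q b < 0.
    by rewrite lt_neqAle hle mulf_neq0.
  move: na nb hlt; set u := orient p q a; set v := orient p q b => na nb hlt.
  have uv : u - v != 0.
    by apply/eqP => /subr0_eq h; move: hlt; rewrite h -expr2 ltNge sqr_ge0.
  pose t := u / (u - v).
  have ht : 0 <= t <= 1.
    rewrite /t; case: (ltgtP u 0) na => // hu _.
      have hv : 0 < v by rewrite -(nmulr_rlt0 _ hu).
      have -> : u / (u - v) = (- u) / (v - u).
        by field; rewrite uv -opprB oppr_eq0 uv.
      by rewrite divr_ge0 ?ler_pdivrMr //=; lra.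
    have hv : v < 0 by rewrite -(pmulr_rlt0 _ hu).
    by rewrite divr_ge0 ?ler_pdivrMr //=; lra.
  pose c := ((1 - t) * a.1 + t * b.1, (1 - t) * a.2 + t * b.2).
  have hc : on_seg a b c by exists t.
  apply: (dis c _ hc); apply: collinear_on_seg.
  - exact: lexlt_conv_r hc.
  - exact: lexlt_conv_l hc.
  have -> : orient p q c = (1 - t) * u + t * v.
    by rewrite /u /v /orient /c /=; ring.
  by rewrite /t; field.
by apply/idP/idP => h; nra.
Qed.

(** If both tests agreed, transitivity of turning among the differences of the four points would
    give the two missing signs of [seg_meet_of_signs]. *)
Lemma seg_meet_interleaved p q a b : lexlt p a -> lexlt a q -> lexlt q b ->
  (forall c, on_seg p q c -> on_seg a b c -> False) ->
  (orient p q a < 0) = ~~ (orient a b q < 0).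
Proof.
move=> hpa haq hqb dis.
have na : orient p q a != 0.
  by apply/eqP => /(collinear_on_seg hpa haq) h; apply: dis h (on_seg_l _ _).
have nq : orient a b q != 0.
  by apply/eqP => /(collinear_on_seg haq hqb) h; apply: dis (on_seg_r _ _) h.
have hpq := lexlt_trans hpa haq; have hab := lexlt_trans haq hqb.
have diff x y : lexlt x y -> 0 < y.1 - x.1 \/ 0 = y.1 - x.1 /\ 0 < y.2 - x.2.
  by move=> /lexltP[h|[h h']]; [left|right; split]; lra.
have := diff _ _ hpa; have := diff _ _ haq; have := diff _ _ hqb.
have := diff _ _ hpq; have := diff _ _ hab => {diff}.
case: p q a b na nq dis {hpa haq hqb hpq hab} => [p1 p2] [q1 q2] [a1 a2] [b1 b2].
move=> na nq dis /= d' d v w r.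
have T := cross_trans.
case: (ltgtP (orient (p1, p2) (q1, q2) (a1, a2)) 0) na => // h1 _;
case: (ltgtP (orient (a1, a2) (b1, b2) (q1, q2)) 0) nq => // h2 _; exfalso.
  have hdw : 0 < (q1 - p1) * (q2 - a2) - (q2 - p2) * (q1 - a1).
    by move: h1; rewrite /orient /=; lra.
  have hwd' : 0 < (q1 - a1) * (b2 - a2) - (q2 - a2) * (b1 - a1).
    by move: h2; rewrite /orient /=; lra.
  have hwv : 0 < (q1 - a1) * (b2 - q2) - (q2 - a2) * (b1 - q1) by lra.
  have hdv := T _ _ _ _ _ _ d w v hdw hwv.
  have hrw : 0 < (a1 - p1) * (q2 - a2) - (a2 - p2) * (q1 - a1) by lra.
  have hrd' := T _ _ _ _ _ _ r w d' hrw hwd'.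
  have [||c c1 c2] := @seg_meet_of_signs (p1, p2) (q1, q2) (a1, a2) (b1, b2) h1 _ _ h2.
  - by rewrite /orient /=; lra.
  - by rewrite /orient /=; lra.
  - exact: dis c1 c2.
have hwd : 0 < (q1 - a1) * (q2 - p2) - (q2 - a2) * (q1 - p1).
  by move: h1; rewrite /orient /=; lra.
have hd'w : 0 < (b1 - a1) * (q2 - a2) - (b2 - a2) * (q1 - a1).
  by move: h2; rewrite /orient /=; lra.
have hvw : 0 < (b1 - q1) * (q2 - a2) - (b2 - q2) * (q1 - a1) by lra.
have hvd := T _ _ _ _ _ _ v w d hvw hwd.
have hwr : 0 < (q1 - a1) * (a2 - p2) - (q2 - a2) * (a1 - p1) by lra.
have hd'r := T _ _ _ _ _ _ d' w r hd'w hwr.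
have [||||c c1 c2] := @seg_meet_of_signs (q1, q2) (p1, p2) (a1, a2) (b1, b2).
- by rewrite orientC; lra.
- by rewrite /orient /=; lra.
- exact: h2.
- by rewrite /orient /=; lra.
- by apply: dis (on_segC c1) c2.
Qed.

(** By symmetry [p] is the least of the four points; the segments are then separated, interleaved or
    nested in the lexicographic order. *)
Lemma seg_cross_disjoint p q a b :
  (forall c, on_seg p q c -> on_seg a b c -> False) -> seg_cross p q a b = false.
Proof.
have ends p' q' a' b' :
    (forall c, on_seg p' q' c -> on_seg a' b' c -> False) ->
    [/\ p' <> a', p' <> b', q' <> a' & q' <> b'].
  have L := on_seg_l; have Rr := on_seg_r.
  move=> dis; split=> h; [apply: (dis p')|apply: (dis p')|apply: (dis q')
    |apply: (dis q')] => //; rewrite h //.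
move=> dis; have [npa npb nqa nqb] := ends _ _ _ _ dis.
have [epq|/eqP npq] := eqVneq p q.
  by subst q; rewrite /seg_cross /below /btw !addbb.
have [eab|/eqP nab] := eqVneq a b.
  by subst b; rewrite /seg_cross /below /btw !addbb.
wlog hpq : p q dis npa npb nqa nqb npq / lexlt p q.
  move=> W; case hpq: (lexlt p q); first exact: W.
  rewrite seg_crossCl; apply: W => //.
  - by move=> c /on_segC; apply: dis.
  - by move=> h; apply: npq.
  - by rewrite (lexlt_total npq) hpq.
wlog hab : a b dis npa npb nqa nqb nab / lexlt a b.
  move=> W; case hab: (lexlt a b); first exact: W.
  rewrite seg_crossCr; apply: W => //.
  - by move=> c h /on_segC; apply: dis.
  - by move=> h; apply: nab.
  - by rewrite (lexlt_total nab) hab.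
wlog hpa : p q a b dis npa npb nqa nqb npq nab hpq hab / lexlt p a.
  move=> W; case hpa: (lexlt p a); first exact: W.
  rewrite seg_crossC //; apply: W => //; try by move=> h; subst.
  - by move=> c h1 h2; apply: dis h2 h1.
  - by rewrite (lexlt_total npa) hpa.
have hpb := lexlt_trans hpa hab.
rewrite /seg_cross /below /btw hpa hpb hpq hab /=.
rewrite (lexlt_asym hpa) (lexlt_asym hpb) /=.
case hqa: (lexlt q a).
  have hqb := lexlt_trans hqa hab.
  by rewrite hqb (lexlt_asym hqa) (lexlt_asym hqb).
have haq : lexlt a q by rewrite (lexlt_total nqa) hqa.
rewrite haq /=; case hqb: (lexlt q b) => /=.
  rewrite (lexlt_asym hqb) /= (seg_meet_interleaved hpa haq hqb dis).
  by case: (orient a b q < 0).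
have hbq : lexlt b q by rewrite (lexlt_total nqb) hqb.
by rewrite hbq /= (seg_meet_nested hpa hab hbq dis) addbb.
Qed.

End CrossingParity.

Section SegXor.
Variable T : Type.
Implicit Types (F G : T -> T -> bool) (x y : T) (s t : seq T).

Fixpoint seg_xor F x s : bool :=
  if s is y :: s' then F x y (+) seg_xor F y s' else false.

Lemma seg_xor_cat F x s t :
  seg_xor F x (s ++ t) = seg_xor F x s (+) seg_xor F (last x s) t.
Proof. by elim: s x => [|y s IH] x //=; rewrite IH addbA. Qed.

Lemma seg_xor_add F G x s :
  seg_xor (fun p q => F p q (+) G p q) x s = seg_xor F x s (+) seg_xor G x s.
Proof.
elim: s x => [|y s IH] x //=; rewrite IH.
by rewrite addbACA.
Qed.

Lemma eq_seg_xor F G x s : F =2 G -> seg_xor F x s = seg_xor G x s.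
Proof. by move=> e; elim: s x => [|y s IH] x //=; rewrite e IH. Qed.

Lemma seg_xor_tele (f : T -> bool) x s :
  seg_xor (fun p q => f p (+) f q) x s = f x (+) f (last x s).
Proof.
elim: s x => [|y s IH] x /=; first by rewrite addbb.
by rewrite IH -!addbA; congr (_ (+) _); rewrite addbA addbb.
Qed.

Lemma seg_xor_rev F x s : (forall p q, F p q = F q p) ->
  seg_xor F (last x s) (rev (belast x s)) = seg_xor F x s.
Proof.
move=> Fsym; elim: s x => [|y s IH] x //=.
rewrite rev_cons -cats1 seg_xor_cat IH /= addbF addbC; congr (_ (+) _).
suff -> : last (last y s) (rev (belast y s)) = y by [].
by case: s {IH} => //= z s; rewrite rev_cons last_rcons.
Qed.

End SegXor.

Section PolygonParity.
Variable R : realFieldType.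
Implicit Types (x y p q : R * R) (s t : seq (R * R)).

Fixpoint on_poly x s (c : R * R) : Prop :=
  if s is y :: s' then on_seg x y c \/ on_poly y s' c else False.

Lemma on_poly_cat x s t c :
  on_poly x (s ++ t) c <-> on_poly x s c \/ on_poly (last x s) t c.
Proof.
elim: s x => [|y s IH] x /=; first by split; [right | case].
by rewrite IH; tauto.
Qed.

Definition poly_cross x s y t :=
  seg_xor (fun p q => seg_xor (fun a b => seg_cross p q a b) y t) x s.

Definition poly_above p y t := seg_xor (fun a b => below p a b) y t.

Lemma poly_cross_disjoint x s y t :
  (forall c, on_poly x s c -> on_poly y t c -> False) ->
  poly_cross x s y t = false.
Proof.
rewrite /poly_cross; elim: s x => [|x' s IH] x //= dis.
rewrite IH ?addbF; last by move=> c h1 h2; apply: (dis c) => //; right.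
have {}dis c : on_seg x x' c -> on_poly y t c -> False.
  by move=> h1 h2; apply: (dis c) => //; left.
elim: t y dis {IH} => [|y' t IH] y //= dis.
rewrite IH; last by move=> c h1 h2; apply: (dis c) => //; right.
rewrite seg_cross_disjoint // => c h1 h2.
by apply: (dis c) => //; left.
Qed.

Lemma poly_cross_ends x s y t :
  poly_cross x s y t =
    poly_above x y t (+) poly_above (last x s) y t
    (+) (poly_above y x s (+) poly_above (last y t) x s)
    (+) (btw x y (last y t) (+) btw (last x s) y (last y t)).
Proof.
pose f p := poly_above p y t; pose g p := btw p y (last y t).
have inner p q : seg_xor (fun a b => seg_cross p q a b) y t =
    (f p (+) f q) (+) (below y p q (+) below (last y t) p q) (+) (g p (+) g q).
  transitivity (seg_xor (fun a b => below p a b (+) below q a b) y t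
    (+) seg_xor (fun a b => below a p q (+) below b p q) y t
    (+) seg_xor (fun a b => btw p a b (+) btw q a b) y t).
    by rewrite -!seg_xor_add.
  rewrite (seg_xor_tele (fun a => below a p q)); congr (_ (+) _ (+) _).
    exact: seg_xor_add.
  by rewrite seg_xor_add /g /btw (seg_xor_tele (lexlt p)) (seg_xor_tele (lexlt q)).
rewrite /poly_cross (eq_seg_xor _ _ inner).
transitivity (seg_xor (fun p q => f p (+) f q) x s
  (+) seg_xor (fun p q => below y p q (+) below (last y t) p q) x s
  (+) seg_xor (fun p q => g p (+) g q) x s); first by rewrite -!seg_xor_add.
by rewrite (seg_xor_tele f) (seg_xor_tele g) seg_xor_add.
Qed.

Lemma poly_cross_catl x s s' y t :
  poly_cross x (s ++ s') y t = poly_cross x s y t (+) poly_cross (last x s) s' y t.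
Proof. exact: seg_xor_cat. Qed.

Lemma poly_cross_catr x s y t t' :
  poly_cross x s y (t ++ t') = poly_cross x s y t (+) poly_cross x s (last y t) t'.
Proof.
by rewrite /poly_cross -seg_xor_add; apply: eq_seg_xor => p q; rewrite seg_xor_cat.
Qed.

Lemma poly_cross_revl x s y t :
  poly_cross (last x s) (rev (belast x s)) y t = poly_cross x s y t.
Proof.
apply: seg_xor_rev => p q; apply: eq_seg_xor => a b; exact: seg_crossCl.
Qed.

Lemma poly_cross_revr x s y t :
  poly_cross x s (last y t) (rev (belast y t)) = poly_cross x s y t.
Proof.
apply: eq_seg_xor => p q; apply: seg_xor_rev => a b; exact: seg_crossCr.
Qed.

Lemma poly_crossC x s y t :
  x <> y -> x <> last y t -> last x s <> y -> last x s <> last y t ->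
  poly_cross x s y t = poly_cross y t x s.
Proof.
move=> h1 h2 h3 h4; rewrite !poly_cross_ends (btw_swap h1 h2 h3 h4).
by congr (_ (+) _); rewrite addbC.
Qed.

Lemma below_top p a b : a.2 <= p.2 -> b.2 <= p.2 -> below p a b = false.
Proof.
move=> ha hb; rewrite /below /btw.
wlog hab : a b ha hb / lexlt a b.
  move=> W; have [->|/eqP n] := eqVneq a b; first by rewrite addbb.
  case h: (lexlt a b).
    by have := W a b ha hb h; rewrite h.
  have h' : lexlt b a by rewrite (lexlt_total n) h.
  by have := W b a hb ha h'; rewrite h' addbC.
rewrite hab; apply/negbTE/negP => /andP[hb1].
have [hpa|npa] := boolP (lexlt p a).
  by move: hb1; rewrite hpa (lexlt_trans hpa hab).
move: hb1; rewrite (negbTE npa) /= => /lexltP hpb.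
have hpa : a.1 <= p.1.
  by rewrite leNgt; apply/negP => h; move/negP: npa; apply; apply/lexltP; left.
have {}hpb : p.1 <= b.1 by case: hpb; lra.
rewrite /orient; apply/negP; rewrite -leNgt.
have h1 : 0 <= (b.1 - p.1) * (p.2 - a.2) by rewrite mulr_ge0 //; lra.
have h2 : 0 <= (p.1 - a.1) * (p.2 - b.2) by rewrite mulr_ge0 //; lra.
nra.
Qed.

Lemma poly_above_top p y t : y.2 <= p.2 -> {in t, forall z, z.2 <= p.2} ->
  poly_above p y t = false.
Proof.
rewrite /poly_above; elim: t y => [|z t IH] y //= hy ht.
have hz : z.2 <= p.2 by apply: ht; rewrite mem_head.
rewrite below_top //=; apply: IH => // z' h.
by rewrite ht // inE h orbT.
Qed.

(** Each of the three terms tells whether two pairs interleave; of the three ways to split four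
    points of a line into two pairs, exactly one is interleaved. *)
Lemma btw_three (r u v w : R * R) :
  r <> u -> r <> v -> r <> w -> u <> v -> u <> w -> v <> w ->
  btw u r v (+) btw w r v (+) (btw v r u (+) btw w r u)
  (+) (btw u r w (+) btw v r w) = true :> bool.
Proof.
move=> ru rv rw uv uw vw; rewrite /btw (lexlt_total uv) (lexlt_total uw).
rewrite (lexlt_total vw).
by case: (lexlt u r); case: (lexlt v r); case: (lexlt w r);
   case: (lexlt u v); case: (lexlt u w); case: (lexlt v w).
Qed.

(* Arcs run from x to tx; the chains tu -> u -> w -> tw and tr -> r -> v -> tv
   both have their ends at the top. *)
Lemma chain_parity H (r u v w : R * R) sr su sv sw pv quw :
  last r pv = v -> last u quw = w ->
  (last r sr).2 = H -> (last u su).2 = H -> (last v sv).2 = H ->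
  (last w sw).2 = H ->
  {in r :: sr ++ u :: su ++ v :: sv ++ w :: sw ++ pv ++ quw,
     forall z, z.2 <= H} ->
  (forall c, on_poly u quw c -> on_poly r pv c -> False) ->
  (forall c, on_poly u quw c -> on_poly r sr c -> False) ->
  (forall c, on_poly u quw c -> on_poly v sv c -> False) ->
  (forall c, on_poly u su c -> on_poly r pv c -> False) ->
  (forall c, on_poly w sw c -> on_poly r pv c -> False) ->
  poly_cross u su r sr (+) poly_cross u su v sv
    (+) (poly_cross w sw r sr (+) poly_cross w sw v sv)
  = btw (last u su) (last r sr) (last v sv)
    (+) btw (last w sw) (last r sr) (last v sv).
Proof.
move=> ev ew hr hu hv hw hH d1 d2 d3 d4 d5.
set tr := last r sr; set tu := last u su; set tv := last v sv; set tw := last w sw.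
rewrite -/tr in hr; rewrite -/tu in hu; rewrite -/tv in hv; rewrite -/tw in hw.
have lastrev x s : last (last x s) (rev (belast x s)) = x.
  by case: s => //= z s; rewrite rev_cons last_rcons.
pose E := rev (belast u su) ++ quw ++ sw.
pose B := rev (belast r sr) ++ pv ++ sv.
have lE : last tu E = tw by rewrite /E !last_cat lastrev ew.
have lB : last tr B = tv by rewrite /B !last_cat lastrev ev.
have : poly_cross tu E tr B = poly_cross u su r sr (+) poly_cross u su v sv
    (+) (poly_cross w sw r sr (+) poly_cross w sw v sv).
  (* Of the nine pairs of pieces, five are disjoint. *)
  rewrite /E /B !poly_cross_catl !poly_cross_catr !lastrev ew ev.
  rewrite !poly_cross_revl !poly_cross_revr.
  rewrite (poly_cross_disjoint d1) (poly_cross_disjoint d2).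
  rewrite (poly_cross_disjoint d3) (poly_cross_disjoint d4).
  by rewrite (poly_cross_disjoint d5) /=.
move=> <-; rewrite poly_cross_ends lE lB.
have memb x s : {subset rev (belast x s) <= x :: s}.
  by move=> z; rewrite mem_rev; apply: mem_belast.
have inE' z : z \in tu :: E -> z.2 <= H.
  rewrite inE /E !mem_cat => /orP[/eqP->|]; first by rewrite hu.
  move=> h; apply: hH; rewrite !(inE, mem_cat); move: h => /or3P[/memb|->|->].
  - by rewrite inE => /orP[->|->]; rewrite ?orbT.
  - by rewrite ?orbT.
  - by rewrite ?orbT.
have inB z : z \in tr :: B -> z.2 <= H.
  rewrite inE /B !mem_cat => /orP[/eqP->|]; first by rewrite hr.
  move=> h; apply: hH; rewrite !(inE, mem_cat); move: h => /or3P[/memb|->|->].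
  - by rewrite inE => /orP[->|->]; rewrite ?orbT.
  - by rewrite ?orbT.
  - by rewrite ?orbT.
have topE p z : p.2 = H -> z \in tu :: E -> z.2 <= p.2 by move=> ->; apply: inE'.
have topB p z : p.2 = H -> z \in tr :: B -> z.2 <= p.2 by move=> ->; apply: inB.
have tailE p : p.2 = H -> {in E, forall z, z.2 <= p.2}.
  by move=> hp z hz; apply: topE; rewrite // inE hz orbT.
have tailB p : p.2 = H -> {in B, forall z, z.2 <= p.2}.
  by move=> hp z hz; apply: topB; rewrite // inE hz orbT.
rewrite (poly_above_top (topB tu _ hu (mem_head _ _)) (tailB tu hu)).
rewrite (poly_above_top (topB tw _ hw (mem_head _ _)) (tailB tw hw)).
rewrite (poly_above_top (topE tr _ hr (mem_head _ _)) (tailE tr hr)).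
by rewrite (poly_above_top (topE tv _ hv (mem_head _ _)) (tailE tv hv)).
Qed.

End PolygonParity.

Section Aster.
Variable R : realFieldType.

Definition poly_disjoint (x : R * R) s y t :=
  forall c, on_poly x s c -> on_poly y t c -> False.

(** Add the three instances of [chain_parity]: every pair of prolongations occurs twice and cancels,
    whereas the right-hand sides add up to 1 by [btw_three]. *)
Lemma no_asteroid_polygons H (r u v w : R * R) sr su sv sw pu pv pw quv quw qvw :
  last r pu = u -> last r pv = v -> last r pw = w ->
  last u quv = v -> last u quw = w -> last v qvw = w ->
  (last r sr).2 = H -> (last u su).2 = H -> (last v sv).2 = H ->
  (last w sw).2 = H ->
  uniq [:: r; u; v; w] ->
  uniq [:: last r sr; last u su; last v sv; last w sw] ->
  u.2 < H -> v.2 < H -> w.2 < H ->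
  {in r :: sr ++ u :: su ++ v :: sv ++ w :: sw
      ++ pu ++ pv ++ pw ++ quv ++ quw ++ qvw, forall z, z.2 <= H} ->
  poly_disjoint u quv r pw -> poly_disjoint u quw r pv -> poly_disjoint v qvw r pu ->
  poly_disjoint u quv r sr -> poly_disjoint u quw r sr -> poly_disjoint v qvw r sr ->
  poly_disjoint u quv w sw -> poly_disjoint u quw v sv -> poly_disjoint v qvw u su ->
  poly_disjoint u su r pv -> poly_disjoint u su r pw ->
  poly_disjoint v sv r pu -> poly_disjoint v sv r pw ->
  poly_disjoint w sw r pu -> poly_disjoint w sw r pv ->
  False.
Proof.
move=> epu epv epw euv euw evw hr hu hv hw uniq1 uniq2 ltu ltv ltw hH.
move=> dP1 dP2 dP3 dr1 dr2 dr3 ds1 ds2 ds3 a1 a2 a3 a4 a5 a6.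
have Ev := @chain_parity R H r u v w sr su sv sw pv quw epv euw hr hu hv hw _
  dP2 dr2 ds2 a1 a6.
have Ew := @chain_parity R H r u w v sr su sw sv pw quv epw euv hr hu hw hv _
  dP1 dr1 ds1 a2 a4.
have Eu := @chain_parity R H r v u w sr sv su sw pu qvw epu evw hr hv hu hw _
  dP3 dr3 ds3 a3 a5.
have S1 : poly_cross u su v sv = poly_cross v sv u su.
  apply: poly_crossC => h.
  - by move: uniq1; rewrite h /= !inE eqxx ?orbT ?andbF.
  - by move: ltu; rewrite h hv ltxx.
  - by move: ltv; rewrite -h hu ltxx.
  - by move: uniq2; rewrite h /= !inE eqxx ?orbT ?andbF.
have S2 : poly_cross u su w sw = poly_cross w sw u su.
  apply: poly_crossC => h.
  - by move: uniq1; rewrite h /= !inE eqxx ?orbT ?andbF.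
  - by move: ltu; rewrite h hw ltxx.
  - by move: ltw; rewrite -h hu ltxx.
  - by move: uniq2; rewrite h /= !inE eqxx ?orbT ?andbF.
have S3 : poly_cross v sv w sw = poly_cross w sw v sv.
  apply: poly_crossC => h.
  - by move: uniq1; rewrite h /= !inE eqxx ?orbT ?andbF.
  - by move: ltv; rewrite h hw ltxx.
  - by move: ltw; rewrite -h hv ltxx.
  - by move: uniq2; rewrite h /= !inE eqxx ?orbT ?andbF.
have := @btw_three R (last r sr) (last u su) (last v sv) (last w sw).
have := uniq2; rewrite /= !inE !negb_or => /andP[/and3P[/eqP q1 /eqP q2 /eqP q3]].
move=> /andP[/andP[/eqP q4 /eqP q5] /andP[/eqP q6 _]].
move=> /(_ q1 q2 q3 q4 q5 q6).
rewrite -Ev.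
  rewrite -Eu.
    rewrite -Ew.
      rewrite S1 S2 S3.
      by case: (poly_cross u su r sr); case: (poly_cross v sv u su);
        case: (poly_cross w sw r sr); case: (poly_cross w sw v sv);
        case: (poly_cross v sv r sr); case: (poly_cross w sw u su).
all: move=> z; rewrite !(inE, mem_cat) => h; apply: hH; rewrite !(inE, mem_cat).
all: by repeat case/orP: h => [h|h]; rewrite h ?orbT.
Qed.

End Aster.

From mathcomp Require Import all_classical all_reals all_analysis.
Import numFieldNormedType.Exports.

(** * Expected number of queries *)

Section ExpectedCost.
Variables (R : realType) (V : finType).

Lemma expected_queries_run T delta (p : prog V T) (f : T -> query_alg V) :
  expected_queries R delta (run p f) =
  (cost delta p)%:R + expected_queries R delta (f (value delta p)).
Proof.
elim: p => [t|u v k IH] /=; first by rewrite add0r.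
by rewrite IH mulrS addrA.
Qed.

(* Chosen so that rate * ln decreases by 14 when the size drops by a tenth: the
   6 vertices and the unit gained in a step are paid for by half of that. *)
Definition rate : R := 14 / ln (10 / 9).

Lemma ln_10_9_gt0 : 0 < ln (10 / 9) :> R.
Proof. by apply: ln_gt0; lra. Qed.

Lemma rate_gt0 : 0 < rate.
Proof. by rewrite divr_gt0 // ln_10_9_gt0. Qed.

Lemma rate_ln_le m k : (0 < m)%N -> (m <= k)%N -> rate * ln m%:R <= rate * ln k%:R.
Proof.
move=> m0 mk; rewrite ler_pM2l ?rate_gt0 //.
by rewrite ler_ln ?ler_nat // posrE ltr0n // (leq_trans m0 mk).
Qed.

Lemma rate_ln_drop m k : (0 < m)%N -> (10 * m <= 9 * k)%N ->
  rate * ln m%:R <= rate * ln k%:R - 14.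
Proof.
move=> m0 mk; have k0 : (0 < k)%N by case: k mk; rewrite // muln0 leqn0 muln_eq0; case: m m0.
have m0' : 0 < m%:R :> R by rewrite ltr0n.
have p : 0 < 10 / 9 :> R by lra.
have h : ln (m%:R * (10 / 9)) <= ln k%:R :> R.
  rewrite ler_ln ?posrE ?ltr0n ?mulr_gt0 ?p //.
  by move: mk; rewrite -(ler_nat R) !natrM => h; lra.
move: h; rewrite lnM ?posrE ?p //.
rewrite -(ler_pM2l rate_gt0) mulrDr [rate * ln (10 / 9)]divfK ?gt_eqF ?ln_10_9_gt0 //.
by lra.
Qed.

(** With L for [rate * ln #|C|], a balanced draw leaves at most L - 14 + 6 + 8 = L per vertex and
    any other draw at most L + 14. The mean is at most L + 7, so the constant 8 leaves one unit per
    vertex for the queries. *)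
Definition weight (it : item V) : R :=
  #|it.1.1|%:R * (rate * ln #|it.1.1|%:R + #|it.2|%:R + 8).

Lemma sum_weight_le (cs : seq (item V)) (k : nat) (B : R) : 0 <= B ->
  (\sum_(it <- cs) #|it.1.1| <= k)%N ->
  {in cs, forall it : item V, rate * ln #|it.1.1|%:R + #|it.2|%:R + 8 <= B} ->
  \sum_(it <- cs) weight it <= k%:R * B.
Proof.
move=> B0 sumk h.
apply: le_trans (_ : (\sum_(it <- cs) #|it.1.1|)%:R * B <= _); last first.
  by rewrite ler_wpM2r // ler_nat.
rewrite natr_sum mulr_suml big_seq [leRHS]big_seq.
by apply: ler_sum => it itin; rewrite ler_wpM2l ?ler0n // h.
Qed.

Variable e : rel V.
Hypotheses (esym : symmetric e) (eirr : irreflexive e) (econ : connected_graph e).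
Hypothesis af : asteroid_free e.
Variable Delta : nat.
Hypothesis edeg : max_degree_le e Delta.
Variable fuel : nat.
Hypothesis fuelV : (#|V| <= 2 ^ fuel)%N.
Notation d := (gdist e).

Definition unit_price : R := (fuel.+3 ^ 2 * (3 * Delta.+1))%:R.

Lemma step_cost_price (C : {set V}) c : (c <= step_cost Delta fuel C)%N ->
  c%:R <= unit_price * #|C|%:R.
Proof. by rewrite -natrM -mulnA ler_nat. Qed.

Lemma rate_ln_ge0 m : (0 < m)%N -> 0 <= rate * ln m%:R.
Proof.
by move=> m0; rewrite mulr_ge0 ?ln_ge0 ?ler1n //; exact/ltW/rate_gt0.
Qed.

Lemma sum_enum_nth x0 (C : {set V}) (F : V -> R) : (0 < #|C|)%N ->
  \sum_(i < (#|C|.-1).+1) F (nth x0 (enum C) i) = \sum_(u in C) F u.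
Proof.
by move=> C0; rewrite -[RHS]big_enum [RHS](big_nth x0) -cardE big_mkord prednK.
Qed.

Lemma explore_expected n x0 wl D : invariant e n wl D ->
  expected_queries R d (explore n fuel x0 wl D) <=
  unit_price * \sum_(it <- wl) weight it.
Proof.
have price0 : 0 <= unit_price by exact: ler0n.
elim: n wl D => [|n IH] [|[[C A] B] wl] D inv /=.
- by rewrite big_nil mulr0.
- by have [] := explore_step esym eirr econ af edeg fuelV inv.
- by rewrite big_nil mulr0.
have [_] := explore_step esym eirr econ af edeg fuelV inv.
have C0 : (0 < #|C|)%N.
  have [_ ok _ _] := inv; have [_ _ C0 _ _] := ok _ (mem_head _ _).
  by rewrite card_gt0.
set L := rate * ln #|C|%:R; have L0 : 0 <= L := rate_ln_ge0 C0.
have wE : weight (C, A, B) = #|C|%:R * (L + #|B|%:R + 8) by [].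
rewrite big_cons {}wE; set W := \sum_(it <- wl) weight it.
have c0 : 0 <= #|C|%:R :> R by exact: ler0n.
have b0 : 0 <= #|B|%:R :> R by exact: ler0n.
have small (cs : seq (item V)) : (\sum_(it <- cs) #|it.1.1| <= #|C|)%N ->
    {in cs, forall it : item V, (#|it.1.1| <= #|C|)%N}.
  move=> h it itin; apply: leq_trans h; rewrite (big_rem it) //=; exact: leq_addr.
have half m k : (2 * m <= k)%N -> (10 * m <= 9 * k)%N by lia.
case: (merge_boundary _ _ _ _ _) => [[A' B'] [[[a b] x]|]].
  rewrite expected_queries_run; set p := step_merge _ _ _ _ _ _ _.
  case: (value d p) => cs D' [inv' sumC hcs cp] /=.
  apply: le_trans (lerD (step_cost_price cp) (IH _ _ inv')) _.
  rewrite -mulrDr ler_wpM2l // big_cat /= -/W.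
  (* A halved child gains at most six vertices in [R] but loses 14 in the logarithm; any other child
     loses a vertex of [R]. Either way a unit is freed for the queries. *)
  have : \sum_(it <- cs) weight it <= #|C|%:R * (L + #|B|%:R + 7).
    apply: sum_weight_le => //; first by lra.
    move=> it itin; have [pos ch] := hcs it itin.
    case: ch => [[h1 h2]|h1].
      have h1' : (10 * #|it.1.1| <= 9 * #|C|)%N by exact: half.
      have h3 := rate_ln_drop pos h1'; rewrite -/L in h3.
      by move: h2 h3; rewrite -(ler_nat R) natrD; lra.
    have h3 := rate_ln_le pos (small _ sumC it itin); rewrite -/L in h3.
    by move: h1 h3; rewrite -(ler_nat R) -natr1; lra.
  by lra.
case=> _ hstep bad; set E := fun u => expected_queries R d
  (run (step_random C A' fuel u D) (fun r => explore n fuel x0 (r.1 ++ wl) r.2)).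
set bads := [set u in C | _] in bad.
rewrite [leLHS]/= [X in X / _](_ : _ = \sum_(u in C) E u); last exact: (sum_enum_nth x0 E C0).
rewrite prednK // ler_pdivrMr ?ltr0n //.
(* A bad draw costs 14 more per vertex of [C], and at most half of the draws are bad. *)
pose M u := unit_price * (#|C|%:R * (L + 1) + W + #|C|%:R * 14 * (u \in bads)%:R).
have EM u : u \in C -> E u <= M u.
  move=> uC; rewrite /E expected_queries_run; have := hstep u uC.
  have : u \in bads = ~~ all (fun it : item V => 10 * #|it.1.1| <= 9 * #|C|)%N
                         (value d (step_random C A' fuel u D)).1.
    by rewrite inE uC.
  rewrite /M; set p := step_random _ _ _ _ _.
  case: (value d p) => cs D' /= -> [inv' sumC hcs cp].
  apply: le_trans (lerD (step_cost_price cp) (IH _ _ inv')) _.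
  rewrite -mulrDr ler_wpM2l // big_cat /= -/W.
  have : \sum_(it <- cs) weight it <= #|C|%:R *
      (L + 14 * (~~ all (fun it : item V => 10 * #|it.1.1| <= 9 * #|C|)%N cs)%:R).
    apply: sum_weight_le => //; first by rewrite addr_ge0 // mulr_ge0 ?ler0n.
    move=> it itin; have [pos h1] := hcs it itin.
    move: h1; rewrite -(ler_nat R) => h1.
    case: allP => [/(_ it itin) h2|_] /=.
      by have := rate_ln_drop pos h2; rewrite -/L; move: h1; lra.
    by have := rate_ln_le pos (small _ sumC it itin); rewrite -/L; move: h1; lra.
  by lra.
apply: (@le_trans _ _ (\sum_(u in C) M u)); first exact: ler_sum.
rewrite /M -mulr_sumr -mulrA ler_wpM2l // big_split /= sumr_const -mulr_sumr.
have -> : \sum_(u in C) (u \in bads)%:R = #|bads|%:R :> R.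
  rewrite -natr_sum -sum1_card; congr (_%:R).
  rewrite [LHS]big_mkcond [RHS]big_mkcond; apply: eq_bigr => u _.
  by rewrite inE; case: (u \in C) => //=; case: (all _ _).
rewrite -[_ *+ #|C|]mulr_natr; move: bad; rewrite -(ler_nat R) natrM.
move: c0 b0; move: #|C|%:R #|bads|%:R #|B|%:R => c k b c0 b0 h.
have h1 : 0 <= c * c * b by rewrite !mulr_ge0.
have h2 : 0 <= c * (c - 2 * k) by rewrite mulr_ge0 // subr_ge0.
by lra.
Qed.

End ExpectedCost.

(** * The constant of the final bound *)

Section TotalCost.
Variable R : realType.

(** With [t = ln n / ln 2], at least 1, one has [fuel + 3 <= 5 * t] and [Delta + 1 <= 2 * Delta], so
    the exploration has the factor 25 * 3 * 2 = 2 * 75; the initial probe contributes the 2 * 1. *)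
Definition cost_constant : R := 2 * (1 + 75 * (rate R * ln 2 + 8)) / ln 2 ^+ 3.

Lemma ln2_gt0 : 0 < ln 2 :> R.
Proof. by apply: ln_gt0; lra. Qed.

Lemma up_log_le n : (1 < n)%N -> ((up_log 2 n)%:R - 1) * ln 2 <= ln n%:R :> R.
Proof.
move=> n1; have /andP[lo _] := up_log_bounds (isT : (1 < 2)%N) n1.
have := ltnW lo; rewrite -(ler_nat R) natrX => h.
have : ln (2 ^+ (up_log 2 n).-1) <= ln n%:R :> R.
  by rewrite ler_ln ?posrE ?exprn_gt0 ?ltr0n // (ltn_trans _ n1).
rewrite lnXn // -[_ *+ _.-1]mulr_natl; apply: le_trans; rewrite ler_wpM2r ?(ltW ln2_gt0) //.
by case: (up_log 2 n) => [|k]; rewrite ?lerBlDr ?natr1 //= ?add0r ?ler01.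
Qed.

Lemma reconstruct_expected (V : finType) (e : rel V) Delta :
  symmetric e -> irreflexive e -> connected_graph e -> asteroid_free e ->
  max_degree_le e Delta ->
  expected_queries R (gdist e) (reconstruct V) <=
    cost_constant * (Delta%:R * #|V|%:R * ln (#|V|%:R : R) ^+ 3).
Proof.
move=> esym eirr econ af edeg; rewrite /reconstruct.
have l0 := ln2_gt0; have rate0 := rate_gt0 R.
case: leqP => [V1|V1] /=.
  case: #|V| V1 => [|[|//]] _; first by rewrite !(mulr0, mul0r).
  by rewrite ln1 expr0n /= !mulr0.
case: pickP => [r _|no]; last by move: V1; rewrite eq_card0.
(* Two vertices in a connected graph force an edge; this allows [Delta + 1] to be absorbed into
   [2 * Delta]. *)
have D0 : (0 < Delta)%N.
  have [z zr] : exists z, z != r.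
    case/card_gt1P: V1 => x [y [_ _ xy]]; case: (eqVneq x r) => [xr|]; last by exists x.
    by exists y; rewrite -xr eq_sym.
  have [w ezw _] := gdist_next eirr econ zr; apply: leq_trans (edeg z).
  by rewrite card_gt0; apply/set0Pn; exists w; rewrite inE.
rewrite expected_queries_run.
have s0 : sound e (fun _ _ => 0%N) by split=> // x y; right.
have := cost_probe esym eirr econ edeg [set: V]%SET [set r]%SET s0.
rewrite cards1 mul1n cardsT -(ler_nat R) natrM => c1.
have := explore_expected R esym eirr econ af edeg (up_logP #|V| (isT : (1 < 2)%N))
          r (initial_invariant esym eirr econ r V1).
rewrite big_seq1 => c2; apply: le_trans (lerD c1 c2) _.
have w1 : weight R ([set~ r], [set r], finset.set0)%SET <=
    #|V|%:R * (rate R * ln #|V|%:R + 8).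
  rewrite /weight /= cards0 addr0 cardsC1.
  have p : (0 < #|V|.-1)%N by case: #|V| V1 => // -[].
  have le : (#|V|.-1 <= #|V|)%N by exact: leq_pred.
  rewrite ler_pM // ?ler0n ?addr_ge0 ?rate_ln_ge0 ?ler_nat //.
  by rewrite lerD2r rate_ln_le.
apply: le_trans (lerD (lexx _) (ler_wpM2l (ler0n _ _) w1)) _.
have h := up_log_le V1.
have h2 : ln 2 <= ln #|V|%:R :> R by rewrite ler_ln ?posrE ?ler_nat ?ltr0n // ltnW.
rewrite /cost_constant /unit_price !natrM -addn3 natrD -addn1 [(Delta + 1)%:R]natrD.
have D1 : 1 <= Delta%:R :> R by rewrite ler1n.
have n0 : 0 <= #|V|%:R :> R by exact: ler0n.
have f0 : 0 <= (up_log 2 #|V|)%:R :> R by exact: ler0n.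
move: D1 n0 f0 h h2 l0 rate0 {c1 c2 w1}.
move: (Delta%:R) (up_log 2 _)%:R => D f; move: (ln #|V|%:R) => L.
move: #|V|%:R (ln 2) (rate R) => n l ra.
move=> D1 n0 f0 h h2 l0 ra0.
pose t := L / l; have LE : L = t * l by rewrite /t divfK // gt_eqF.
have t1 : 1 <= t by rewrite /t ler_pdivlMr // mul1r.
have ft : f + 3 <= 5 * t.
  have : (f - 1) <= t by rewrite /t ler_pdivlMr.
  by lra.
rewrite LE; clear h h2 LE; clearbody t.
have -> : 2 * (1 + 75 * (ra * l + 8)) / l ^+ 3 * (D * n * (t * l) ^+ 3) =
   2 * (1 + 75 * (ra * l + 8)) * (D * n * t ^+ 3).
  by field; rewrite gt_eqF.
have ral : 0 <= ra * l by rewrite mulr_ge0 // ltW.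
have f3 : (f + 3) * (f + 3) <= 25 * t ^+ 2.
  rewrite (_ : 25 * t ^+ 2 = (5 * t) * (5 * t)); last by ring.
  by rewrite ler_pM // addr_ge0.
have D2 : D + 1 <= 2 * D by lra.
have t0 : 0 <= t by lra.
have t31 : 1 <= t ^+ 3 by rewrite exprn_ege1.
have w : n * (ra * (t * l) + 8) <= n * (t * (ra * l + 8)).
  by rewrite ler_wpM2l //; lra.
have e1 : (f + 3) * (f + 3) * (3 * (D + 1)) * (n * (ra * (t * l) + 8)) <=
    25 * t ^+ 2 * (3 * (2 * D)) * (n * (t * (ra * l + 8))).
  apply: ler_pM => //.
  - by rewrite !mulr_ge0 ?addr_ge0 //; lra.
  - by rewrite mulr_ge0 // addr_ge0 // mulr_ge0 ?(ltW ra0) // mulr_ge0 // ltW.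
  - by apply: ler_pM => //; rewrite ?mulr_ge0 ?addr_ge0 //; lra.
have e2 : (D + 1) * n <= 2 * D * n * t ^+ 3.
  rewrite -[leLHS]mulr1; apply: ler_pM => //; first by rewrite mulr_ge0 //; lra.
  by rewrite ler_wpM2r.
apply: le_trans (lerD e2 e1) _.
by rewrite le_eqVlt; apply/orP; left; apply/eqP; ring.
Qed.

End TotalCost.

Local Open Scope classical_set_scope.
Local Open Scope ring_scope.

(** * Outerplanar drawings *)

Section PlaneTopology.
Variable R : realType.
Implicit Types (p q c x y : R * R) (s t : seq (R * R)) (A B O : set (R * R)).

Lemma ball_pairE p (r : R) q :
  ball p r q <-> `|p.1 - q.1| < r /\ `|p.2 - q.2| < r.
Proof. by rewrite /ball /= /prod_ball -!ball_normE. Qed.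

Lemma ball_on_seg p (r : R) x y c :
  ball p r x -> ball p r y -> on_seg x y c -> ball p r c.
Proof.
move=> /ball_pairE[h1 h2] /ball_pairE[k1 k2] [t /andP[t0 t1] ->].
apply/ball_pairE => /=; move: h1 h2 k1 k2.
rewrite !ltr_norml => /andP[h1 h2] /andP[h3 h4] /andP[k1 k2] /andP[k3 k4].
have conv (u v b : R) : u < b -> v < b -> (1 - t) * u + t * v < b.
  move=> hu hv; have [->|tn0] := eqVneq t 0; first by lra.
  have tp : 0 < t by rewrite lt_neqAle eq_sym tn0.
  have e1 : t * v < t * b by rewrite ltr_pM2l.
  have e2 : (1 - t) * u <= (1 - t) * b by rewrite ler_wpM2l //; lra.
  by lra.
have := conv (- (p.1 - x.1)) (- (p.1 - y.1)) r; have := conv (p.1 - x.1) (p.1 - y.1) r.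
have := conv (- (p.2 - x.2)) (- (p.2 - y.2)) r; have := conv (p.2 - x.2) (p.2 - y.2) r.
move=> C1 C2 C3 C4.
have {}C1 := C1 ltac:(lra) ltac:(lra).
have {}C2 := C2 ltac:(lra) ltac:(lra).
have {}C3 := C3 ltac:(lra) ltac:(lra).
have {}C4 := C4 ltac:(lra) ltac:(lra).
by split; apply/andP; split; lra.
Qed.

(** Half the radius that works at a point works at all nearby points; compactness makes the radius
    uniform. *)
Lemma compact_closed_separated A B : compact A -> closed B ->
  (forall p, A p -> B p -> False) ->
  exists2 r : R, 0 < r & forall a b, A a -> B b -> ball a r b -> False.
Proof.
move=> /compact_near_coveringP cA cB dis.
have key : \forall r \near 0^'+, A `<=` (fun a => forall b, B b -> ball a (r : R) b -> False).
  apply: (cA R 0^'+ (fun r a => forall b, B b -> ball a r b -> False)) => a Aa.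
  have oB : open (~` B) by rewrite openC.
  have /nbhs_ballP[r /= r0 hr] : nbhs a (~` B).
    by apply: open_nbhs_nbhs; split => // Ba; exact: dis Aa Ba.
  exists (ball a (r / 2), [set e | e < r / 2]); first split => /=.
  - by apply: nbhsx_ballx; lra.
  - by apply: nbhs_right_lt; lra.
  move=> [a' e] /= [ha he] b Bb hb; apply: (hr b) => //.
  have -> : r = r / 2 + r / 2 by lra.
  by apply: ball_triangle ha _; apply: le_ball hb; exact: ltW.
have H := filterI key (nbhs_right_gt (0 : R)).
have [r [hr r0]] := @filter_ex _ _ (at_right_proper_filter (0 : R)) _ (H _).
by exists r => // a b Aa Bb; apply: hr.
Qed.

Lemma arc_modulus (g : R -> R * R) (r : R) :
  {within `[0, 1], continuous g} -> 0 < r ->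
  exists2 d : R, 0 < d & forall a b : R, 0 <= a <= 1 -> 0 <= b <= 1 ->
    `|a - b| < d -> ball (g a) r (g b).
Proof.
move=> /subspace_continuousP cg r0.
have /compact_near_coveringP cA := @segment_compact R 0 1.
have key : \forall d \near 0^'+, `[0, 1] `<=` (fun a => forall b, 0 <= b <= 1 ->
    `|a - b| < (d : R) -> 0 <= a <= 1 -> ball (g a) r (g b)).
  apply: (cA R 0^'+ (fun d a => forall b, 0 <= b <= 1 ->
    `|a - b| < (d : R) -> 0 <= a <= 1 -> ball (g a) r (g b))) => a Aa.
  have r2 : 0 < r / 2 by lra.
  have /cvg_ballP/(_ _ r2) := cg a Aa.
  rewrite /prop_near1 /within /= => /nbhs_ballP[d /= d0 hd].
  exists (ball a (d / 2), [set e | e < d / 2]); first split => /=.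
  - by apply: nbhsx_ballx; lra.
  - by apply: nbhs_right_lt; lra.
  move=> [a' e] /= [ha he] b Bb hb Aa'.
  have -> : r = r / 2 + r / 2 by lra.
  have ba' : ball a d a' by apply: le_ball ha; lra.
  have bb : ball a d b.
    have -> : d = d / 2 + d / 2 by lra.
    apply: ball_triangle ha _; rewrite -ball_normE /ball_ /=.
    by apply: lt_trans hb _.
  have h1 := hd a' ba'; have h2 := hd b bb.
  apply: ball_triangle (ball_sym _) _; [apply: h1|apply: h2];
    by rewrite /= in_itv.
have H := filterI key (nbhs_right_gt (0 : R)).
have [d [hd d0]] := @filter_ex _ _ (at_right_proper_filter (0 : R)) _ (H _).
exists d => // a b Aa Ab hab; apply: hd => //.
Qed.

(** Chords between equally spaced parameters, as fine as uniform continuity requires. Their ends lie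
    on the arc, which bounds the height of the chain. *)
Lemma arc_polygon (g : R -> R * R) (r : R) :
  {within `[0, 1], continuous g} -> 0 < r ->
  exists s, [/\ last (g 0) s = g 1,
    {in s, forall z, (g @` `[0, 1]) z} &
    forall c, on_poly (g 0) s c -> exists2 p, (g @` `[0, 1]) p & ball p r c].
Proof.
move=> cg r0; have [d d0 hd] := arc_modulus cg r0.
pose N := (Num.truncn d^-1).+1.
have hN : N%:R^-1 < d.
  rewrite -[ltRHS]invrK ltf_pV2 ?posrE ?invr_gt0 ?ltr0n //.
  by have := @truncnS_gt R d^-1.
have N0 : 0 < N%:R :> R by rewrite ltr0n.
pose u (k : nat) : R := k%:R / N%:R; pose h k := g (u k).
have in01 k : (k <= N)%N -> 0 <= u k <= 1.
  move=> kN; apply/andP; split; first by rewrite divr_ge0 ?ler0n.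
  by rewrite ler_pdivrMr // mul1r ler_nat.
have him k : (k <= N)%N -> (g @` `[0, 1]) (h k).
  by move=> /in01 hk; exists (u k) => //; rewrite /= in_itv.
have hlast k m : last (h m) [seq h j | j <- iota m.+1 k] = h (m + k)%N.
  elim: k m => [|k IH] m /=; first by rewrite addn0.
  by rewrite IH addSnnS.
have g0 : g 0 = h 0%N by rewrite /h /u mul0r.
exists [seq h j | j <- iota 1 N]; split.
- by rewrite g0 hlast add0n /h /u divff // lt0r_neq0.
- move=> z /mapP[j]; rewrite mem_iota add1n ltnS => /andP[_ jN] ->.
  exact: him.
- rewrite g0 => c.
  suff H k m : (m + k <= N)%N -> on_poly (h m) [seq h j | j <- iota m.+1 k] c ->
      exists2 p, (g @` `[0, 1]) p & ball p r c by apply: H.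
  elim: k m => [|k IH] m //= mk [hc|]; last first.
    by apply: IH; rewrite addSnnS.
  have mN : (m <= N)%N by apply: leq_trans mk; rewrite leq_addr.
  have mN' : (m.+1 <= N)%N by apply: leq_trans mk; rewrite addnS ltnS leq_addr.
  exists (h m); first exact: him.
  apply: ball_on_seg hc; first exact: ballxx.
  apply: hd; [exact: in01|exact: in01|].
  rewrite /u -mulrBl -addn1 natrD opprD addNKr mulN1r normrN ger0_norm ?invr_ge0 ?ler0n //.
Qed.

(** Balls are convex, so the points of [O] reached by chains from [z] and the points not reached
    both form open sets. *)
Lemma poly_connected O z y :
  open O -> connected_component O z y ->
  exists s, last z s = y /\ forall c, on_poly z s c -> O c.
Proof.
move=> oO Cy.
pose reach y := exists s, last z s = y /\ forall c, on_poly z s c -> O c.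
have Oz : O z.
  have [//|nOz] := pselect (O z).
  by move: Cy; rewrite connected_component_out.
have sub := @connected_component_sub _ O z.
have step a (d : R) b : ball a d `<=` O -> ball a d a -> ball a d b ->
    (reach a -> reach b) /\ (reach b -> reach a).
  move=> hB ha hb; split=> -[s [hs hO]].
    exists (rcons s b); rewrite last_rcons; split=> // c.
    rewrite -cats1 => /on_poly_cat[/hO//|]; rewrite hs /= => -[hc|//].
    by apply: hB; apply: ball_on_seg hc.
  exists (rcons s a); rewrite last_rcons; split=> // c.
  rewrite -cats1 => /on_poly_cat[/hO//|]; rewrite hs /= => -[hc|//].
  by apply: hB; apply: ball_on_seg hc.
have nb a : O a -> exists2 d : R, 0 < d & ball a d `<=` O.
  by move=> Oa; have /nbhs_ballP[d /= d0 hd] := open_nbhs_nbhs (conj oO Oa); exists d.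
pose U := [set a | O a /\ reach a]; pose W := [set a | O a /\ ~ reach a].
have openU : open U.
  rewrite openE => a [Oa ra]; have [d d0 hd] := nb a Oa.
  apply/nbhs_ballP; exists d => //= b hb; split; first exact: hd.
  by have [h _] := step a d b hd (ballxx _ d0) hb; exact: h.
have openW : open W.
  rewrite openE => a [Oa ra]; have [d d0 hd] := nb a Oa.
  apply/nbhs_ballP; exists d => //= b hb; split; first exact: hd.
  by have [_ h] := step a d b hd (ballxx _ d0) hb; move/h.
have e1 : [set a | connected_component O z a /\ reach a] =
    connected_component O z `&` U.
  apply/seteqP; split=> a [h1 h2]; split=> //; last by case: h2.
  by split => //; exact: sub.
have e2 : [set a | connected_component O z a /\ reach a] =
    connected_component O z `&` (~` W).
  apply/seteqP; split=> a [h1 h2]; split=> //; first by case.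
  by apply: contrapT => h; apply: h2; split=> //; exact: sub.
have : [set a | connected_component O z a /\ reach a] = connected_component O z.
  apply: (@component_connected _ O z).
  - by exists z; split; [exact: connected_component_refl | exists [::]].
  - by exists U.
  - by exists (~` W) => //; rewrite closedC.
move=> E; have [] : [set a | connected_component O z a /\ reach a] y by rewrite E.
by [].
Qed.

End PlaneTopology.

(** * Compactness of drawings *)

Section DrawingTopology.
Variable R : realType.
Implicit Types (p q c x y : R * R) (s t : seq (R * R)) (A B O : set (R * R)).

Lemma compact_on_seg p q : compact [set c | on_seg p q c].
Proof.
pose h (t : R) : R * R := ((1 - t) * p.1 + t * q.1, (1 - t) * p.2 + t * q.2).
have -> : [set c | on_seg p q c] = h @` `[0, 1].
  apply/seteqP; split=> c /=.
    by case=> t t01 ->; exists t => //; rewrite /= in_itv.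
  by case=> t; rewrite in_itv /= => t01 <-; exists t.
apply: continuous_compact; last exact: segment_compact.
apply: continuous_subspaceT => t.
have -> : h = (fun t : R => t *: (q - p) + p).
  by apply/funext => x; rewrite /h; case: p q {h} => [p1 p2] [q1 q2];
    congr (_, _); rewrite /= /GRing.scale /=; ring.
apply: cvgD; last exact: cvg_cst.
exact: scalel_continuous.
Qed.

Lemma compact_on_poly p s : compact [set c | on_poly p s c].
Proof.
elim: s p => [|q s IH] p.
  have -> : [set c | on_poly p [::] c] = set0 by apply/seteqP; split.
  exact: compact0.
have -> : [set c | on_poly p (q :: s) c] =
    [set c | on_seg p q c] `|` [set c | on_poly q s c] by [].
by apply: compactU; [exact: compact_on_seg | exact: IH].
Qed.

Lemma compact_bigcup_fin (I : finType) (A : I -> set (R * R)) :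
  (forall i, compact (A i)) -> compact (\bigcup_i A i).
Proof.
move=> cA.
have -> : \bigcup_i A i = \big[setU/set0]_(i <- enum I) A i.
  rewrite -bigcup_seq; apply/seteqP; split=> c [i _ hc]; exists i => //=.
  by rewrite mem_enum.
by apply: bigsetU_compact.
Qed.

Lemma uniform_radius (I : finType) (P : I -> R -> Prop) :
  (forall i (r r' : R), r' <= r -> P i r -> P i r') ->
  (forall i, exists2 r : R, 0 < r & P i r) ->
  exists2 r : R, 0 < r & forall i, P i r.
Proof.
move=> mono ex.
suff [r r0 hr] : exists2 r : R, 0 < r & {in enum I, forall i, P i r}.
  by exists r => // i; apply: hr; rewrite mem_enum.
elim: (enum I) => [|i s [r r0 hr]]; first by exists 1.
have [r' r0' hr'] := ex i; exists (Num.min r r'); first by rewrite lt_min r0.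
move=> j; rewrite inE => /orP[/eqP->|/hr h].
  by apply: mono hr'; rewrite ge_min lexx orbT.
by apply: mono h; rewrite ge_min lexx.
Qed.

Lemma height_bound s : exists H : R, {in s, forall z, z.2 <= H}.
Proof.
elim: s => [|z s [H hH]]; first by exists 0.
exists (Num.max z.2 H) => z'; rewrite inE => /orP[/eqP->|/hH h].
  by rewrite le_max lexx.
by rewrite le_max h orbT.
Qed.

Section Walks.
Variables (V : finType) (e : rel V) (f : V -> R * R) (G : V -> V -> seq (R * R)).

Fixpoint walk_poly (x : V) (s : seq V) : seq (R * R) :=
  if s is y :: s' then G x y ++ walk_poly y s' else [::].

Hypothesis Gend : forall x y : V, e x y -> last (f x) (G x y) = f y.

Lemma last_walk_poly (x : V) (s : seq V) :
  path e x s -> last (f x) (walk_poly x s) = f (last x s).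
Proof. by elim: s x => //= y s IH x /andP[/Gend h /IH <-]; rewrite last_cat h. Qed.

Lemma on_walk_poly (x : V) (s : seq V) c : path e x s -> on_poly (f x) (walk_poly x s) c ->
  exists a b : V, [/\ e a b, a \in x :: s, b \in x :: s & on_poly (f a) (G a b) c].
Proof.
elim: s x => //= y s IH x /andP[exy pys] /on_poly_cat[h|].
  by exists x, y; rewrite !inE !eqxx orbT.
rewrite Gend // => /(IH _ pys)[a [b [eab ha hb hc]]].
by exists a, b; rewrite (in_cons x) ha (in_cons x) hb !orbT.
Qed.

Lemma mem_walk_poly (x : V) (s : seq V) z : path e x s -> z \in walk_poly x s ->
  exists a b : V, e a b /\ z \in G a b.
Proof.
elim: s x => //= y s IH x /andP[exy pys]; rewrite mem_cat => /orP[h|/(IH _ pys)//].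
by exists x, y.
Qed.

End Walks.

Section Drawing.
Variables (V : finType) (e : rel V) (f : V -> R * R) (g : V -> V -> R -> R * R).
Hypothesis pd : plane_drawing e f g.
Notation arc u v := (g u v @` `[0, 1]).
Notation D := (drawing_support e f g).

Lemma arc_compact u v : e u v -> compact (arc u v).
Proof.
move=> euv; apply: continuous_compact; last exact: segment_compact.
exact: drawing_arc_continuous pd _ _ euv.
Qed.

Lemma support_compact : compact D.
Proof.
apply: compactU.
  have -> : range f = \bigcup_v [set f v].
    by apply/seteqP; split=> c [v _ h]; exists v.
  by apply: compact_bigcup_fin => v; exact: compact_set1.
have -> : [set p | exists u v, e u v /\ arc u v p] =
    \bigcup_(uv : V * V) (if e uv.1 uv.2 then arc uv.1 uv.2 else set0).
  apply/seteqP; split=> c.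
    by move=> [u [v [euv h]]]; exists (u, v) => //=; rewrite euv.
  by move=> [[u v] _ /=]; case: ifP => // euv h; exists u, v.
apply: compact_bigcup_fin => -[u v] /=; case: ifP => euv.
  exact: arc_compact.
exact: compact0.
Qed.

Lemma arc_in_support u v : e u v -> arc u v `<=` D.
Proof. by move=> euv p hp; right; exists u, v. Qed.

Lemma arcP u v p : e u v -> arc u v p ->
  [\/ p = f u, p = f v | (g u v @` `]0, 1[) p].
Proof.
move=> euv [t /=]; rewrite in_itv /= => /andP[t0 t1] <-.
have [->|tn0] := eqVneq t 0.
  by apply: Or31; rewrite (drawing_arc_start pd).
have [->|tn1] := eqVneq t 1.
  by apply: Or32; rewrite (drawing_arc_end pd).
apply: Or33; exists t => //=; rewrite in_itv /=.
by rewrite !lt_neqAle t0 t1 eq_sym tn0 tn1.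
Qed.

Lemma arc_avoids u v w : e u v -> w != u -> w != v -> ~ arc u v (f w).
Proof.
move=> euv /eqP wu /eqP wv /(arcP euv)[h|h|].
- by apply: wu; exact: (drawing_vertex_inj pd).
- by apply: wv; exact: (drawing_vertex_inj pd).
- exact: (drawing_arc_vertex pd).
Qed.

Lemma arc_disjoint (u v x y : V) p : e u v -> e x y ->
  x != u -> x != v -> y != u -> y != v -> arc u v p -> arc x y p -> False.
Proof.
move=> euv exy xu xv yu yv h1 h2.
case/(arcP exy): (h2) => hp.
- by move: h1; rewrite hp; exact: arc_avoids.
- by move: h1; rewrite hp; exact: arc_avoids.
case/(arcP euv): (h1) => hp'.
- by move: h2; rewrite hp'; apply: arc_avoids; rewrite // eq_sym.
- by move: h2; rewrite hp'; apply: arc_avoids; rewrite // eq_sym.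
have [h|h] := pselect ([set u; v]%SET = [set x; y]%SET); last first.
  have E := drawing_arc_disjoint pd euv exy h.
  by have : set0 p by rewrite -E.
have : x \in [set u; v]%SET by rewrite h !inE eqxx.
by rewrite !inE (negbTE xu) (negbTE xv).
Qed.

Lemma support_box : exists2 M : R, 0 < M &
  forall p, D p -> `|p.1| < M /\ `|p.2| < M.
Proof.
have [M [Mr hM]] := compact_bounded support_compact.
exists (Num.max M 0 + 2); first by rewrite ltr_wpDl // le_max lexx orbT.
move=> p Dp.
have h : `|p| <= Num.max M 0 + 1.
  by apply: hM Dp; rewrite (@le_lt_trans _ _ (Num.max M 0)) ?le_max ?lexx //; lra.
have : ball (0 : R * R) (Num.max M 0 + 2) p.
  by rewrite ball_prod_normE /ball_ /= sub0r normrN; lra.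
by move=> /ball_pairE /=; rewrite !sub0r !normrN.
Qed.

End Drawing.
End DrawingTopology.

Section NoAsteroid.
Variables (R : realType) (V : finType) (e : rel V).
Variables (f : V -> R * R) (g : V -> V -> R -> R * R).
Hypothesis pd : plane_drawing e f g.
Notation arc u v := (g u v @` `[0, 1]).
Notation D := (drawing_support e f g).
Implicit Types (p q c : R * R).

(** Finitely many pairs of disjoint compact sets; chains within half this radius of their arcs
    inherit the disjointness. *)
Lemma separation_radius : exists2 r : R, 0 < r &
  (forall u v w p, e u v -> w != u -> w != v -> arc u v p -> ~ ball p r (f w)) /\
  (forall u v x y p q, e u v -> e x y ->
     x != u -> x != v -> y != u -> y != v -> arc u v p -> arc x y q -> ~ ball p r q).
Proof.
pose P1 (i : V * V * V) (r : R) := forall p, e i.1.1 i.1.2 -> i.2 != i.1.1 ->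
  i.2 != i.1.2 -> arc i.1.1 i.1.2 p -> ~ ball p r (f i.2).
pose P2 (i : V * V * (V * V)) (r : R) := forall p q, e i.1.1 i.1.2 ->
  e i.2.1 i.2.2 -> i.2.1 != i.1.1 -> i.2.1 != i.1.2 -> i.2.2 != i.1.1 ->
  i.2.2 != i.1.2 -> arc i.1.1 i.1.2 p -> arc i.2.1 i.2.2 q -> ~ ball p r q.
have [||r1 r10 h1] := @uniform_radius R _ P1.
- by move=> i r r' le h p e1 e2 e3 e4 hb; apply: (h p e1 e2 e3 e4); apply: le_ball hb.
- move=> [[u v] w]; rewrite /P1 /=.
  have [euv|] := boolP (e u v); last by move=> _; exists 1.
  have [wu|wu] := eqVneq w u; first by exists 1.
  have [wv|wv] := eqVneq w v; first by exists 1.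
  have [|||r r0 hr] := @compact_closed_separated R (arc u v) [set f w].
  + exact: arc_compact pd _ _ euv.
  + by apply: compact_closed; [exact: norm_hausdorff | exact: compact_set1].
  + by move=> p hp /= ep; move: hp; rewrite ep; apply: (arc_avoids pd).
  + by exists r => // p _ _ _ hp hb; apply: (hr p (f w)).
have [||r2 r20 h2] := @uniform_radius R _ P2.
- move=> i r r' le h p q e1 e2 e3 e4 e5 e6 e7 e8 hb.
  by apply: (h p q e1 e2 e3 e4 e5 e6 e7 e8); apply: le_ball hb.
- move=> [[u v] [x y]]; rewrite /P2 /=.
  have [euv|] := boolP (e u v); last by move=> _; exists 1.
  have [exy|] := boolP (e x y); last by move=> _; exists 1.
  have [->|xu] := eqVneq x u; first by exists 1.
  have [->|xv] := eqVneq x v; first by exists 1.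
  have [->|yu] := eqVneq y u; first by exists 1.
  have [->|yv] := eqVneq y v; first by exists 1.
  have [|||r r0 hr] := @compact_closed_separated R (arc u v) (arc x y).
  + exact: arc_compact pd _ _ euv.
  + by apply: compact_closed; [exact: norm_hausdorff | exact: arc_compact pd _ _ exy].
  + by move=> p; apply: (arc_disjoint pd euv exy).
  + by exists r => // p q _ _ _ _ _ _ hp hq hb; apply: (hr p q).
exists (Num.min r1 r2); first by rewrite lt_min r10.
split=> [u v w p euv wu wv hp hb|u v x y p q euv exy xu xv yu yv hp hq hb].
  by apply: (h1 (u, v, w) p) => //; apply: le_ball hb; rewrite ge_min lexx.
by apply: (h2 (u, v, (x, y)) p q) => //; apply: le_ball hb; rewrite ge_min lexx orbT.
Qed.

(** The drawing lies in a square of half-side [M]. The chain goes round it: to the right first when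
    it starts below, then up beside the square, then along its top. *)
Lemma escape_far (M : R) q : (forall p, D p -> `|p.1| < M /\ `|p.2| < M) -> 0 < M ->
  M < `|q.1| \/ M < `|q.2| ->
  exists s, last q s = (0, M + 1) /\ forall c, on_poly q s c -> ~ D c.
Proof.
move=> hM M0 hq.
have up c : M < c.2 -> ~ D c by move=> h /hM[_]; rewrite ltr_norml; lra.
have down c : c.2 < - M -> ~ D c by move=> h /hM[_]; rewrite ltr_norml; lra.
have right c : M < c.1 -> ~ D c by move=> h /hM[+ _]; rewrite ltr_norml; lra.
have left c : c.1 < - M -> ~ D c by move=> h /hM[+ _]; rewrite ltr_norml; lra.
have conv (u v t b : R) : 0 <= t <= 1 -> b < u -> b < v -> b < (1 - t) * u + t * v.
  move=> /andP[t0 t1] hu hv; have [->|tn0] := eqVneq t 0; first by lra.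
  have tp : 0 < t by rewrite lt_neqAle eq_sym tn0.
  have e1 : t * b < t * v by rewrite ltr_pM2l.
  have e2 : (1 - t) * b <= (1 - t) * u by rewrite ler_wpM2l //; lra.
  by lra.
have conv' (u v t b : R) : 0 <= t <= 1 -> u < b -> v < b -> (1 - t) * u + t * v < b.
  by move=> ht hu hv; have := @conv (- u) (- v) t (- b) ht; lra.
have segup x y c : M < x.2 -> M < y.2 -> on_seg x y c -> ~ D c.
  by move=> hx hy [t ht ->]; apply: up => /=; apply: conv.
have segright x y c : M < x.1 -> M < y.1 -> on_seg x y c -> ~ D c.
  by move=> hx hy [t ht ->]; apply: right => /=; apply: conv.
have segleft x y c : x.1 < - M -> y.1 < - M -> on_seg x y c -> ~ D c.
  by move=> hx hy [t ht ->]; apply: left => /=; apply: conv'.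
have segdown x y c : x.2 < - M -> y.2 < - M -> on_seg x y c -> ~ D c.
  by move=> hx hy [t ht ->]; apply: down => /=; apply: conv'.
have M1 : M < M + 1 by lra.
have side x : M < `|x.1| -> exists s, last x s = (0, M + 1) /\
    forall c, on_poly x s c -> ~ D c.
  move=> hx; exists [:: (x.1, M + 1); (0, M + 1)]; split=> // c /= [h|[h|//]].
    move: hx; rewrite lter_normr => /orP[hx|hx].
      by apply: segright h.
    by apply: segleft h => /=; lra.
  by apply: segup h.
case: hq => [/side//|]; rewrite lter_normr => /orP[hq|hq].
  by exists [:: (0, M + 1)]; split=> // c /= [h|//]; apply: segup h.
have [|s [hs1 hs2]] := side (M + 1, q.2); first by rewrite lter_normr /= M1.
exists ((M + 1, q.2) :: s); split=> // c /= [h|/hs2//].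
by apply: segdown h => /=; lra.
Qed.

(** The vertex belongs to the drawing, so the chain starts from a point of [F] close to it; as [F]
    is unbounded, it contains a point from which [escape_far] applies. *)
Lemma escape_path F (M r : R) v : 0 < M ->
  (forall p, D p -> `|p.1| < M /\ `|p.2| < M) ->
  face D F -> ~ bounded_set F -> closure F (f v) -> 0 < r ->
  exists zs : R * R * seq (R * R), [/\ ball (f v) r zs.1, last zs.1 zs.2 = (0, M + 1) &
     forall c, on_poly zs.1 zs.2 c -> ~ D c].
Proof.
move=> M0 hM [p0 Dp0 FE] unb clv r0.
have oD : open (~` D).
  rewrite openC; apply: compact_closed; first exact: norm_hausdorff.
  exact: support_compact pd.
have [z [Fz hz]] : exists z, F z /\ ball (f v) r z.
  have [z [hz1 hz2]] := clv (ball (f v) r) (nbhsx_ballx _ _ r0).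
  by exists z.
have [q [Fq hq]] : exists q, F q /\ (M < `|q.1| \/ M < `|q.2|).
  apply: contrapT => h; apply: unb; exists M; split; first exact: num_real.
  move=> M' hM' q Fq /=.
  have [h1 h2] : `|q.1| <= M /\ `|q.2| <= M.
    by split; rewrite leNgt; apply/negP => h1; apply: h; exists q; split=> //; [left|right].
  have : ball (0 : R * R) M' q.
    by apply/ball_pairE; rewrite /= !sub0r !normrN; lra.
  by rewrite ball_prod_normE /ball_ /= sub0r normrN; exact: ltW.
have Czq : connected_component (~` D) z q.
  apply: (@connected_component_trans _ _ p0).
    by apply: connected_component_sym; rewrite -FE.
  by rewrite -FE.
have [s1 [e1 hs1]] := poly_connected oD Czq.
have [s2 [e2 hs2]] := escape_far hM M0 hq.
exists (z, s1 ++ s2); split=> //=; first by rewrite last_cat e1.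
by move=> c /on_poly_cat[/hs1//|]; rewrite e1 => /hs2.
Qed.


(** Disjointness is required only between objects at a positive distance, which survives the passage
    to polygons; the prolongations may cross one another. *)
Lemma walks_no_asteroid F (r u v w : V) (pu pv pw quv quw qvw : seq V) :
  face D F -> ~ bounded_set F -> (forall x, closure F (f x)) ->
  path e r pu -> path e r pv -> path e r pw ->
  path e u quv -> path e u quw -> path e v qvw ->
  last r pu = u -> last r pv = v -> last r pw = w ->
  last u quv = v -> last u quw = w -> last v qvw = w ->
  {in u :: quv, forall x, x \notin r :: pw} ->
  {in u :: quw, forall x, x \notin r :: pv} ->
  {in v :: qvw, forall x, x \notin r :: pu} -> False.
Proof.
move=> fF uF cF ppu ppv ppw pquv pquw pqvw lu lv lw luv luw lvw duv duw dvw.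
have [M M0 hM] := support_box pd.
have [e1 e10 [sep1 sep2]] := separation_radius.
(* Half for the polygonal approximation of an arc and half for the first segment of a prolongation
   or for a second arc. *)
pose e2 := e1 / 2; have e20 : 0 < e2 by rewrite /e2; lra.
have /choice[zs hzs] := fun x => escape_path M0 hM fF uF (cF x) e20.
pose z x := (zs x).1; pose s x := (zs x).2.
have [H0 hH0] := height_bound (flatten [seq z x :: s x | x <- enum V]).
have hs x y : y \in z x :: s x -> y.2 <= H0.
  move=> h; apply: hH0; apply/flattenP; exists (z x :: s x) => //.
  by apply/mapP; exists x; rewrite ?mem_enum.
pose H := Num.max H0 M + 2.
have [HH0 HM] : H0 < H /\ M + 1 < H.
  have h1 : H0 <= Num.max H0 M by rewrite le_max lexx.
  have h2 : M <= Num.max H0 M by rewrite le_max lexx orbT.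
  by rewrite /H; lra.
(* All escapes end at [(0, M + 1)]; four points at height [H] provide the distinct ends that the
   parity argument compares. *)
pose tp (k : 'I_4) : R * R := (k%:R, H).
pose a x k := z x :: s x ++ [:: tp k].
have far x k c : on_poly (z x) (s x ++ [:: tp k]) c -> ~ D c.
  have [_ h2 h3] := hzs x.
  move=> /on_poly_cat[/h3//|]; rewrite [last _ _]h2 /= => -[[t /andP[t0 t1] ->]|//].
  move=> /hM[_] /=; rewrite ltr_norml => /andP[_ hlt].
  have : 0 <= t * (H - (M + 1)) by rewrite mulr_ge0 //; lra.
  by move: hlt; lra.
(* Past its first segment a prolongation avoids the compact drawing, hence stays at a positive
   distance from it. *)
have [e3 e30 he3] : exists2 r : R, 0 < r & forall (xk : V * 'I_4) c p,
    on_poly (z xk.1) (s xk.1 ++ [:: tp xk.2]) c -> D p -> ~ ball c r p.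
  apply: (@uniform_radius R _ (fun (xk : V * 'I_4) r => forall c p,
    on_poly (z xk.1) (s xk.1 ++ [:: tp xk.2]) c -> D p -> ~ ball c r p)).
    by move=> xk r1 r2 le h c p h1 h2 hb; apply: (h c p h1 h2); apply: le_ball hb.
  move=> [x k] /=.
  have [|||r1 r10 hr] := @compact_closed_separated R
      [set c | on_poly (z x) (s x ++ [:: tp k]) c] D.
  - exact: compact_on_poly.
  - by apply: compact_closed; [exact: norm_hausdorff | exact: support_compact pd].
  - by move=> c /= /far.
  - by exists r1 => // c p h1 h2 hb; apply: (hr c p).
pose eta := Num.min e2 e3.
have eta0 : 0 < eta by rewrite lt_min e20.
have [G hG] : exists G : V -> V -> seq (R * R), forall x y, e x y ->
    [/\ last (f x) (G x y) = f y, {in G x y, forall p, arc x y p} &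
      forall c, on_poly (f x) (G x y) c -> exists2 p, arc x y p & ball p eta c].
  have /choice[G hG] : forall xy : V * V, exists l, e xy.1 xy.2 ->
      [/\ last (f xy.1) l = f xy.2, {in l, forall p, arc xy.1 xy.2 p} &
      forall c, on_poly (f xy.1) l c ->
        exists2 p, arc xy.1 xy.2 p & ball p eta c].
    move=> [x y] /=; have [exy|_] := boolP (e x y); last by exists [::].
    have [l] := arc_polygon (drawing_arc_continuous pd exy) eta0.
    by rewrite (drawing_arc_start pd exy) (drawing_arc_end pd exy) => hl; exists l.
  by exists (fun x y => G (x, y)) => x y exy; exact: hG (x, y) exy.
have Gend x y : e x y -> last (f x) (G x y) = f y by move=> /hG[].
have near1 x y p c : ball (f x) e2 c -> ball p eta c -> arc y x p -> ball p e1 (f x).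
  move=> h1 h2 _; have -> : e1 = e2 + e2 by rewrite /e2; lra.
  apply: ball_triangle (ball_sym h1); apply: le_ball h2.
  by rewrite ge_min lexx.
(* A common point on the first segment would bring the arc within [e1] of a vertex that is not one
   of its ends; on the rest, within [e3] of the prolongation. *)
have E1 x y w' k c : e x y -> w' != x -> w' != y -> on_poly (f x) (G x y) c ->
    on_poly (f w') (a w' k) c -> False.
  move=> exy wx wy hc; have [_ _ /(_ c hc)[p hp hb]] := hG _ _ exy.
  case=> [hc'|hc'].
    apply: (sep1 x y w' p exy wx wy hp).
    have -> : e1 = e2 + e2 by rewrite /e2; lra.
    apply: (@ball_triangle _ _ c); first by apply: le_ball hb; rewrite ge_min lexx.
    apply: ball_sym; apply: ball_on_seg hc'; first exact: ballxx.
    by have [] := hzs w'.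
  apply: (he3 (w', k) c p hc'); first exact: (@arc_in_support R V e f g x y exy p hp).
  by apply: ball_sym; apply: le_ball hb; rewrite ge_min lexx orbT.
have E2 x y x' y' c : e x y -> e x' y' -> x' != x -> x' != y -> y' != x -> y' != y ->
    on_poly (f x) (G x y) c -> on_poly (f x') (G x' y') c -> False.
  move=> exy exy' h1 h2 h3 h4 hc hc'.
  have [_ _ /(_ c hc)[p hp hb]] := hG _ _ exy.
  have [_ _ /(_ c hc')[q hq hb']] := hG _ _ exy'.
  apply: (sep2 x y x' y' p q) => //.
  have -> : e1 = e2 + e2 by rewrite /e2; lra.
  apply: (@ball_triangle _ _ c); first by apply: le_ball hb; rewrite ge_min lexx.
  by apply: ball_sym; apply: le_ball hb'; rewrite ge_min lexx.
have W1 x l w' k : path e x l -> w' \notin x :: l ->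
    poly_disjoint (f x) (walk_poly G x l) (f w') (a w' k).
  move=> pl wl c /(on_walk_poly Gend pl)[b [b' [ebb hb hb' hc]]].
  apply: E1 hc => //.
  - by apply: contraNneq wl => ->.
  - by apply: contraNneq wl => ->.
have W1' x l w' k : path e x l -> w' \notin x :: l ->
    poly_disjoint (f w') (a w' k) (f x) (walk_poly G x l).
  by move=> pl wl c h1 h2; apply: (W1 _ _ _ k pl wl c).
have W2 x l x' l' : path e x l -> path e x' l' ->
    {in x :: l, forall y, y \notin x' :: l'} ->
    poly_disjoint (f x) (walk_poly G x l) (f x') (walk_poly G x' l').
  move=> pl pl' dl c /(on_walk_poly Gend pl)[b [b' [ebb hb hb' hc]]].
  move=> /(on_walk_poly Gend pl')[d [d' [edd hd hd' hc']]].
  apply: (E2 b b' d d' c ebb edd _ _ _ _ hc hc').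
  - by apply: contraTneq hd => ->; apply: dl.
  - by apply: contraTneq hd => ->; apply: dl.
  - by apply: contraTneq hd' => ->; apply: dl.
  - by apply: contraTneq hd' => ->; apply: dl.
have low x l y : path e x l -> y \in walk_poly G x l -> y.2 <= H.
  move=> pl /(mem_walk_poly pl)[b [b' [ebb hy]]].
  have [_ /(_ _ hy) hy' _] := hG _ _ ebb.
  have [_] := hM _ (@arc_in_support R V e f g b b' ebb y hy').
  by rewrite ltr_norml => /andP[_ ?]; lra.
have lowf x : (f x).2 < H.
  have [_] := hM (f x) (or_introl (ex_intro2 _ _ x I erefl)).
  by rewrite ltr_norml => /andP[_ ?]; lra.
have lowa x k y : y \in a x k -> y.2 <= H.
  rewrite /a -cat_cons mem_cat => /orP[/hs h|]; first by lra.
  by rewrite inE => /eqP->.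
have lasta x k : last (f x) (a x k) = tp k by rewrite /a /= last_cat.
have mem_l x l y : last x l = y -> y \in x :: l by move=> <-; exact: mem_last.
have [ru rv rw] : [/\ r != u, r != v & r != w].
  split.
  - have := duw u (mem_head _ _); apply: contraNneq => <-; exact: mem_head.
  - have := dvw v (mem_head _ _); apply: contraNneq => <-; exact: mem_head.
  - have := duw w (mem_l _ _ _ _ luw); apply: contraNneq => <-; exact: mem_head.
have [uv uw vw] : [/\ u != v, u != w & v != w].
  split.
  - have := duw u (mem_head _ _); apply: contraNneq => ->; exact: mem_l lv.
  - have := duv u (mem_head _ _); apply: contraNneq => ->; exact: mem_l lw.
  - have := duv v (mem_l _ _ _ _ luv); apply: contraNneq => ->; exact: mem_l lw.
have inj x y : x != y -> f x != f y.
  by apply: contra_neq; exact: (drawing_vertex_inj pd).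
have nt (k k' : 'I_4) : k != k' -> tp k != tp k'.
  by apply: contra_neq => -[/eqP]; rewrite eqr_nat => /eqP/val_inj.
have sym x l y l' : {in x :: l, forall b : V, b \notin y :: l'} ->
    {in y :: l', forall b, b \notin x :: l}.
  by move=> h b hb; apply/negP => /h; rewrite hb.
clearbody a.
apply: (@no_asteroid_polygons R H (f r) (f u) (f v) (f w) (a r (inord 0))
  (a u (inord 1)) (a v (inord 2)) (a w (inord 3))
  (walk_poly G r pu) (walk_poly G r pv) (walk_poly G r pw)
  (walk_poly G u quv) (walk_poly G u quw) (walk_poly G v qvw));
  rewrite ?lasta ?(last_walk_poly Gend) //; try by congr f.
- by rewrite /= !inE !negb_or !inj.
- by rewrite /= !inE !negb_or !nt // -val_eqE /= !inordK.
- move=> y; rewrite !(inE, mem_cat).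
  repeat case/orP; try (by move=> /eqP->; exact: ltW); try exact: low; try exact: lowa.
- exact: W2.
- exact: W2.
- exact: W2.
- by apply: W1 => //; apply: contraTN (mem_head r pw) => /duv.
- by apply: W1 => //; apply: contraTN (mem_head r pv) => /duw.
- by apply: W1 => //; apply: contraTN (mem_head r pu) => /dvw.
- by apply: W1 => //; apply: (sym _ _ _ _ duv); exact: mem_l.
- by apply: W1 => //; apply: (sym _ _ _ _ duw); exact: mem_l.
- by apply: W1 => //; apply: (sym _ _ _ _ dvw); exact: mem_l.
- by apply: W1' => //; apply: duw; exact: mem_head.
- by apply: W1' => //; apply: duv; exact: mem_head.
- by apply: W1' => //; apply: dvw; exact: mem_head.
- by apply: W1' => //; apply: duv; exact: mem_l.
- by apply: W1' => //; apply: dvw; exact: mem_l.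
- by apply: W1' => //; apply: duw; exact: mem_l.
Qed.

End NoAsteroid.

Lemma outerplanar_asteroid_free (R : realType) (V : finType) (e : rel V) :
  outerplanar R e -> asteroid_free e.
Proof.
move=> [f [g [pd [F [hF hb cl]]]]] r u v w Pu Pv Pw.
move=> /walk_withinP[pu [p1 l1 s1]] /walk_withinP[pv [p2 l2 s2]].
move=> /walk_withinP[pw [p3 l3 s3]] /walk_withinP[quv [p4 l4 s4]].
move=> /walk_withinP[quw [p5 l5 s5]] /walk_withinP[qvw [p6 l6 s6]].
have avoid (P : {set V}) (p q : seq V) : {subset p <= P} ->
    {subset q <= finset.setC P} -> {in q, forall x, x \notin p}.
  by move=> hp hq x /hq; rewrite !inE; apply: contra => /hp.
exact: (walks_no_asteroid pd hF hb cl p1 p2 p3 p4 p5 p6 l1 l2 l3 l4 l5 l6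
  (avoid _ _ _ s3 s4) (avoid _ _ _ s2 s5) (avoid _ _ _ s1 s6)).
Qed.

Theorem theorem2 (R : realType) :
  exists (C : R) (A : forall V : finType, nat -> query_alg V),
    forall (V : finType) (n Delta : nat) (e : rel V),
      #|V| = n ->
      simple_graph e ->
      connected_graph e ->
      outerplanar R e ->
      max_degree_le e Delta ->
      always_reconstructs (gdist e) (A V Delta) /\
      expected_queries R (gdist e) (A V Delta)
        <= C * (Delta%:R * n%:R * ln (n%:R : R) ^+ 3).
Proof.
exists (cost_constant R), (fun V _ => reconstruct V) => V n Delta e <- [esym eirr] econ.
move=> /outerplanar_asteroid_free af edeg; split.
  exact: (reconstruct_correct esym eirr econ af edeg).
exact: reconstruct_expected.
Qed.
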